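(* Let $G$ and $H$ be compact Lie groups, let $G\ltimes X\xleftarrow{\lambda}Z\xrightarrow{\rho}H\ltimes Y$ be a bibundle, and let $\mathcal{A}$ be a coefficient system on $\Pi((G\times H)\ltimes Z)$. Then there is a coefficient system $\lambda_*\mathcal{A}$ on $\Pi(G\ltimes X)$ (a pushforward coefficient system) such that $\lambda^*\lambda_*\mathcal{A}$ is naturally isomorphic to $\mathcal{A}$. Moreover, any two such pushforward coefficient systems are naturally isomorphic.
   Context: Conventions: manifolds are smooth without boundary, all groups are compact Lie groups, actions are smooth, subgroups are closed. For $G$ acting on the left on a manifold $X$, the action groupoid $G\ltimes X$ has object space $X$ and arrow space $G\times X$, with $(g,x)\colon x\to gx$. An equivariant functor $\varphi\colon G\ltimes X\to H\ltimes Y$ is a smooth functor of the form $(g,x)\mapsto(\widetilde\varphi(g),\varphi(x))$ with $\widetilde\varphi\colon G\to H$ a Lie group homomorphism; equivalently, a smooth map $\varphi\colon X\to Y$ with $\varphi(gx)=\widetilde\varphi(g)\varphi(x)$. Bibundles. For $G$ acting on $X$ and $H$ acting on $Y$ on the left, a bibundle $G\ltimes X\xleftarrow{\lambda}Z\xrightarrow{\rho}H\ltimes Y$ is a manifold $Z$ with commuting left $G$-action and right $H$-action, a $G$-equivariant map $\lambda\colon Z\to X$ that is a principal $H$-bundle (surjective submersion, $H$-invariant, and $H\times Z\to Z\times_XZ$, $(h,z)\mapsto(z,zh^{-1})$ is a diffeomorphism), and a smooth map $\rho\colon Z\to Y$ that is $G$-invariant and satisfies $\rho(zh^{-1})=h\rho(z)$.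 Regard $Z$ as a left $(G\times H)$-manifold by $(g,h)\cdot z=gzh^{-1}$; then $\lambda\colon(G\times H)\ltimes Z\to G\ltimes X$ is an equivariant functor with $\widetilde\lambda=\mathrm{pr}_1$. Fundamental groupoid. $\Pi(G\ltimes X)$ is the following category. Objects: $G$-maps $x_H\colon G/H\to X$, $H\le G$ closed; equivalently pairs $(H,x)$ with $x=x_H(H)\in X^H$. Arrows $x_H\to y_K$: equivalence classes $[\overline g,p]$ of pairs of a $G$-map $\overline g\colon G/H\to G/K$, $aH\mapsto agK$ (so $g^{-1}Hg\le K$), and a continuous path $p\colon[0,1]\to X^H$ from $x$ to $gy$. Pairs $(\overline g_0,p_0)$, $(\overline g_1,p_1)$ are equivalent if there are a $G$-homotopy $\Psi\colon G/H\times[0,1]\to G/K$, $\Psi(aH,t)=ag_tK$, from $\overline g_0$ to $\overline g_1$ and a continuous $\Phi\colon[0,1]^2\to X^H$ with $\Phi(s,0)=p_0(s)$, $\Phi(s,1)=p_1(s)$, $\Phi(0,t)=x$, $\Phi(1,t)=y_K(\Psi(H,t))$. Units: $[\overline{1_G},x]$ (constant path). The composite of $[\overline g_0,p_0]\colon x_H\to y_K$ followed by $[\overline g_1,p_1]\colon y_K\to z_L$ is $[\overline{g_0g_1},p_0*(g_0p_1)]$. An equivariant functor $\varphi$ induces $\Pi\varphi$: $x_K\mapsto\varphi(x)_{\widetilde\varphi(K)}$, $[\overline g,p]\mapsto[\overline{\widetilde\varphi(g)},\varphi\circ p]$. A coefficient system on $\Pi(G\ltimes X)$ is a contravariant functor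 $\Pi(G\ltimes X)\to\mathbf{Ab}$. The pullback along $\varphi$ is $\varphi^*\mathcal{B}:=\mathcal{B}\circ\Pi\varphi$. *)

(* Defs.v *)
From HB Require Import structures.
From mathcomp Require Import all_boot all_order all_algebra generic_quotient.
From mathcomp Require Import all_classical all_reals all_analysis.
From mathcomp Require Import lra.

Set Implicit Arguments.
Unset Strict Implicit.
Unset Printing Implicit Defensive.

Import Order.TTheory GRing.Theory Num.Theory.
Import numFieldNormedType.Exports.

Local Open Scope classical_set_scope.
Local Open Scope ring_scope.
Local Open Scope quotient_scope.

Lemma open_setX {T T' : topologicalType} (A : set T) (B : set T') :
  open A -> open B -> open (A `*` B).
Proof.
rewrite !openE => oA oB [x y] [/= Ax By].
by exists (A, B); [split; [exact: oA|exact: oB]|].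
Qed.

Lemma hausdorff_setX (T U : topologicalType) :
  hausdorff_space T -> hausdorff_space U -> hausdorff_space (T * U)%type.
Proof.
move=> hT hU [x y] [x' y'] cl; congr pair; [apply: hT|apply: hU] => A B nA nB.
  have [] := cl (A `*` setT) (B `*` setT).
  - by exists (A, setT); [split=> //; exact: filterT|].
  - by exists (B, setT); [split=> //; exact: filterT|].
  by move=> [z t] [[/= Az _] [/= Bz _]]; exists z.
have [] := cl (setT `*` A) (setT `*` B).
- by exists (setT, A); [split=> //; exact: filterT|].
- by exists (setT, B); [split=> //; exact: filterT|].
by move=> [z t] [[/= _ Az] [/= _ Bz]]; exists t.
Qed.

Lemma continuous_pair {T U V : topologicalType} (f : T -> U) (g : T -> V) :
  continuous f -> continuous g -> continuous (fun x => (f x, g x)).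
Proof. by move=> cf cg x; apply: cvg_pair; [exact: cf|exact: cg]. Qed.

Lemma continuous_comp2 {T U V W : topologicalType} (h : U * V -> W)
    (f : T -> U) (g : T -> V) : continuous h ->
  continuous f -> continuous g -> continuous (fun x => h (f x, g x)).
Proof.
move=> ch cf cg x; apply: (cvg_comp (fun x => (f x, g x)) h); last exact: ch.
exact: continuous_pair.
Qed.

Lemma continuous_comp1 {T U V : topologicalType} (h : U -> V) (f : T -> U) :
  continuous h -> continuous f -> continuous (fun x => h (f x)).
Proof. by move=> ch cf x; apply: (cvg_comp f h); [exact: cf|exact: ch]. Qed.

Lemma continuous_fst {T U : topologicalType} : continuous (@fst T U).
Proof. by move=> x; exact: cvg_fst. Qed.

Lemma continuous_snd {T U : topologicalType} : continuous (@snd T U).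
Proof. by move=> x; exact: cvg_snd. Qed.

Lemma within_retract {T S : topologicalType} (A : set T) (r : T -> T)
    (f : T -> S) : continuous r -> (forall x, A (r x)) ->
  {within A, continuous f} -> continuous (f \o r).
Proof.
move=> cr Ar /subspace_continuousP cf x.
apply: (cvg_comp r f) (cf _ (Ar x)) => B /= nB.
have h : nbhs x (r @^-1` [set y | A y -> B y]) := cr x _ nB.
suff : nbhs x (r @^-1` B) by [].
by apply: filterS h => y /= /(_ (Ar y)).
Qed.

Lemma within_eq {T S : topologicalType} (A : set T) (f g : T -> S) :
  (forall x, A x -> f x = g x) -> continuous g -> {within A, continuous f}.
Proof.
move=> fg cg; apply: (@subspace_eq_continuous _ _ _ (g : subspace A -> S)).
  by move=> x /set_mem Ax; apply/esym; exact: fg.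
exact: continuous_subspaceT.
Qed.

Section Smooth.
Context {R : realType}.

(** C^k maps on an open set [U]; meant for finite-dimensional [V] and [W]. *)
Fixpoint Ck (k : nat) {V W : normedModType R} (U : set V) (f : V -> W) : Prop :=
  if k is k'.+1 then
    (forall x, U x -> differentiable f x) /\ (forall v, Ck k' U ('D_v f))
  else forall x, U x -> {for x, continuous f}.

Definition smooth_on {V W : normedModType R} (U : set V) (f : V -> W) : Prop :=
  forall k, Ck k U f.

Lemma near_differentiable {V W : normedModType R} (f g : V -> W) x :
  (\near x, f x = g x) -> differentiable f x -> differentiable g x.
Proof.
move=> fg dfx; have fgx : f x = g x by exact: nbhs_singleton fg.
have main : g \o shift x = cst (g x) + 'd f x +o_ 0 id.
  apply/eqaddoP => e e0.
  have /eqaddoP /(_ e e0) := diff_locally dfx.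
  have fg0 : \forall h \near (0 : V), f (h + x) = g (h + x).
    have sx : h + x @[h --> (0 : V)] --> x.
      by rewrite -{2}(add0r x); apply: cvgD; [exact: cvg_id|exact: cvg_cst].
    exact: sx fg.
  by apply: filterS2 fg0 => h /= fgh; rewrite -fgx /= !fctE /= fgh.
apply/diff_locallyP; have cf : continuous ('d f x) by exact: diff_continuous.
by rewrite (diff_unique cf main).
Unshelve. all: by end_near. Qed.

Lemma eq_Ck k {V W : normedModType R} (U : set V) (f g : V -> W) :
  open U -> (forall x, U x -> f x = g x) -> Ck k U f -> Ck k U g.
Proof.
move=> oU; have nU x : U x -> nbhs x U by move=> Ux; apply: open_nbhs_nbhs.
elim: k f g => [|k IHk] f g fg /=.
  move=> cf x Ux; have nfg : \near x, f x = g x by apply: filterS (nU _ Ux).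
  suff : g @ x --> g x by [].
  by rewrite -(fg _ Ux); apply: cvg_trans (cf _ Ux); exact: near_eq_cvg.
have nfg x : U x -> \near x, f x = g x by move=> Ux; apply: filterS (nU _ Ux).
move=> [df Df]; split=> [x Ux|v].
  exact: near_differentiable (nfg _ Ux) (df _ Ux).
by apply: IHk (Df v) => x Ux; apply: near_eq_derive; exact: nfg.
Qed.

Lemma Ck_prod k {V V' W W' : normedModType R} (U : set V) (U' : set V')
    (f : V -> W) (f' : V' -> W') : open U -> open U' ->
  Ck k U f -> Ck k U' f' -> Ck k (U `*` U') (fun u => (f u.1, f' u.2)).
Proof.
move=> oU oU'; elim: k f f' => [|k IHk] f f' /=.
  move=> cf cf' [x y] [/= Ux Uy]; apply: cvg_pair => /=.
    exact: (cvg_comp fst f cvg_fst (cf _ Ux)).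
  exact: (cvg_comp snd f' cvg_snd (cf' _ Uy)).
move=> [df Df] [df' Df'].
have dfst (u : V * V') : differentiable (fst : V * V' -> V) u.
  by apply: linear_differentiable => v; exact: cvg_fst.
have dsnd (u : V * V') : differentiable (snd : V * V' -> V') u.
  by apply: linear_differentiable => v; exact: cvg_snd.
have d1 u : (U `*` U') u -> differentiable (f \o fst) u.
  by move=> [Uu _]; apply: differentiable_comp => //; exact: df.
have d2 u : (U `*` U') u -> differentiable (f' \o snd) u.
  by move=> [_ Uu]; apply: differentiable_comp => //; exact: df'.
split=> [u Uu|v]; first exact: differentiable_pair (d1 _ Uu) (d2 _ Uu).
apply: (@eq_Ck _ _ _ _ (fun u => ('D_(v.1) f u.1, 'D_(v.2) f' u.2))).
- exact: open_setX.
- move=> u Uu; rewrite [RHS]deriveE; last first.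
    exact: differentiable_pair (d1 _ Uu) (d2 _ Uu).
  rewrite (diff_pair (d1 _ Uu) (d2 _ Uu)) /=; case: (Uu) => U1 U2.
  rewrite (diff_comp (dfst u) (df _ U1)) (diff_comp (dsnd u) (df' _ U2)) /=.
  have c1 : continuous (fst : V * V' -> V) by move=> ?; exact: cvg_fst.
  have c2 : continuous (snd : V * V' -> V') by move=> ?; exact: cvg_snd.
  by rewrite (diff_lin _ c1) (diff_lin _ c2) !deriveE//; [exact: df'|exact: df].
- exact: (IHk ('D_(v.1) f) ('D_(v.2) f')).
Qed.

Lemma smooth_on_prod {V V' W W' : normedModType R} (U : set V) (U' : set V')
    (f : V -> W) (f' : V' -> W') : open U -> open U' ->
  smooth_on U f -> smooth_on U' f' ->
  smooth_on (U `*` U') (fun u => (f u.1, f' u.2)).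
Proof. by move=> oU oU' sf sf' k; exact: (Ck_prod oU oU' (sf k) (sf' k)). Qed.

End Smooth.

Record chart {R : realType} (E : normedModType R) (M : topologicalType) :=
  Chart {
    cdom : set M;
    cmap : M -> E;
    cinv : E -> M;
    cdom_open : open cdom;
    cimg_open : open (cmap @` cdom);
    cmapK : forall x, cdom x -> cinv (cmap x) = x;
    cmap_continuous : forall x, cdom x -> {for x, continuous cmap};
    cinv_continuous : forall x, cdom x -> {for cmap x, continuous cinv};
  }.

(** The model space [E] is ['rV[R]_n] for an n-dimensional manifold, and a
    product of such spaces for a product of manifolds. *)
HB.mixin Record isManifold (R : realType) (E : normedModType R) M
    & Topological M := {
  atlas : set (chart E M);
  atlas_cover : forall x : M, exists2 c, atlas c & cdom c x;
  atlas_smooth : forall c d, atlas c -> atlas d ->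
    smooth_on (cmap c @` (cdom c `&` cdom d)) (cmap d \o cinv c);
  manifold_hausdorff : hausdorff_space M;
  manifold_second_countable : @second_countable M;
}.

#[short(type="manifoldType")]
HB.structure Definition Manifold (R : realType) (E : normedModType R) :=
  {M of isManifold R E M & Topological M}.

Section ProductManifold.
Context {R : realType} {E F : normedModType R}.
Context (M : manifoldType E) (N : manifoldType F).

Section ProductChart.
Variables (c : chart E M) (d : chart F N).

Let dom : set (M * N) := cdom c `*` cdom d.
Let map (u : M * N) : E * F := (cmap c u.1, cmap d u.2).
Let inv (u : E * F) : M * N := (cinv c u.1, cinv d u.2).

Let dom_open : open dom.
Proof. by apply: open_setX; exact: cdom_open. Qed.

Lemma img_setX (A : set M) (B : set N) :
  map @` (A `*` B) = (cmap c @` A) `*` (cmap d @` B).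
Proof.
apply/seteqP; split=> [_ [[x y] [/= Ax By] <-]|[u v]].
  by split; [exists x|exists y].
by move=> [[x Ax /= <-] [y By /= <-]]; exists (x, y).
Qed.

Let img_open : open (map @` dom).
Proof. by rewrite img_setX; apply: open_setX; exact: cimg_open. Qed.

Let mapK u : dom u -> inv (map u) = u.
Proof. by case: u => x y [/= cx dy]; rewrite /inv /= !cmapK. Qed.

Let map_continuous u : dom u -> {for u, continuous map}.
Proof.
case: u => x y [/= cx dy]; apply: cvg_pair => /=.
  exact: (cvg_comp fst (cmap c) cvg_fst (cmap_continuous cx)).
exact: (cvg_comp snd (cmap d) cvg_snd (cmap_continuous dy)).
Qed.

Let inv_continuous u : dom u -> {for map u, continuous inv}.
Proof.
case: u => x y [/= cx dy]; apply: cvg_pair => /=.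
  exact: (cvg_comp fst (cinv c) cvg_fst (cinv_continuous cx)).
exact: (cvg_comp snd (cinv d) cvg_snd (cinv_continuous dy)).
Qed.

Definition prod_chart : chart (E * F)%type (M * N)%type :=
  Chart dom_open img_open mapK map_continuous inv_continuous.

End ProductChart.

Let prod_atlas : set (chart (E * F)%type (M * N)%type) :=
  [set e | exists c d, [/\ atlas c, atlas d & e = prod_chart c d]].

Let prod_atlas_cover (u : M * N) : exists2 c, prod_atlas c & cdom c u.
Proof.
case: u => x y; have [c ac cx] := atlas_cover x.
have [d ad dy] := atlas_cover y.
by exists (prod_chart c d); first by exists c, d.
Qed.

Lemma chart_overlap_open (G : normedModType R) (P : manifoldType G)
  (c d : chart G P) : open (cmap c @` (cdom c `&` cdom d)).
Proof.
rewrite openE => _ [x [cx dx] <-].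
have ox : nbhs x (cdom c `&` cdom d).
  by apply: open_nbhs_nbhs; split=> //; apply: openI; exact: cdom_open.
have /(cinv_continuous cx) nx : nbhs (cinv c (cmap c x)) (cdom c `&` cdom d).
  by rewrite cmapK.
have nc : nbhs (cmap c x) (cmap c @` cdom c).
  by apply: open_nbhs_nbhs; split; [exact: cimg_open|exists x].
suff: nbhs (cmap c x) (cmap c @` (cdom c `&` cdom d)) by [].
apply: filterS2 (nx : nbhs (cmap c x) _) nc => u /= cdu [y cy yu].
by exists y => //; move: cdu; rewrite -yu cmapK.
Qed.

Let prod_atlas_smooth c d : prod_atlas c -> prod_atlas d ->
  smooth_on (cmap c @` (cdom c `&` cdom d)) (cmap d \o cinv c).
Proof.
move=> [c1 [c2 [ac1 ac2 ->]]] [d1 [d2 [ad1 ad2 ->]]] /=.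
rewrite -setXI img_setX.
apply: (smooth_on_prod (f := cmap d1 \o cinv c1) (f' := cmap d2 \o cinv c2)).
- exact: chart_overlap_open.
- exact: chart_overlap_open.
- exact: atlas_smooth.
- exact: atlas_smooth.
Qed.

Let prod_hausdorff : hausdorff_space (M * N)%type.
Proof. by apply: hausdorff_setX; exact: manifold_hausdorff. Qed.

Let prod_second_countable : @second_countable (M * N)%type.
Proof.
have [A cA [oA bA]] := @manifold_second_countable R E M.
have [B cB [oB bB]] := @manifold_second_countable R F N.
exists [set C.1 `*` C.2 | C in A `*` B].
  exact: sub_countable (card_image_le _ _) (countableX cA cB).
split=> [_ [[U V] [/= AU BV] <-]|[x y] W [[U V] [/= nU nV] UVW]].
  by apply: open_setX; [exact: oA|exact: oB].
have [U' [AU' U'x] sU] := bA _ _ nU; have [V' [BV' V'y] sV] := bB _ _ nV.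
exists (U' `*` V'); first by split=> //; exists (U', V').
by move=> [z t] [/= /sU Uz /sV Vt]; exact: UVW.
Qed.

HB.instance Definition _ := isManifold.Build R (E * F)%type (M * N)%type
  prod_atlas_cover prod_atlas_smooth prod_hausdorff prod_second_countable.

End ProductManifold.

Section SmoothMap.
Context {R : realType} {E F : normedModType R}.
Context {M : manifoldType E} {N : manifoldType F}.

Definition smooth_at (f : M -> N) (x : M) : Prop :=
  exists c d, exists U : set M,
    [/\ atlas c, atlas d, open U, U x &
     [/\ U `<=` cdom c, (forall y, U y -> cdom d (f y)) &
         smooth_on (cmap c @` U) (cmap d \o f \o cinv c)]].

Definition smooth (f : M -> N) : Prop := forall x, smooth_at f x.

(** Smoothness of a map defined on a subset [A] of a manifold; for an embedded
    submanifold [A] it is smoothness for the induced structure. *)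
Definition smooth_within (A : set M) (f : M -> N) : Prop :=
  forall x, A x -> exists g : M -> N,
    smooth_at g x /\ \forall y \near x, A y -> f y = g y.

Definition submersion (f : M -> N) : Prop :=
  smooth f /\
  forall c d x, atlas c -> atlas d -> cdom c x -> cdom d (f x) ->
    forall w : F, exists v : E,
      'd (cmap d \o f \o cinv c) (cmap c x) v = w.

Lemma smooth_at_continuous (f : M -> N) x :
  smooth_at f x -> {for x, continuous f}.
Proof.
move=> [c [d [U [ac ad oU Ux [Uc Ud sf]]]]].
have h : nbhs x U by exact: open_nbhs_nbhs.
have cfx : {for cmap c x, continuous (cmap d \o f \o cinv c)}.
  by apply: (sf 0%N); exists x.
have Kx := cmapK (Uc _ Ux); have dfx := Ud _ Ux.
have {}cfx : (cmap d \o f \o cinv c) @ cmap c x --> cmap d (f x).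
  by move: cfx; rewrite /prop_for /continuous_at /= Kx.
have cd : cinv d @ cmap d (f x) --> f x.
  by have := cinv_continuous dfx; rewrite /prop_for /continuous_at cmapK.
suff : f @ x --> f x by [].
have := cvg_comp _ _ (cvg_comp _ _ (cmap_continuous (Uc _ Ux)) cfx) cd.
apply: cvg_trans; apply: near_eq_cvg; apply: filterS h => y Uy /=.
by rewrite (cmapK (Uc _ Uy)) cmapK//; exact: Ud.
Qed.

Lemma smooth_continuous (f : M -> N) : smooth f -> continuous f.
Proof. by move=> sf x; apply: smooth_at_continuous. Qed.

End SmoothMap.

HB.mixin Record isCompactGroup G & Topological G & Group G := {
  mulg_continuous : continuous (fun u : G * G => (u.1 * u.2)%g);
  invg_continuous : continuous (fun x : G => x^-1%g);
  compactg : compact [set: G];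
  hausdorffg : hausdorff_space G;
}.

#[short(type="compactGroupType")]
HB.structure Definition CompactGroup :=
  {G of isCompactGroup G & Topological G & Group G}.

HB.mixin Record isLieGroup (R : realType) (E : normedModType R) G
    & Manifold R E G & Group G := {
  mulg_smooth : smooth (fun u : G * G => (u.1 * u.2)%g);
  invg_smooth : smooth (fun x : G => x^-1%g);
}.

#[short(type="compactLieGroupType")]
HB.structure Definition CompactLieGroup (R : realType) (E : normedModType R) :=
  {G of isLieGroup R E G & Manifold R E G & CompactGroup G}.

Section ProductGroup.
Variables G H : compactGroupType.

Let prod_mul : continuous (fun u : (G * H) * (G * H) => (u.1 * u.2)%g).
Proof.
apply: continuous_pair.
  apply: (continuous_comp2 (@mulg_continuous G)).
    by apply: continuous_comp1; exact: continuous_fst.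
  by apply: continuous_comp1; [exact: continuous_fst|exact: continuous_snd].
apply: (continuous_comp2 (@mulg_continuous H)).
  by apply: continuous_comp1; [exact: continuous_snd|exact: continuous_fst].
by apply: continuous_comp1; exact: continuous_snd.
Qed.

Let prod_inv : continuous (fun u : G * H => u^-1%g).
Proof.
apply: continuous_pair; apply: continuous_comp1.
- exact: invg_continuous.
- exact: continuous_fst.
- exact: invg_continuous.
- exact: continuous_snd.
Qed.

Let prod_compact : compact [set: G * H].
Proof. by rewrite -setXTT; apply: compact_setX; exact: compactg. Qed.

Let prod_hausdorff : hausdorff_space (G * H)%type.
Proof. by apply: hausdorff_setX; exact: hausdorffg. Qed.

HB.instance Definition _ := isCompactGroup.Build (G * H)%type
  prod_mul prod_inv prod_compact prod_hausdorff.

End ProductGroup.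

Record closed_subgroup (G : compactGroupType) := ClosedSubgroup {
  csg :> G -> Prop;
  csg_closed : closed (csg : set G);
  csg1 : csg 1%g;
  csgM : forall a b, csg a -> csg b -> csg (a * b)%g;
  csgV : forall a, csg a -> csg a^-1%g;
}.

Section Orbit.
Context {G : compactGroupType}.
Implicit Types H K L : closed_subgroup G.

Definition coset_eq K (a b : G) : bool := `[< K (a^-1 * b)%g >].

Lemma coset_eq_refl K : reflexive (coset_eq K).
Proof. by move=> a; apply/asboolP; rewrite mulVg; exact: csg1. Qed.

Lemma coset_eq_sym K : symmetric (coset_eq K).
Proof.
move=> a b; apply/asboolP/asboolP => /csgV; by rewrite invgM invgK.
Qed.

Lemma coset_eq_trans K : transitive (coset_eq K).
Proof.
move=> b a c /asboolP Kab /asboolP Kbc; apply/asboolP.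
by have := csgM Kab Kbc; rewrite mulgA mulgK.
Qed.

Definition coset_equiv K : equiv_rel G :=
  EquivRel _ (@coset_eq_refl K) (@coset_eq_sym K) (@coset_eq_trans K).

Definition orbit K : Type := {eq_quot (coset_equiv K)}.

HB.instance Definition _ K := Quotient.on (orbit K).
HB.instance Definition _ K :=
  Topological.copy (orbit K) (quotient_topology (orbit K)).
HB.instance Definition _ K := Quotient.on (orbit K).

Definition coset K (a : G) : orbit K := \pi_(orbit K)%qT a.

Lemma coset_eqP K a b : coset K a = coset K b <-> K (a^-1 * b)%g.
Proof.
split=> [/eqmodP/asboolP //|Kab]; apply/eqmodP; exact/asboolP.
Qed.

Lemma coset_repr K (c : orbit K) : coset K (repr c) = c.
Proof. exact: reprK. Qed.

Lemma repr_coset K a : K (a^-1 * repr (coset K a))%g.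
Proof. by apply/coset_eqP; rewrite coset_repr. Qed.

Lemma coset_continuous K : continuous (coset K).
Proof. exact: pi_continuous. Qed.

Definition translate K (a : G) (c : orbit K) : orbit K :=
  coset K (a * repr c)%g.

(** The map G/H -> G/K, aH |-> agK; it is well defined as soon as
    [g^-1 H g] is contained in [K]. *)
Definition orbit_map H K (g : G) (c : orbit H) : orbit K :=
  coset K (repr c * g)%g.

Definition subconj H K (g : G) : Prop :=
  forall h, H h -> K (g^-1 * h * g)%g.

Lemma translate_coset K a b : translate a (coset K b) = coset K (a * b)%g.
Proof.
apply/esym/coset_eqP; rewrite invgM -mulgA mulKg; exact: repr_coset.
Qed.

Lemma orbit_map_coset H K g a : subconj H K g ->
  orbit_map K g (coset H a) = coset K (a * g)%g.
Proof.
move=> sg; apply/esym/coset_eqP; rewrite invgM -mulgA.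
by have := sg _ (repr_coset H a); rewrite !mulgA.
Qed.

Lemma orbit_map_continuous H K g : subconj H K g ->
  continuous (@orbit_map H K g).
Proof.
move=> sg; apply/quotient_continuous.
rewrite (_ : _ \o _ = coset K \o (fun a => a * g)%g); last first.
  by apply/funext => a; exact: orbit_map_coset.
apply: (continuous_comp1 (@coset_continuous K)).
apply: (continuous_comp2 (@mulg_continuous G)); first by move=> x.
by move=> x; exact: cvg_cst.
Qed.

Lemma nbhs_coset K (c : orbit K) (U : set G) :
  nbhs (repr c) U -> nbhs c (coset K @` U).
Proof.
rewrite nbhsE => -[U' [oU' U'c] sU].
rewrite nbhsE; exists (coset K @` U'); last by move=> _ [a /sU Ua <-]; exists a.
split; last by exists (repr c); rewrite ?coset_repr.
suff : open (coset K @^-1` (coset K @` U')) by [].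
have -> : coset K @^-1` (coset K @` U') =
    \bigcup_(k in (K : set G)) ((fun a => a * k)%g @^-1` U').
  apply/seteqP; split=> [a [b U'b /esym /coset_eqP Kab]|a [k Kk U'ak]] /=.
    by exists (a^-1 * b)%g => //=; rewrite mulVKg.
  exists (a * k)%g => //; apply/esym/coset_eqP; by rewrite mulKg.
apply: bigcup_open => k _; apply: open_comp => // a _.
by apply: (continuous_comp2 (@mulg_continuous G)) => u;
  [exact: cvg_id|exact: cvg_cst].
Qed.

Lemma translate_continuous K :
  continuous (fun u : G * orbit K => translate u.1 u.2).
Proof.
move=> [a c] W nW.
have cm : continuous (fun u : G * G => coset K (u.1 * u.2)%g).
  exact: continuous_comp1 (@coset_continuous K) (@mulg_continuous G).
have [[U V] [/= nU nV] UVW] := cm (a, repr c) _ nW.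
exists (U, coset K @` V); first by split=> //=; exact: nbhs_coset.
move=> [a' _] [/= Ua' [b Vb <-]].
by rewrite /= translate_coset; exact: (UVW (a', b)).
Qed.

End Orbit.

Record gspace (G : compactGroupType) := GSpace {
  gspace_sort :> topologicalType;
  act : G -> gspace_sort -> gspace_sort;
  act1 : forall x, act 1%g x = x;
  actM : forall a b x, act (a * b)%g x = act a (act b x);
  act_continuous : continuous (fun u : G * gspace_sort => act u.1 u.2);
}.

Section Interval.
Context {R : realType}.

Definition unitI : set R := `[0, 1].

Definition clamp (s : R) : R := Order.max 0 (Order.min s 1).

Lemma unitIP s : unitI s <-> 0 <= s <= 1.
Proof. by rewrite /unitI /= in_itv. Qed.

Lemma clamp_unitI s : unitI (clamp s).
Proof.
apply/unitIP; rewrite /clamp le_max lexx /= ge_max ler01 /=.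
by rewrite ge_min lexx orbT.
Qed.

Lemma clampE s : unitI s -> clamp s = s.
Proof. by move=> /unitIP/andP[s0 s1]; rewrite /clamp (min_l s1) (max_r s0). Qed.

Lemma clamp0 : clamp 0 = 0.
Proof. by apply: clampE; apply/unitIP; rewrite lexx ler01. Qed.

Lemma clamp1 : clamp 1 = 1.
Proof. by apply: clampE; apply/unitIP; rewrite lexx ler01. Qed.

Lemma continuous_rmin (f g : R -> R) : continuous f -> continuous g ->
  continuous (fun s => Order.min (f s) (g s)).
Proof.
by move=> cf cg s; apply: (@continuous_min _ _ (f : R -> R^o) (g : R -> R^o));
  [exact: cf|exact: cg].
Qed.

Lemma continuous_rmax (f g : R -> R) : continuous f -> continuous g ->
  continuous (fun s => Order.max (f s) (g s)).
Proof.
by move=> cf cg s; apply: (@continuous_max _ _ (f : R -> R^o) (g : R -> R^o));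
  [exact: cf|exact: cg].
Qed.

Lemma clamp_continuous : continuous clamp.
Proof.
apply: continuous_rmax; first by move=> s; exact: cvg_cst.
by apply: continuous_rmin => s; [exact: cvg_id|exact: cvg_cst].
Qed.

Lemma continuous_paste {T S : topologicalType} (k : T -> R) (c : R)
    (f g : T -> S) : continuous k -> continuous f -> continuous g ->
  (forall x, k x = c -> f x = g x) ->
  continuous (fun x => if k x <= c then f x else g x).
Proof.
move=> ck cf cg fg; apply/continuous_subspace_setT.
have -> : [set: T] = k @^-1` [set x | x <= c] `|` k @^-1` [set x | c <= x].
  apply/seteqP; split=> x // _ /=.
  by case: (lerP (k x) c) => [|/ltW]; [left|right].
have ck' : {in setT, continuous k} by move=> ? ?; exact: ck.
apply: withinU_continuous.
- by apply: closed_comp => //; exact: closed_le.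
- by apply: closed_comp => //; exact: closed_ge.
- by apply: within_eq cf => x /= ->.
- apply: within_eq cg => x /= cx; case: ifP => // xc; apply: fg.
  by apply/eqP; rewrite eq_le xc.
Qed.

End Interval.

Arguments unitI {R}.

(** The fundamental groupoid only depends on the underlying topological group
    and on the continuity of the action, so it is built in that generality. *)

Section FundamentalGroupoid.
Context (R : realType) {G : compactGroupType} (X : gspace G).

(** A pair (H, x) with x in X^H, i.e. the G-map G/H -> X, aH |-> ax. *)
Record pi_ob := PiOb {
  ob_grp : closed_subgroup G;
  ob_pt : X;
  ob_fixed : forall h, ob_grp h -> act h ob_pt = ob_pt;
}.

Implicit Types x y z : pi_ob.

Definition fixed (H : closed_subgroup G) : set X :=
  [set u | forall h, H h -> act h u = u].

(** The G-map G/K -> X, aK |-> ay. *)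
Definition ob_map y (c : orbit (ob_grp y)) : X := act (repr c) (ob_pt y).

(** A pair of a G-map G/H -> G/K, aH |-> agK, given by a representative [g],
    and of a path in X^H from x to gy. Representatives of the same G-map yield
    equivalent pairs, see [homotopy]. *)
Record pre_arrow x y := PreArrow {
  arr_g : G;
  arr_path : R -> X;
  arr_subconj : subconj (ob_grp x) (ob_grp y) arr_g;
  arr_continuous : {within unitI, continuous arr_path};
  arr_fixed : forall s, unitI s -> fixed (ob_grp x) (arr_path s);
  arr_path0 : arr_path 0 = ob_pt x;
  arr_path1 : arr_path 1 = act arr_g (ob_pt y);
}.

Definition arr_map x y (a : pre_arrow x y) :
    orbit (ob_grp x) -> orbit (ob_grp y) :=
  orbit_map (ob_grp y) (arr_g a).

(** [Psi] is a G-homotopy between the two G-maps and [Phi] is a compatible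
    homotopy of paths in X^H: its endpoint at time [t] is the image of
    [Psi (H, t)] under the G-map G/K -> X. *)
Record homotopy x y (a b : pre_arrow x y)
    (Psi : orbit (ob_grp x) * R -> orbit (ob_grp y)) (Phi : R * R -> X) :
    Prop :=
  Homotopy {
    hPsi_continuous : {within setT `*` unitI, continuous Psi};
    hPsi_equivariant : forall g c t, unitI t ->
      Psi (translate g c, t) = translate g (Psi (c, t));
    hPsi0 : forall c, Psi (c, 0) = arr_map a c;
    hPsi1 : forall c, Psi (c, 1) = arr_map b c;
    hPhi_continuous : {within unitI `*` unitI, continuous Phi};
    hPhi_fixed : forall s t, unitI s -> unitI t ->
      fixed (ob_grp x) (Phi (s, t));
    hPhi_0 : forall s, unitI s -> Phi (s, 0) = arr_path a s;
    hPhi_1 : forall s, unitI s -> Phi (s, 1) = arr_path b s;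
    hPhi0_ : forall t, unitI t -> Phi (0, t) = ob_pt x;
    hPhi1_ : forall t, unitI t ->
      Phi (1, t) = ob_map (Psi (coset (ob_grp x) 1%g, t));
  }.

Definition homotopic x y (a b : pre_arrow x y) : Prop :=
  exists Psi Phi, homotopy a b Psi Phi.

Record global_homotopy x y (a b : pre_arrow x y)
    (Psi : orbit (ob_grp x) * R -> orbit (ob_grp y)) (Phi : R * R -> X) :
    Prop :=
  GlobalHomotopy {
    gPsi_continuous : continuous Psi;
    gPsi_equivariant : forall g c t,
      Psi (translate g c, t) = translate g (Psi (c, t));
    gPsi0 : forall c, Psi (c, 0) = arr_map a c;
    gPsi1 : forall c, Psi (c, 1) = arr_map b c;
    gPhi_continuous : continuous Phi;
    gPhi_fixed : forall s t, fixed (ob_grp x) (Phi (s, t));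
    gPhi_0 : forall s, Phi (s, 0) = arr_path a (clamp s);
    gPhi_1 : forall s, Phi (s, 1) = arr_path b (clamp s);
    gPhi0_ : forall t, Phi (0, t) = ob_pt x;
    gPhi1_ : forall t, Phi (1, t) = ob_map (Psi (coset (ob_grp x) 1%g, t));
  }.

Lemma homotopic_global x y (a b : pre_arrow x y) :
  homotopic a b -> exists Psi Phi, global_homotopy a b Psi Phi.
Proof.
move=> [Psi [Phi [cS eS S0 S1 cF fF F0 F1 F_0 F_1]]].
exists (Psi \o (fun u => (u.1, clamp u.2))).
exists (Phi \o (fun u => (clamp u.1, clamp u.2))).
have cl (T T' : topologicalType) (f : T -> T') (k : T -> R) :
    continuous k -> continuous (fun u => clamp (k u)).
  exact: (continuous_comp1 (@clamp_continuous R)).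
split=> [|g c t|c|c||s t|s|s|t|t]; rewrite /= ?clamp0 ?clamp1.
- apply: within_retract cS; last by move=> u; split=> //; exact: clamp_unitI.
  apply: continuous_pair; first exact: continuous_fst.
  by apply: (continuous_comp1 (@clamp_continuous R)); exact: continuous_snd.
- by apply: eS; exact: clamp_unitI.
- exact: S0.
- exact: S1.
- apply: within_retract cF; last by move=> u; split; exact: clamp_unitI.
  apply: continuous_pair; apply: (continuous_comp1 (@clamp_continuous R)).
    exact: continuous_fst.
  exact: continuous_snd.
- by apply: fF; exact: clamp_unitI.
- by apply: F0; exact: clamp_unitI.
- by apply: F1; exact: clamp_unitI.
- by apply: F_0; exact: clamp_unitI.
- by apply: F_1; exact: clamp_unitI.
Qed.

Lemma global_homotopic x y (a b : pre_arrow x y) Psi Phi :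
  global_homotopy a b Psi Phi -> homotopic a b.
Proof.
move=> [cS eS S0 S1 cF fF F0 F1 F_0 F_1]; exists Psi, Phi; split=> //.
- exact: continuous_subspaceT.
- exact: continuous_subspaceT.
- by move=> s Is; rewrite F0 clampE.
- by move=> s Is; rewrite F1 clampE.
Qed.

Definition ext_path x y (a : pre_arrow x y) (s : R) : X := arr_path a (clamp s).

Lemma ext_path_continuous x y (a : pre_arrow x y) : continuous (ext_path a).
Proof.
exact: (within_retract (@clamp_continuous R) (@clamp_unitI R)
  (@arr_continuous _ _ a)).
Qed.

Lemma ext_path_fixed x y (a : pre_arrow x y) s :
  fixed (ob_grp x) (ext_path a s).
Proof. by apply: arr_fixed; exact: clamp_unitI. Qed.

Lemma act_coset (K : closed_subgroup G) a b (u : X) :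
  fixed K u -> coset K a = coset K b -> act a u = act b u.
Proof.
move=> fu /coset_eqP Kab; rewrite -[in RHS](mulVKg a b).
by rewrite actM (fu _ Kab).
Qed.

Lemma act_repr (K : closed_subgroup G) a (u : X) :
  fixed K u -> act (repr (coset K a)) u = act a u.
Proof. by move=> fu; apply: (act_coset fu); rewrite coset_repr. Qed.

Lemma ob_map_coset y a : ob_map (coset (ob_grp y) a) = act a (ob_pt y).
Proof. exact: act_repr (ob_fixed (p := y)). Qed.

Lemma ob_map_translate y a c :
  ob_map (y := y) (translate a c) = act a (ob_map c).
Proof. by rewrite /translate ob_map_coset actM. Qed.

Lemma homotopic_reparam x y (a b : pre_arrow x y) (u : R -> R) :
  arr_g a = arr_g b -> continuous u -> (forall s, unitI s -> unitI (u s)) ->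
  u 0 = 0 -> u 1 = 1 ->
  (forall s, unitI s -> arr_path b s = arr_path a (u s)) -> homotopic a b.
Proof.
move=> gab cu Iu u0 u1 ab.
pose v (w : R * R) : R := (1 - w.2) * w.1 + w.2 * u w.1.
have cv : continuous v.
  move=> w; apply: cvgD; apply: cvgM.
  - by apply: cvgB; [exact: cvg_cst|exact: cvg_snd].
  - exact: cvg_fst.
  - exact: cvg_snd.
  - by apply: (cvg_comp fst u); [exact: cvg_fst|exact: cu].
have Iv s t : unitI s -> unitI t -> unitI (v (s, t)).
  move=> Is It; have := Iu _ Is; move: Is It.
  move=> /unitIP/andP[? ?] /unitIP/andP[? ?] /unitIP/andP[? ?].
  by apply/unitIP; rewrite /v /=; apply/andP; split; nra.
exists (fun w => arr_map a w.1), (fun w => ext_path a (v w)); split=> //=.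
- apply: continuous_subspaceT; apply: continuous_comp1 continuous_fst.
  exact: orbit_map_continuous (arr_subconj a).
- move=> g c t _; rewrite /arr_map -(coset_repr c) translate_coset.
  rewrite !(orbit_map_coset _ (arr_subconj a)).
  by rewrite translate_coset mulgA.
- by move=> c; rewrite /arr_map gab.
- apply: continuous_subspaceT; apply: continuous_comp1 cv.
  exact: ext_path_continuous.
- by move=> s t Is It; exact: ext_path_fixed.
- by move=> s Is; rewrite /ext_path /v /= subr0 mul1r mul0r addr0 clampE.
- move=> s Is; rewrite /ext_path /v /= subrr mul0r mul1r add0r.
  rewrite clampE; last exact: Iu.
  by rewrite ab.
- by move=> t It; rewrite /ext_path /v /= u0 !mulr0 addr0 clamp0 arr_path0.
- move=> t It; rewrite /ext_path /v /= u1 !mulr1 subrK clamp1 arr_path1.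
  by rewrite /arr_map (orbit_map_coset _ (arr_subconj a)) mul1g ob_map_coset.
Qed.

Lemma homotopic_refl x y (a : pre_arrow x y) : homotopic a a.
Proof. by apply: (@homotopic_reparam _ _ _ _ id) => //; move=> ?. Qed.

Lemma homotopic_sym x y (a b : pre_arrow x y) : homotopic a b -> homotopic b a.
Proof.
move=> /homotopic_global[Psi [Phi [cS eS S0 S1 cF fF F0 F1 F_0 F_1]]].
have cr : continuous (fun t : R => 1 - t).
  by move=> t; apply: cvgB; [exact: cvg_cst|exact: cvg_id].
apply: (@global_homotopic _ _ _ _ (fun u => Psi (u.1, 1 - u.2))
                                 (fun u => Phi (u.1, 1 - u.2))).
split=> //=.
- apply: continuous_comp1 cS _; apply: continuous_pair.
    exact: continuous_fst.
  by apply: continuous_comp1 cr _; exact: continuous_snd.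
- by move=> c; rewrite subr0.
- by move=> c; rewrite subrr.
- apply: continuous_comp1 cF _; apply: continuous_pair.
    exact: continuous_fst.
  by apply: continuous_comp1 cr _; exact: continuous_snd.
- by move=> s; rewrite subr0.
- by move=> s; rewrite subrr.
Qed.

Lemma homotopic_trans x y (a b c : pre_arrow x y) :
  homotopic a b -> homotopic b c -> homotopic a c.
Proof.
move=> /homotopic_global[Psi [Phi [cS eS S0 S1 cF fF F0 F1 F_0 F_1]]].
move=> /homotopic_global[Psi' [Phi']].
move=> [cS' eS' S0' S1' cF' fF' F0' F1' F_0' F_1'].
have c1 : continuous (fun t : R => 2 * t).
  by move=> t; apply: cvgM; [exact: cvg_cst|exact: cvg_id].
have c2 : continuous (fun t : R => 2 * t - 1).
  by move=> t; apply: cvgB; [exact: c1|exact: cvg_cst].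
have e1 : 2 * 2^-1 = 1 :> R by rewrite divff.
have e2 : (1 <= 2^-1 :> R) = false by apply/negbTE; rewrite -ltNge; lra.
have e3 : (0 <= 2^-1 :> R) by lra.
have cc (T : topologicalType) (h : R -> R) : continuous h ->
    continuous (fun u : T * R => (u.1, h u.2)).
  move=> ch; apply: continuous_pair; first exact: continuous_fst.
  by apply: (continuous_comp1 ch); exact: continuous_snd.
apply: (@global_homotopic _ _ _ _
  (fun u => if u.2 <= 2^-1 then Psi (u.1, 2 * u.2) else Psi' (u.1, 2 * u.2 - 1))
  (fun u => if u.2 <= 2^-1 then Phi (u.1, 2 * u.2)
            else Phi' (u.1, 2 * u.2 - 1))).
split=> /=.
- apply: continuous_paste; first exact: continuous_snd.
  + exact: continuous_comp1 cS (cc _ _ c1).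
  + exact: continuous_comp1 cS' (cc _ _ c2).
  + by move=> [d t] /= ->; rewrite e1 subrr S1 S0'.
- by move=> g d t; case: ifP.
- by move=> d; rewrite e3 mulr0.
- by move=> d; rewrite e2 mulr1 -{1}[2]/(1 + 1) addrK.
- apply: continuous_paste; first exact: continuous_snd.
  + exact: continuous_comp1 cF (cc _ _ c1).
  + exact: continuous_comp1 cF' (cc _ _ c2).
  + by move=> [d t] /= ->; rewrite e1 subrr F1 F0'.
- by move=> s t; case: ifP.
- by move=> s; rewrite e3 mulr0.
- by move=> s; rewrite e2 mulr1 -{1}[2]/(1 + 1) addrK.
- by move=> t; case: ifP.
- by move=> t; case: ifP.
Qed.

End FundamentalGroupoid.

Section Composition.
Context (R : realType) {G : compactGroupType} (X : gspace G).
Implicit Types x y z : pi_ob X.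
Local Notation pre_arrow := (@pre_arrow R G X).

Lemma subconjM (H K L : closed_subgroup G) a b :
  subconj H K a -> subconj K L b -> subconj H L (a * b)%g.
Proof. by move=> sa sb h /sa/sb; rewrite invgM !mulgA. Qed.

Lemma subconj1 (H : closed_subgroup G) : subconj H H 1%g.
Proof. by move=> h; rewrite invg1 mul1g mulg1. Qed.

Lemma act_fixed (H K : closed_subgroup G) a (u : X) :
  subconj H K a -> fixed K u -> fixed H (act a u).
Proof.
move=> sa fu h /sa Kh; rewrite -actM.
have -> : (h * a = a * (a^-1 * h * a))%g by rewrite -mulgA mulVKg.
by rewrite actM (fu _ Kh).
Qed.

Lemma act_cst_continuous a : continuous (act a : X -> X).
Proof.
apply: (continuous_comp2 (@act_continuous _ X)) => u; first exact: cvg_cst.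
exact: cvg_id.
Qed.

Section Concat.
Variables (p q : R -> X).

Definition concat (s : R) : X :=
  if s <= 2^-1 then p (2 * s) else q (2 * s - 1).

Lemma concat0 : concat 0 = p 0.
Proof. by rewrite /concat (_ : 0 <= _); [rewrite mulr0|lra]. Qed.

Lemma concat1 : concat 1 = q 1.
Proof.
rewrite /concat ifF; last by apply/negbTE; rewrite -ltNge; lra.
by congr q; lra.
Qed.

Lemma concat_continuous : continuous p -> continuous q -> p 1 = q 0 ->
  continuous concat.
Proof.
move=> cp cq pq; apply: continuous_paste.
- by move=> s; exact: cvg_id.
- refine (@continuous_comp1 R R X p (fun t : R => 2 * t) cp _) => t.
  by apply: cvgM; [exact: cvg_cst|exact: cvg_id].
- refine (@continuous_comp1 R R X q (fun t : R => 2 * t - 1) cq _) => t.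
  apply: cvgB; last exact: cvg_cst.
  by apply: cvgM; [exact: cvg_cst|exact: cvg_id].
- by move=> s ->; rewrite divff// subrr.
Qed.

End Concat.

Lemma unitI_left (s : R) : unitI s -> s <= 2^-1 -> unitI (2 * s).
Proof. by move=> /unitIP/andP[? ?] ?; apply/unitIP/andP; split; lra. Qed.

Lemma unitI_right (s : R) : unitI s -> s <= 2^-1 = false -> unitI (2 * s - 1).
Proof.
move=> /unitIP/andP[? ?] /negbT; rewrite -ltNge => ?.
by apply/unitIP/andP; split; lra.
Qed.

Lemma concat_ext (p q p' q' : R -> X) s : unitI s ->
  (forall s, unitI s -> p s = p' s) -> (forall s, unitI s -> q s = q' s) ->
  concat p q s = concat p' q' s.
Proof.
move=> Is pp' qq'; rewrite /concat; case: ifPn => [sl|/negbTE sr].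
  by rewrite pp'//; exact: unitI_left.
by rewrite qq'//; exact: unitI_right.
Qed.

Section PreComp.
Context x y z (a : pre_arrow x y) (b : pre_arrow y z).

Let g : G := (arr_g a * arr_g b)%g.
Let p : R -> X := concat (arr_path a) (act (arr_g a) \o arr_path b).

Let g_subconj : subconj (ob_grp x) (ob_grp z) g.
Proof. exact: subconjM (arr_subconj a) (arr_subconj b). Qed.

Let p_continuous : {within unitI, continuous p}.
Proof.
apply: (@within_eq _ _ _ _ (concat (ext_path a) (act (arr_g a) \o ext_path b))).
  by move=> s Is; apply: concat_ext => // t It /=; rewrite /ext_path clampE.
apply: concat_continuous; first exact: ext_path_continuous.
  apply: continuous_comp1; first exact: act_cst_continuous.
  exact: ext_path_continuous.
by rewrite /ext_path /= clamp0 clamp1 arr_path0 arr_path1.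
Qed.

Let p_fixed s : unitI s -> fixed (ob_grp x) (p s).
Proof.
move=> Is; rewrite /p /concat; case: ifPn => [sl|/negbTE sr].
  by apply: arr_fixed; exact: unitI_left.
by apply: act_fixed (arr_subconj a) _; apply: arr_fixed; exact: unitI_right.
Qed.

Let p0 : p 0 = ob_pt x.
Proof. by rewrite /p concat0 arr_path0. Qed.

Let p1 : p 1 = act g (ob_pt z).
Proof. by rewrite /p concat1 /= arr_path1 actM. Qed.

Definition pre_comp : pre_arrow x z :=
  PreArrow g_subconj p_continuous p_fixed p0 p1.

End PreComp.

Section PreId.
Variable x : pi_ob X.

Let p (s : R) : X := ob_pt x.

Let p_continuous : {within unitI, continuous p}.
Proof. by apply: continuous_subspaceT => s; exact: cvg_cst. Qed.

Let p_fixed s : unitI s -> fixed (ob_grp x) (p s).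
Proof. by move=> _; exact: ob_fixed. Qed.

Let p1 : p 1 = act 1%g (ob_pt x).
Proof. by rewrite act1. Qed.

Definition pre_id : pre_arrow x x :=
  PreArrow (@subconj1 (ob_grp x)) p_continuous p_fixed erefl p1.

End PreId.

Lemma repr_act_continuous (T : topologicalType) (K : closed_subgroup G)
    (q : T -> orbit K) (f : T -> X) : continuous q -> continuous f ->
  (forall t, fixed K (f t)) -> continuous (fun t => act (repr (q t)) (f t)).
Proof.
move=> cq cf ff t W /= nW.
have : nbhs (repr (q t), f t) ((fun u : G * X => act u.1 u.2) @^-1` W).
  exact: (@act_continuous _ X (repr (q t), f t)).
case=> -[U V] /= [nU nV] UVW.
have nq : nbhs (q t) (coset K @` U) by exact: nbhs_coset.
have n1 : nbhs t (q @^-1` (coset K @` U)) := cq t _ nq.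
have n2 : nbhs t (f @^-1` V) := cf t _ nV.
suff : nbhs t ((fun t => act (repr (q t)) (f t)) @^-1` W) by [].
apply: filterS2 n1 n2 => s /= [a Ua qs] Vs.
by rewrite -qs (act_repr _ (ff s)); exact: (UVW (a, f s)).
Qed.

Lemma pre_comp_homotopic x y z (a a' : pre_arrow x y) (b b' : pre_arrow y z) :
  homotopic a a' -> homotopic b b' ->
  homotopic (pre_comp a b) (pre_comp a' b').
Proof.
move=> /homotopic_global[Psi [Phi [cS eS S0 S1 cF fF F0 F1 F_0 F_1]]].
move=> /homotopic_global[Psi' [Phi']].
move=> [cS' eS' S0' S1' cF' fF' F0' F1' F_0' F_1'].
pose e := coset (ob_grp x) 1%g; pose e' := coset (ob_grp y) 1%g.
pose r (t : R) := repr (Psi (e, t)).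
have re t : Psi (e, t) = translate (r t) e'.
  by rewrite translate_coset mulg1 coset_repr.
have sr t : subconj (ob_grp x) (ob_grp y) (r t).
  move=> h xh; rewrite -mulgA; apply/coset_eqP; rewrite -translate_coset.
  rewrite coset_repr -eS translate_coset mulg1; congr (Psi (_, _)).
  by apply/coset_eqP; rewrite invg1 mul1g.
have comp_map (c : pre_arrow x y) (d : pre_arrow y z) w :
    arr_map (pre_comp c d) w = arr_map d (arr_map c w).
  rewrite /arr_map -(coset_repr w) (orbit_map_coset _ (arr_subconj c)).
  rewrite (orbit_map_coset _ (arr_subconj d)).
  by rewrite (orbit_map_coset _ (arr_subconj (pre_comp c d))) mulgA.
have arr_r (c : pre_arrow x y) t (u : X) : fixed (ob_grp y) u ->
    Psi (e, t) = arr_map c e -> act (r t) u = act (arr_g c) u.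
  move=> fu; rewrite /r => ->.
  by rewrite /arr_map (orbit_map_coset _ (arr_subconj c)) mul1g (act_repr _ fu).
pose Sigma (w : orbit (ob_grp x) * R) := Psi' (Psi w, w.2).
pose Theta (w : R * R) := if w.1 <= 2^-1 then Phi (2 * w.1, w.2)
                          else act (r w.2) (Phi' (2 * w.1 - 1, w.2)).
have c2 (T : topologicalType) (k : T -> R) :
    continuous k -> continuous (fun t => 2 * k t).
  by move=> ck t; apply: cvgM; [exact: cvg_cst|exact: ck].
exists Sigma, Theta; split.
- apply: continuous_subspaceT; apply: (continuous_comp2 cS'); first exact: cS.
  exact: continuous_snd.
- by move=> h c t _; rewrite /Sigma eS eS'.
- by move=> c; rewrite /Sigma S0 S0' comp_map.
- by move=> c; rewrite /Sigma S1 S1' comp_map.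
- apply: continuous_subspaceT; apply: continuous_paste.
  + exact: continuous_fst.
  + apply: (continuous_comp2 cF); last exact: continuous_snd.
    exact: c2 continuous_fst.
  + apply: repr_act_continuous => [||w]; last exact: fF'.
      apply: (continuous_comp2 cS); last exact: continuous_snd.
      by move=> w; exact: cvg_cst.
    apply: (continuous_comp2 cF'); last exact: continuous_snd.
    by move=> w; apply: cvgB; [exact: c2 continuous_fst _|exact: cvg_cst].
  + move=> w ->; rewrite divff// subrr F_1 F_0' re ob_map_translate.
    by rewrite ob_map_coset act1.
- move=> s t Is It; rewrite /Theta; case: ifP => _; first exact: fF.
  exact: act_fixed (sr t) (fF' _ _).
- move=> s Is; rewrite /Theta /=; case: ifPn => [sl|/negbTE sr'].
    by rewrite F0 clampE; [rewrite /concat sl|exact: unitI_left].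
  rewrite F0' clampE; last exact: unitI_right.
  rewrite (@arr_r a) ?S0//; first by rewrite /concat sr'.
  by apply: arr_fixed; exact: unitI_right.
- move=> s Is; rewrite /Theta /=; case: ifPn => [sl|/negbTE sr'].
    by rewrite F1 clampE; [rewrite /concat sl|exact: unitI_left].
  rewrite F1' clampE; last exact: unitI_right.
  rewrite (@arr_r a') ?S1//; first by rewrite /concat sr'.
  by apply: arr_fixed; exact: unitI_right.
- by move=> t It; rewrite /Theta /= (_ : 0 <= _); [rewrite mulr0 F_0|lra].
- move=> t It; rewrite /Theta /= ifF; last by apply/negbTE; rewrite -ltNge; lra.
  have -> : 2 * 1 - 1 = 1 :> R by lra.
  by rewrite F_1' /Sigma /= re eS' ob_map_translate.
Qed.

Lemma pre_comp_assoc w x y z (a : pre_arrow w x) (b : pre_arrow x y)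
    (c : pre_arrow y z) :
  homotopic (pre_comp a (pre_comp b c)) (pre_comp (pre_comp a b) c).
Proof.
pose u (s : R) := Order.min (Order.min (2 * s) (s + 4^-1)) ((s + 1) / 2).
have c2 : continuous (fun s : R => 2 * s).
  by move=> t; apply: cvgM; [exact: cvg_cst|exact: cvg_id].
have c3 : continuous (fun s : R => s + 4^-1).
  by move=> t; apply: cvgD; [exact: cvg_id|exact: cvg_cst].
have c4 : continuous (fun s : R => (s + 1) / 2).
  move=> t; apply: cvgM; last exact: cvg_cst.
  by apply: cvgD; [exact: cvg_id|exact: cvg_cst].
have u1 s : s <= 4^-1 -> u s = 2 * s.
  by move=> ?; rewrite /u min_l; [rewrite min_l//; lra|rewrite min_l; lra].
have u2 s : 4^-1 <= s -> s <= 2^-1 -> u s = s + 4^-1.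
  by move=> ? ?; rewrite /u min_l; [rewrite min_r//; lra|rewrite min_r; lra].
have u3 s : 2^-1 <= s -> u s = (s + 1) / 2.
  by move=> ?; rewrite /u min_r// min_r; lra.
apply: (@homotopic_reparam _ _ _ _ _ _ _ u).
- by rewrite /= mulgA.
- by apply: continuous_rmin c4; exact: continuous_rmin c2 c3.
- move=> s /unitIP/andP[s0 s1]; apply/unitIP/andP.
  have [s4|s4] := lerP s 4^-1; first by rewrite u1//; split; lra.
  have [s2|s2] := lerP s 2^-1; first by rewrite u2//; [split; lra|exact: ltW].
  by rewrite u3//; [split; lra|exact: ltW].
- by rewrite u1 ?mulr0//; lra.
- by rewrite u3; lra.
- move=> s /unitIP/andP[s0 s1] /=; rewrite /concat /=.
  have [s2|s2] := lerP s 2^-1; last first.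
    rewrite u3; last exact: ltW.
    rewrite ifF; last by apply/negbTE; rewrite -ltNge; lra.
    rewrite ifF; last by apply/negbTE; rewrite -ltNge; lra.
    by rewrite actM; congr (act _ (act _ (arr_path c _))); lra.
  have [s4|s4] := lerP (2 * s) 2^-1.
    by rewrite u1; [rewrite ifT//; congr arr_path; lra|lra].
  rewrite u2; [|lra|lra].
  rewrite ifF; last by apply/negbTE; rewrite -ltNge; lra.
  by rewrite ifT; [congr (act _ (arr_path b _)); lra|lra].
Qed.

Lemma pre_comp1l x y (a : pre_arrow x y) : homotopic a (pre_comp (pre_id x) a).
Proof.
pose u (s : R) := Order.max 0 (2 * s - 1).
apply: (@homotopic_reparam _ _ _ _ _ _ _ u).
- by rewrite /= mul1g.
- apply: continuous_rmax => s; first exact: cvg_cst.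
  apply: cvgB; last exact: cvg_cst.
  by apply: cvgM; [exact: cvg_cst|exact: cvg_id].
- move=> s /unitIP/andP[s0 s1]; apply/unitIP/andP; rewrite /u.
  by have [?|?] := lerP 0 (2 * s - 1); split; lra.
- by rewrite /u max_l; lra.
- by rewrite /u max_r; lra.
- move=> s /unitIP/andP[s0 s1] /=; rewrite /concat /u /=.
  have [s2|s2] := lerP s 2^-1; first by rewrite max_l ?arr_path0//; lra.
  by rewrite act1 max_r//; lra.
Qed.

Lemma pre_comp1r x y (a : pre_arrow x y) : homotopic a (pre_comp a (pre_id y)).
Proof.
pose u (s : R) := Order.min (2 * s) 1.
apply: (@homotopic_reparam _ _ _ _ _ _ _ u).
- by rewrite /= mulg1.
- apply: continuous_rmin => s.
    by apply: cvgM; [exact: cvg_cst|exact: cvg_id].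
  exact: cvg_cst.
- move=> s /unitIP/andP[s0 s1]; apply/unitIP/andP; rewrite /u.
  by have [?|?] := lerP (2 * s) 1; split; lra.
- by rewrite /u min_l; lra.
- by rewrite /u min_r; lra.
- move=> s /unitIP/andP[s0 s1] /=; rewrite /concat /u /=.
  have [s2|s2] := lerP s 2^-1; first by rewrite min_l//; lra.
  by rewrite min_r ?arr_path1//; lra.
Qed.

End Composition.

Record category := Category {
  obj :> Type;
  hom : obj -> obj -> Type;
  idm : forall x, hom x x;
  (* [cmp f g] is [f] followed by [g] *)
  cmp : forall x y z, hom x y -> hom y z -> hom x z;
  cmp1m : forall x y (f : hom x y), cmp (idm x) f = f;
  cmpm1 : forall x y (f : hom x y), cmp f (idm y) = f;
  cmpA : forall w x y z (f : hom w x) (g : hom x y) (h : hom y z),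
    cmp f (cmp g h) = cmp (cmp f g) h;
}.
Arguments idm {c}.

Record functor (C D : category) := Functor {
  fobj :> C -> D;
  fmap : forall x y, hom x y -> hom (fobj x) (fobj y);
  fmap_id : forall x, fmap (idm x) = idm (fobj x);
  fmap_cmp : forall x y z (f : hom x y) (g : hom y z),
    fmap (cmp f g) = cmp (fmap f) (fmap g);
}.

Record coefficient_system (C : category) := CoefficientSystem {
  coef :> C -> zmodType;
  coef_map : forall x y : C, hom x y -> {additive coef y -> coef x};
  coef_id : forall (x : C) (m : coef x), coef_map (idm x) m = m;
  coef_cmp : forall (x y z : C) (f : hom x y) (g : hom y z) (m : coef z),
    coef_map (cmp f g) m = coef_map f (coef_map g m);
}.

Section Pullback.
Context {C D : category} (F : functor C D) (B : coefficient_system D).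

Let pmap (x y : C) (f : hom x y) : {additive B (F y) -> B (F x)} :=
  coef_map B (fmap F f).

Let pmap_id (x : C) (m : B (F x)) : pmap (idm x) m = m.
Proof. by rewrite /pmap fmap_id coef_id. Qed.

Let pmap_cmp (x y z : C) (f : hom x y) (g : hom y z) (m : B (F z)) :
  pmap (cmp f g) m = pmap f (pmap g m).
Proof. by rewrite /pmap fmap_cmp coef_cmp. Qed.

Definition pullback : coefficient_system C :=
  @CoefficientSystem C (fun x => B (F x)) pmap pmap_id pmap_cmp.

End Pullback.

Definition naturally_isomorphic {C : category} (A B : coefficient_system C) :
    Prop :=
  exists theta : forall x : C, {additive A x -> B x},
    (forall x, bijective (theta x)) /\
    (forall (x y : C) (f : hom x y) (m : A y),
       theta x (coef_map A f m) = coef_map B f (theta y m)).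

Section PiCategory.
Context (R : realType) {G : compactGroupType} (X : gspace G).
Implicit Types x y z : pi_ob X.

HB.instance Definition _ x y := gen_eqMixin (pre_arrow R x y).
HB.instance Definition _ x y := gen_choiceMixin (pre_arrow R x y).

Definition homotopicb x y (a b : pre_arrow R x y) : bool :=
  `[< homotopic a b >].

Lemma homotopicb_refl x y : reflexive (@homotopicb x y).
Proof. by move=> a; apply/asboolP; exact: homotopic_refl. Qed.

Lemma homotopicb_sym x y : symmetric (@homotopicb x y).
Proof. by move=> a b; apply/asboolP/asboolP; exact: homotopic_sym. Qed.

Lemma homotopicb_trans x y : transitive (@homotopicb x y).
Proof.
move=> b a c /asboolP ab /asboolP bc; apply/asboolP.
exact: homotopic_trans ab bc.
Qed.

Definition homotopic_equiv x y : equiv_rel (pre_arrow R x y) :=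
  EquivRel _ (@homotopicb_refl x y) (@homotopicb_sym x y)
    (@homotopicb_trans x y).

Definition arrow x y : Type := {eq_quot (homotopic_equiv x y)}.

HB.instance Definition _ x y := Quotient.on (arrow x y).

Definition arrow_class x y (a : pre_arrow R x y) : arrow x y :=
  \pi_(arrow x y) a.

Lemma arrow_eqP x y (a b : pre_arrow R x y) :
  arrow_class a = arrow_class b <-> homotopic a b.
Proof. by split=> [/eqmodP/asboolP //|ab]; apply/eqmodP/asboolP. Qed.

Lemma arrow_repr x y (f : arrow x y) : arrow_class (repr f) = f.
Proof. exact: reprK. Qed.

Definition arrow_comp x y z (f : arrow x y) (g : arrow y z) : arrow x z :=
  arrow_class (pre_comp (repr f) (repr g)).

Lemma arrow_comp_class x y z (a : pre_arrow R x y) (b : pre_arrow R y z) :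
  arrow_comp (arrow_class a) (arrow_class b) = arrow_class (pre_comp a b).
Proof.
by apply/arrow_eqP/pre_comp_homotopic; apply/arrow_eqP; exact: arrow_repr.
Qed.

Let arrow_id x : arrow x x := arrow_class (pre_id R x).

Let comp1m x y (f : arrow x y) : arrow_comp (arrow_id x) f = f.
Proof.
rewrite -(arrow_repr f) arrow_comp_class; apply/esym/arrow_eqP.
exact: pre_comp1l.
Qed.

Let compm1 x y (f : arrow x y) : arrow_comp f (arrow_id y) = f.
Proof.
rewrite -(arrow_repr f) arrow_comp_class; apply/esym/arrow_eqP.
exact: pre_comp1r.
Qed.

Let compA w x y z (f : arrow w x) (g : arrow x y) (h : arrow y z) :
  arrow_comp f (arrow_comp g h) = arrow_comp (arrow_comp f g) h.
Proof.
rewrite -(arrow_repr f) -(arrow_repr g) -(arrow_repr h) !arrow_comp_class.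
by apply/arrow_eqP; exact: pre_comp_assoc.
Qed.

Definition Pi : category :=
  @Category (pi_ob X) arrow arrow_id arrow_comp comp1m compm1 compA.

End PiCategory.

Definition orbit_gspace {G : compactGroupType} (K : closed_subgroup G) :
  gspace G.
Proof.
refine (@GSpace G (orbit K) (@translate G K) _ _ (@translate_continuous G K)).
- by move=> c; rewrite /translate mul1g coset_repr.
- by move=> a b c; rewrite -(coset_repr c) !translate_coset mulgA.
Defined.

(** The underlying continuous data of an equivariant functor; the functor it
    induces on fundamental groupoids only depends on it. *)
Record equivariant_functor {G H : compactGroupType} (X : gspace G)
    (Y : gspace H) := EquivariantFunctor {
  ef_hom : UMagmaMorphism.type G H;
  ef_map :> X -> Y;
  ef_hom_continuous : continuous ef_hom;
  ef_map_continuous : continuous ef_map;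
  ef_equivariant : forall g x, ef_map (act g x) = act (ef_hom g) (ef_map x);
}.

Section PiFunctor.
Context (R : realType) {G H : compactGroupType} {X : gspace G} {Y : gspace H}.
Variable phi : equivariant_functor X Y.
Local Notation f := (ef_hom phi).

Section Image.
Variable K : closed_subgroup G.

Let img : H -> Prop := fun h => exists2 k, K k & f k = h.

Let img_closed : closed (img : set H).
Proof.
apply: (compact_closed (@hausdorffg H)).
apply: continuous_compact; last first.
  apply: (subclosed_compact _ (@compactg G)) => //; exact: csg_closed.
by apply: continuous_subspaceT; exact: ef_hom_continuous.
Qed.

Let f1 : f 1%g = 1%g.
Proof. exact: gmulf1. Qed.

Let img1 : img 1%g.
Proof. by exists 1%g; [exact: csg1|]. Qed.

Let imgM a b : img a -> img b -> img (a * b)%g.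
Proof.
move=> [k Kk <-] [l Kl <-]; exists (k * l)%g; first exact: csgM.
by rewrite gmulfM.
Qed.

Let imgV a : img a -> img a^-1%g.
Proof.
by move=> [k Kk <-]; exists k^-1%g; [exact: csgV|rewrite gmulfV].
Qed.

Definition image_subgroup : closed_subgroup H :=
  ClosedSubgroup img_closed img1 imgM imgV.

End Image.

Definition pi_fobj (x : pi_ob X) : pi_ob Y.
Proof.
refine (@PiOb H Y (image_subgroup (ob_grp x)) (phi (ob_pt x)) _).
by move=> _ [k Kk <-]; rewrite -ef_equivariant (ob_fixed Kk).
Defined.

Lemma image_subconj (K L : closed_subgroup G) g : subconj K L g ->
  subconj (image_subgroup K) (image_subgroup L) (f g).
Proof.
move=> sg _ [k Kk <-]; exists (g^-1 * k * g)%g; first exact: sg.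
by rewrite !gmulfM gmulfV.
Qed.

Lemma image_fixed (K : closed_subgroup G) (u : X) :
  fixed K u -> fixed (image_subgroup K) (phi u).
Proof. by move=> fu _ [k Kk <-]; rewrite -ef_equivariant (fu _ Kk). Qed.

Section PreMap.
Context {x y : pi_ob X} (a : pre_arrow R x y).

Let p : R -> Y := phi \o arr_path a.

Let p_continuous : {within unitI, continuous p}.
Proof.
apply: (@within_eq _ _ _ _ (phi \o ext_path a)).
  by move=> s Is; rewrite /p /ext_path /= clampE.
apply: (@continuous_comp1 R X Y phi); first exact: ef_map_continuous.
exact: ext_path_continuous.
Qed.

Let p_fixed s : unitI s -> fixed (ob_grp (pi_fobj x)) (p s).
Proof. by move=> Is; apply: image_fixed; exact: arr_fixed. Qed.

Let p0 : p 0 = ob_pt (pi_fobj x).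
Proof. by rewrite /p /= arr_path0. Qed.

Let p1 : p 1 = act (f (arr_g a)) (ob_pt (pi_fobj y)).
Proof. by rewrite /p /= arr_path1 ef_equivariant. Qed.

Definition pre_map : pre_arrow R (pi_fobj x) (pi_fobj y) :=
  @PreArrow R H Y (pi_fobj x) (pi_fobj y) (f (arr_g a)) p
    (image_subconj (arr_subconj a)) p_continuous p_fixed p0 p1.

End PreMap.

Let iota (K : closed_subgroup G) (c : orbit K) : orbit (image_subgroup K) :=
  coset (image_subgroup K) (f (repr c)).

Let iota_coset K a : iota (coset K a) = coset (image_subgroup K) (f a).
Proof.
apply/esym/coset_eqP; exists (a^-1 * repr (coset K a))%g.
  exact: repr_coset.
by rewrite gmulfM gmulfV.
Qed.

Let iota_continuous K : continuous (@iota K).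
Proof.
apply/quotient_continuous.
rewrite (_ : _ \o _ = coset (image_subgroup K) \o f); last first.
  by apply/funext => a; exact: iota_coset.
apply: (continuous_comp1 (@coset_continuous _ (image_subgroup K))).
exact: ef_hom_continuous.
Qed.

Let iota_translate K a (c : orbit K) :
  iota (translate a c) = translate (f a) (iota c).
Proof.
by rewrite -(coset_repr c) translate_coset !iota_coset translate_coset gmulfM.
Qed.

Lemma pre_map_homotopic (x y : pi_ob X) (a b : pre_arrow R x y) :
  homotopic a b -> homotopic (pre_map a) (pre_map b).
Proof.
move=> /homotopic_global[Psi [Phi [cS eS S0 S1 cF fF F0 F1 F_0 F_1]]].
pose e := coset (ob_grp x) 1%g.
pose q (t : R) : orbit_gspace (image_subgroup (ob_grp y)) := iota (Psi (e, t)).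
have cq : continuous q.
  apply: (continuous_comp1 (@iota_continuous _)).
  apply: (continuous_comp2 cS); [by move=> t; exact: cvg_cst|].
  by move=> t; exact: cvg_id.
have fq t : fixed (image_subgroup (ob_grp x)) (q t).
  move=> _ [k Kk <-]; rewrite /q /= -iota_translate -eS translate_coset mulg1.
  congr (iota (Psi (_, _))); apply/esym/coset_eqP.
  by rewrite invg1 mul1g.
pose S (w : orbit (image_subgroup (ob_grp x)) * R) :
  orbit (image_subgroup (ob_grp y)) := act (repr w.1) (q w.2).
exists S, (phi \o Phi); split=> /=.
- apply: continuous_subspaceT;
  apply: (@repr_act_continuous _ (orbit_gspace (image_subgroup (ob_grp y)))
    _ _ fst (q \o snd)) => [||w].
  + exact: continuous_fst.
  + exact: (continuous_comp1 cq continuous_snd).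
  + exact: fq.
- move=> g c t _; apply: (etrans (act_repr (g * repr c)%g (fq t))).
  exact: (@actM _ (orbit_gspace _)).
- move=> c; rewrite /S /q /= S0 /arr_map (orbit_map_coset _ (arr_subconj a)).
  by rewrite mul1g iota_coset translate_coset.
- move=> c; rewrite /S /q /= S1 /arr_map (orbit_map_coset _ (arr_subconj b)).
  by rewrite mul1g iota_coset translate_coset.
- apply: continuous_subspaceT; apply: (@continuous_comp1 _ X Y phi).
    exact: ef_map_continuous.
  exact: cF.
- by move=> s t _ _; apply: image_fixed; exact: fF.
- by move=> s Is; rewrite F0 clampE.
- by move=> s Is; rewrite F1 clampE.
- by move=> t It; rewrite F_0.
- move=> t It; rewrite F_1.
  have -> : S (coset (image_subgroup (ob_grp x)) 1%g, t) = q t.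
    by apply: (etrans (act_repr 1%g (fq t))); exact: act1.
  by rewrite /q /iota ob_map_coset /= -ef_equivariant.
Qed.

Definition pi_fmap (x y : Pi R X) (h : hom x y) :
    @hom (Pi R Y) (pi_fobj x) (pi_fobj y) :=
  arrow_class (pre_map (repr (h : arrow R x y))).

Lemma pi_fmap_class (x y : pi_ob X) (a : pre_arrow R x y) :
  @pi_fmap x y (arrow_class a) = arrow_class (pre_map a).
Proof.
by apply/arrow_eqP/pre_map_homotopic; apply/arrow_eqP; exact: arrow_repr.
Qed.

Lemma pi_fmap_id (x : Pi R X) :
  pi_fmap (idm x) = @idm (Pi R Y) (pi_fobj x).
Proof.
rewrite [LHS]pi_fmap_class; apply/arrow_eqP.
apply: (@homotopic_reparam _ _ _ _ _ _ _ id) => //=; last by move=> ?.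
exact: gmulf1.
Qed.

Lemma pi_fmap_cmp (x y z : Pi R X) (h : hom x y) (k : hom y z) :
  pi_fmap (cmp h k) = @cmp (Pi R Y) _ _ _ (pi_fmap h) (pi_fmap k).
Proof.
rewrite [LHS]pi_fmap_class [RHS]arrow_comp_class; apply/arrow_eqP.
apply: (@homotopic_reparam _ _ _ _ _ _ _ id) => //=; last first.
- by move=> s _; rewrite /concat /=; case: ifP => // _; rewrite ef_equivariant.
- by move=> ?.
by rewrite gmulfM.
Qed.

Definition Pi_map : functor (Pi R X) (Pi R Y) :=
  @Functor (Pi R X) (Pi R Y) pi_fobj pi_fmap pi_fmap_id pi_fmap_cmp.

End PiFunctor.

Record gmanifold {R : realType} {E : normedModType R} (F : normedModType R)
    (G : compactLieGroupType E) := GManifold {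
  gm_sort :> manifoldType F;
  gm_act : G -> gm_sort -> gm_sort;
  gm_act1 : forall x, gm_act 1%g x = x;
  gm_actM : forall a b x, gm_act (a * b)%g x = gm_act a (gm_act b x);
  gm_act_smooth : smooth (fun u : G * gm_sort => gm_act u.1 u.2);
} as X.

Definition gmanifold_gspace {R : realType} {E F : normedModType R}
    (G : compactLieGroupType E) (X : gmanifold F G) : gspace G :=
  GSpace (gm_act1 (X := X)) (gm_actM (X := X))
    (smooth_continuous (gm_act_smooth (X := X))).

Coercion gmanifold_gspace : gmanifold >-> gspace.

(** [f] is a diffeomorphism onto the embedded submanifold [A] of [N]. *)
Definition diffeo_onto {R : realType} {E F : normedModType R}
    {M : manifoldType E} {N : manifoldType F} (A : set N) (f : M -> N) : Prop :=
  [/\ set_bij setT A f, smooth f &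
      exists2 g : N -> M, smooth_within A g & cancel f g].

Record bibundle {R : realType} {EG EH EX EY : normedModType R}
    (E : normedModType R) {G : compactLieGroupType EG}
    {H : compactLieGroupType EH} (X : gmanifold EX G) (Y : gmanifold EY H) :=
  Bibundle {
    bb_sort :> manifoldType E;
    bb_lact : G -> bb_sort -> bb_sort;
    bb_ract : bb_sort -> H -> bb_sort;
    bb_lact1 : forall z, bb_lact 1%g z = z;
    bb_lactM : forall a b z, bb_lact (a * b)%g z = bb_lact a (bb_lact b z);
    bb_lact_smooth : smooth (fun u : G * bb_sort => bb_lact u.1 u.2);
    bb_ract1 : forall z, bb_ract z 1%g = z;
    bb_ractM : forall z a b, bb_ract z (a * b)%g = bb_ract (bb_ract z a) b;
    bb_ract_smooth : smooth (fun u : bb_sort * H => bb_ract u.1 u.2);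
    bb_actC : forall g z h, bb_lact g (bb_ract z h) = bb_ract (bb_lact g z) h;
    bb_lambda : bb_sort -> X;
    bb_lambda_equivariant : forall g z,
      bb_lambda (bb_lact g z) = gm_act g (bb_lambda z);
    bb_lambda_submersion : submersion bb_lambda;
    bb_lambda_surjective : forall x, exists z, bb_lambda z = x;
    bb_lambda_invariant : forall z h, bb_lambda (bb_ract z h) = bb_lambda z;
    bb_lambda_principal :
      diffeo_onto [set u : bb_sort * bb_sort | bb_lambda u.1 = bb_lambda u.2]
        (fun u : H * bb_sort => (u.2, bb_ract u.2 u.1^-1%g));
    bb_rho : bb_sort -> Y;
    bb_rho_smooth : smooth bb_rho;
    bb_rho_invariant : forall g z, bb_rho (bb_lact g z) = bb_rho z;
    bb_rho_equivariant : forall z h,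
      bb_rho (bb_ract z h^-1%g) = gm_act h (bb_rho z);
  } as Z.

Section BibundleTheory.
Context {R : realType} {EG EH EX EY E : normedModType R}.
Context {G : compactLieGroupType EG} {H : compactLieGroupType EH}.
Context {X : gmanifold EX G} {Y : gmanifold EY H} (Z : bibundle E X Y).

Let zact (u : G * H) (z : Z) : Z := bb_ract (bb_lact u.1 z) u.2^-1%g.

Let zact1 z : zact 1%g z = z.
Proof. by rewrite /zact /= invg1 bb_ract1 bb_lact1. Qed.

Let zactM u v z : zact (u * v)%g z = zact u (zact v z).
Proof. by rewrite /zact /= bb_actC invgM bb_ractM bb_lactM. Qed.

Let zact_continuous : continuous (fun w : (G * H) * Z => zact w.1 w.2).
Proof.
apply: (continuous_comp2 (smooth_continuous (bb_ract_smooth (Z := Z)))).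
  apply: (continuous_comp2 (smooth_continuous (bb_lact_smooth (Z := Z)))).
    by apply: continuous_comp1; exact: continuous_fst.
  exact: continuous_snd.
apply: (continuous_comp1 (@invg_continuous H)).
by apply: continuous_comp1; [exact: continuous_snd|exact: continuous_fst].
Qed.

Definition bibundle_gspace : gspace (G * H)%type :=
  GSpace zact1 zactM zact_continuous.

Definition left_functor : equivariant_functor bibundle_gspace X.
Proof.
refine (@EquivariantFunctor (G * H)%type G bibundle_gspace X
  (fst : UMagmaMorphism.type (G * H)%type G) (bb_lambda (Z := Z)) _ _ _).
- exact: continuous_fst.
- by apply: smooth_continuous; case: (bb_lambda_submersion Z).
- by move=> u z /=; rewrite bb_lambda_invariant bb_lambda_equivariant.
Defined.

End BibundleTheory.

Definition is_pushforward {C D : category} (F : functor C D)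
    (A : coefficient_system C) (B : coefficient_system D) : Prop :=
  naturally_isomorphic (pullback F B) A.

(* Main.v *)
(** The functor induced by [lambda] on fundamental groupoids is full, faithful
    and surjective on objects, so every coefficient system descends along it,
    uniquely up to isomorphism.

    Fix a closed [K <= G x H] and put [Kbar = pr1 K]. Everything reduces to
    lifting paths and homotopies from [X^Kbar] to [Z^K], hence to finding local
    sections of [Z^K -> X^Kbar] through a given [z0]. Let [E z] be the maximum
    over [k] in [K] of the squared distance from [k z] to [z0] in a chart. It is
    [K]-invariant and, near [z0], strictly midpoint convex along the fibres of
    [lambda], since the orbit maps of the free [H]-action are immersions. As the
    fibres are compact and [lambda] is open and closed, [E] has a unique
    minimiser in each fibre near [z0]. It depends continuously on the base point
    and, over [X^Kbar], it is fixed by [K] because [K] preserves the fibre. *)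

From HB Require Import structures.
Require Import Defs.
From mathcomp Require Import all_boot all_order all_algebra.
From mathcomp Require Import all_classical all_reals all_analysis.
From mathcomp Require Import lra ring.

Set Implicit Arguments.
Unset Strict Implicit.
Unset Printing Implicit Defensive.

Import Order.TTheory GRing.Theory Num.Theory.
Import numFieldNormedType.Exports.

Local Open Scope classical_set_scope.
Local Open Scope ring_scope.

(** A maximum over [K] takes the place of averaging because a strict midpoint inequality valid for
    every [k] passes to it, when read at a [k] attaining the maximum at the midpoint. The price is
    that [E] is only continuous: minimisers come from compactness and not from an implicit function
    theorem, and smoothness enters only through Lipschitz and second difference bounds.

    Lifts to [Z^K] are not unique. Two lifts of one map differ by an [H]-valued map, and right
    translation by the quotient of two points of [Z^K] in one fibre preserves [Z^K]. Hence lifts can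
    be glued along edges and corrected to prescribed values on three sides of a square.

    The groups are controlled by freeness of the [H]-action: an element of [G x H] fixing a point of
    [Z] is determined by its [G]-component, so a lifted path dictates how subconjugacies and
    homotopies of orbit maps lift with it. *)

Lemma cousin (R : realType) (P : R -> R -> Prop) :
  (forall a b c, a <= b -> b <= c -> P a b -> P b c -> P a c) ->
  (forall t, 0 <= t <= 1 -> exists2 e, 0 < e & forall a b,
     0 <= a -> t - e < a -> a <= t -> t <= b -> b < t + e -> b <= 1 -> P a b) ->
  P 0 1.
Proof.
(* Continuous induction: [sup S] is reached by a short interval around it, and would be overstepped
   if it were below 1. This serves both as connectedness of the unit interval and as a Lebesgue
   number argument. *)
move=> glue loc; pose S := [set t | 0 <= t <= 1 /\ P 0 t].
have S0 : S 0.
  split; first by rewrite lexx ler01.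
  have [|e e0 He] := loc 0; first by rewrite lexx ler01.
  by apply: He; lra.
have supS : has_sup S.
  by split; [exists 0|exists 1 => t [/andP[]]].
have s01 : 0 <= sup S <= 1.
  rewrite sup_upper_bound//=; apply: ge_sup; first by exists 0.
  by move=> t [/andP[]].
have [e e0 He] := loc _ s01; case/andP: s01 => s0 s1.
have [t [/andP[t0 t1] Pt] lt_t] := sup_adherent e0 supS.
have ts : t <= sup S by apply: sup_upper_bound => //; split=> //; apply/andP.
have up b : sup S <= b -> b < sup S + e -> b <= 1 -> P 0 b.
  by move=> sb be b1; apply: (glue 0 t b) => //; [lra|apply: He].
have [|lt1] := lerP 1 (sup S + e / 2); first by move=> ?; apply: up => //; lra.
have /(sup_upper_bound supS) : S (sup S + e / 2).
  by split; [apply/andP; split; lra|apply: up; lra].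
by lra.
Qed.

(** * Mean value estimates *)

Section MeanValue.
Context {R : realType}.

(** Vector values exclude an intermediate point. Instead the bound with slope [M + e] adds up over
    adjacent intervals, and it holds on short intervals around each [t] by comparing both ends with
    [f t]. *)
Lemma mean_value_ineq (V : normedModType R) (f : R -> V) (M : R) :
  (forall t, 0 <= t <= 1 -> derivable f t 1 /\ `|'D_1 f t| <= M) ->
  `|f 1 - f 0| <= M.
Proof.
move=> df; apply/ler_addgt0Pr => e e0.
suff: `|f 1 - f 0| <= (M + e) * (1 - 0) by rewrite subr0 mulr1.
apply: (@cousin R (fun a b => `|f b - f a| <= (M + e) * (b - a))).
  move=> a b c ab bc fab fbc; rewrite -(subrKA (f b)).
  rewrite (le_trans (ler_normD _ _))//; lra.
move=> t t01; have [dt Mt] := df t t01.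
have : \forall h \near (0:R)^', `|'D_1 f t - h^-1 *: (f (h *: 1 + t) - f t)| < e.
  by move/cvgrPdist_lt : dt; apply.
rewrite near_withinE => /nbhs_normP[d /= d0 Hd]; exists d => //.
have key h : `|h| < d -> `|f (h + t) - f t| <= (M + e) * `|h|.
  move=> hd; have [->|h0] := eqVneq h 0.
    by rewrite add0r subrr !normr0 mulr0.
  have := Hd h; rewrite /ball_ /= sub0r normrN => /(_ hd h0).
  have -> : h *: (1 : R) = h by rewrite [LHS]mulr1.
  move=> lt_e.
  have le1 : `|h^-1 *: (f (h + t) - f t)| <= M + e.
    rewrite -(subrK ('D_1 f t) (_ *: _)) (le_trans (ler_normD _ _))//.
    by rewrite addrC lerD// distrC ltW.
  rewrite normrZ normfV ler_pdivrMl ?normr_gt0// in le1.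
  by rewrite mulrC.
move=> a b _ ta aT tb bt _.
have k1 := key (b - t); have k2 := key (a - t); rewrite !subrK in k1 k2.
rewrite ger0_norm ?subr_ge0// in k1; rewrite ler0_norm ?subr_le0// in k2.
have {}k1 := k1 ltac:(lra); have {}k2 := k2 ltac:(lra).
rewrite -(subrKA (f t)) (le_trans (ler_normD _ _))// distrC [X in _ + X]distrC.
have -> : (M + e) * (b - a) = (M + e) * (b - t) + (M + e) * - (a - t) by ring.
by rewrite distrC [X in _ + X]distrC (distrC (f t)) lerD.
Qed.

Lemma derive_line (V W : normedModType R) (f : V -> W) (y v : V) (t : R) :
  derivable f (y + t *: v) v ->
  is_derive t 1 (fun t : R => f (y + t *: v)) ('D_v f (y + t *: v)).
Proof.
have E : (fun h : R => h^-1 *: (f (y + (h *: 1 + t) *: v) - f (y + t *: v))) =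
   (fun h : R => h^-1 *: (f (h *: v + (y + t *: v)) - f (y + t *: v))).
  apply/funext => h; congr (_ *: (f _ - _)).
  by rewrite scalerDl addrCA [h *: 1]mulr1.
move=> df; apply: DeriveDef; first by rewrite /derivable /= E.
by rewrite /derive /= E.
Qed.

(** Bounded coordinates turn closeness of the finitely many ['D_(e i) f] into closeness of
    differentials. The form passes to products, the model spaces of product manifolds. *)
Definition fin_dim (V : normedModType R) : Prop :=
  exists (I : finType) (e : I -> V) (C : R),
    0 <= C /\ forall v, exists c : I -> R,
      v = \sum_i c i *: e i /\ forall i, `|c i| <= C * `|v|.

Lemma coord_le_norm n (v : 'rV[R]_n) i : `|v 0 i| <= `|v|.
Proof.
rewrite [in leRHS]/Num.norm /= mx_normrE.
by apply/bigmax_geP; right => /=; exists (0, i).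
Qed.

Lemma fin_dim_rV n : fin_dim 'rV[R]_n.
Proof.
exists 'I_n, (fun i => delta_mx 0 i), 1; split=> // v.
exists (fun i => v 0 i); split; first exact: row_sum_delta.
by move=> i; rewrite mul1r coord_le_norm.
Qed.

Lemma fin_dim_prod (V W : normedModType R) :
  fin_dim V -> fin_dim W -> fin_dim (V * W)%type.
Proof.
move=> [I [e [C [C0 He]]]] [J [e' [C' [C0' He']]]].
exists (I + J)%type.
exists (fun k => match k with inl i => (e i, 0) | inr j => (0, e' j) end).
exists (C + C'); split=> [|[v w]]; first exact: addr_ge0.
have [c [vE cv]] := He v; have [c' [wE cw]] := He' w.
exists (fun k => match k with inl i => c i | inr j => c' j end).
have nv : `|v| <= `|(v, w)| by rewrite prod_normE le_max lexx.
have nw : `|w| <= `|(v, w)| by rewrite prod_normE le_max lexx orbT.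
split.
  rewrite big_sumType /=.
  have E1 : \sum_(i : I) c i *: ((e i, 0) : V * W) = (v, 0).
    rewrite [in RHS]vE; elim/big_ind2 : _ => // [x x' y y' -> ->|i _].
      by rewrite -[LHS]/(_, _) /= addr0.
    by rewrite -[LHS]/(_, _) /= scaler0.
  have E2 : \sum_(j : J) c' j *: ((0, e' j) : V * W) = (0, w).
    rewrite [in RHS]wE; elim/big_ind2 : _ => // [x x' y y' -> ->|i _].
      by rewrite -[LHS]/(_, _) /= addr0.
    by rewrite -[LHS]/(_, _) /= scaler0.
  by rewrite E1 E2 -[RHS]/(_, _) /= addr0 add0r.
move=> [i|j].
- by rewrite (le_trans (cv i))// ler_pM// lerDl.
- by rewrite (le_trans (cw j))// ler_pM// lerDr.
Qed.

(** Strict differentiability: the base point [y] varies along with [v]. The mean value inequality is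
    applied on the segment from [y] to [y + v] to [f] minus its linear part at [a]. *)
Lemma Ck1_strict (V W : normedModType R) (U : set V) (f : V -> W) (a : V)
    (eps : R) : fin_dim V -> open U -> Ck 1 U f -> U a -> 0 < eps ->
  exists2 d, 0 < d & forall y v, `|y - a| < d -> `|v| < d ->
    `|f (y + v) - f y - 'd f a v| <= eps * `|v|.
Proof.
move=> [I [e [C [C0 He]]]] oU [df cf] Ua eps0.
(* There will be [#|I|] error terms of size [C * |v| * eps']; the [+ 1] keeps the denominator
   positive. *)
pose eps' := eps / (C * #|I|%:R + 1).
have D0 : 0 < C * #|I|%:R + 1 by rewrite ltr_wpDl// mulr_ge0.
have eps'0 : 0 < eps' by rewrite divr_gt0.
have : \forall x \near a, U x /\ forall i : I,
    `|'D_(e i) f a - 'D_(e i) f x| < eps'.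
  near=> x; split; first by near: x; exact: open_nbhs_nbhs.
  near: x; apply: filter_forall => i.
  have ca : 'D_(e i) f x @[x --> a] --> 'D_(e i) f a by exact: cf.
  by move/cvgrPdist_lt : ca; apply.
move=> /nbhs_normP[d /= d0 Hd]; exists (d / 2); first by rewrite divr_gt0.
move=> y v ya vd.
have yt t : 0 <= t <= 1 -> `|a - (y + t *: v)| < d.
  move=> /andP[t0 t1]; rewrite distrC -addrAC.
  rewrite (le_lt_trans (ler_normD _ _))// normrZ (ger0_norm t0).
  have : t * `|v| <= 1 * `|v| by rewrite ler_wpM2r.
  lra.
have Dbound t : 0 <= t <= 1 -> `|'D_v f (y + t *: v) - 'd f a v| <= eps * `|v|.
  move=> /yt/Hd[Ux Hx]; have [c [vE cv]] := He v.
  rewrite deriveE; last exact: df.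
  have lin x : 'd f x v = \sum_i c i *: ('d f x (e i) : W).
    by rewrite {1}vE linear_sum; apply: eq_bigr => i _; rewrite linearZ.
  rewrite !lin -sumrB (le_trans (ler_norm_sum _ _ _))//.
  apply: (@le_trans _ _ (\sum_(i : I) C * `|v| * eps')).
    apply: ler_sum => i _; rewrite -scalerBr normrZ ler_pM//.
    by rewrite -!deriveE ?ltW// 1?distrC//; exact: df.
  rewrite sumr_const -[X in X <= _]mulr_natl /eps'.
  have -> : #|I|%:R * (C * `|v| * (eps / (C * #|I|%:R + 1))) =
      eps * `|v| * (C * #|I|%:R / (C * #|I|%:R + 1)) by ring.
  rewrite ler_piMr ?mulr_ge0 ?(ltW eps0)//.
  by rewrite ler_pdivrMr// mul1r lerDl.
pose g t := f (y + t *: v) - t *: ('d f a v : W).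
have -> : f (y + v) - f y - 'd f a v = g 1 - g 0.
  by rewrite /g !scale1r !scale0r subr0 addr0 addrAC.
apply: mean_value_ineq => t t01.
have Uyt : U (y + t *: v) by case: (Hd _ (yt _ t01)).
set L : W := 'd f a v.
have dL : is_derive t 1 (fun t : R => t *: L) L.
  have /= := @derive_line W W id 0 L t (@derivable_id _ _ _ _).
  by rewrite derive_id; under eq_fun do rewrite add0r.
have dg : is_derive t 1 g ('D_v f (y + t *: v) - L).
  by apply: is_deriveB; apply: derive_line; exact/diff_derivable/df.
split; first exact: ex_derive.
by rewrite derive_val; exact: Dbound.
Unshelve. all: by end_near. Qed.

Lemma Ck1_lipschitz (V W : normedModType R) (U : set V) (f : V -> W) (a : V) :
  fin_dim V -> open U -> Ck 1 U f -> U a ->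
  exists2 C, 0 <= C & exists2 d, 0 < d & forall y v,
    `|y - a| < d -> `|v| < d -> `|f (y + v) - f y| <= C * `|v|.
Proof.
move=> fV oU Cf Ua; have [d d0 Hd] := Ck1_strict fV oU Cf Ua ltr01.
have [df _] := Cf; have [C C0 HC] := linear_lipschitz (diff_continuous (df _ Ua)).
exists (C + 1); first by rewrite addr_ge0// ltW.
exists d => // y v ya vd; rewrite -(subrK ('d f a v) (f (y + v) - f y)).
by rewrite (le_trans (ler_normD _ _))// mulrDl addrC lerD// Hd.
Qed.

(** The second difference is [g 1 - g 0] for [g t = f (y + t v) + f (y - t v)]. The derivative of
    [g] compares differentials at points [2 t v] apart, and the partial derivatives are
    Lipschitz. *)
Lemma Ck2_second_difference (V W : normedModType R) (U : set V) (f : V -> W)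
    (a : V) : fin_dim V -> open U -> Ck 2 U f -> U a ->
  exists2 C, 0 <= C & exists2 d, 0 < d & forall y v,
    `|y - a| < d -> `|v| < d ->
    `|f (y + v) + f (y - v) - 2 *: f y| <= C * `|v| ^+ 2.
Proof.
move=> fV oU [df Cf] Ua; have [I [e [C [C0 He]]]] := fV.
have /choice[L HL] : forall i, exists l : R * R,
    [/\ 0 <= l.1, 0 < l.2 & forall y v, `|y - a| < l.2 -> `|v| < l.2 ->
      `|'D_(e i) f (y + v) - 'D_(e i) f y| <= l.1 * `|v|].
  move=> i; have [K K0 [d d0 Hd]] := Ck1_lipschitz fV oU (Cf (e i)) Ua.
  by exists (K, d).
have /nbhs_normP[r /= r0 Hr] := open_nbhs_nbhs (conj oU Ua).
have nL : \forall d \near (0 : R)^'+, forall i, d < (L i).2.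
  by apply: filter_forall => i; have [_ Li0 _] := HL i; exact: nbhs_right_lt.
have [d [[dr dL] d0]] :=
  filter_ex (filterI (filterI (nbhs_right_lt r0) nL) (nbhs_right_gt 0)).
have dU x : `|x - a| < d -> U x.
  by move=> xa; apply: Hr; rewrite /= distrC (lt_trans xa).
pose K := \sum_i 2 * C * (L i).1.
have L0 i : 0 <= (L i).1 by case: (HL i).
exists K; first by apply: sumr_ge0 => i _; rewrite !mulr_ge0.
exists (d / 2); first by rewrite divr_gt0.
move=> y v ya vd.
have in_ball s : `|s| <= 1 -> `|y + s *: v - a| < d.
  move=> s1; rewrite addrAC (le_lt_trans (ler_normD _ _))// normrZ.
  have : `|s| * `|v| <= 1 * `|v| by rewrite ler_wpM2r.
  lra.
pose g t := f (y + t *: v) + f (y + t *: - v).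
have -> : f (y + v) + f (y - v) - 2 *: f y = g 1 - g 0.
  by rewrite /g !scale1r !scale0r !addr0 scaler_nat mulr2n.
apply: mean_value_ineq => t /andP[t0 t1].
have t01 : `|t| <= 1 by rewrite ger0_norm.
have Nt01 : `|- t| <= 1 by rewrite normrN.
have U1 : U (y + t *: v) by apply: dU; exact: in_ball.
have U2 : U (y - t *: v) by apply: dU; rewrite -scaleNr; exact: in_ball.
have dg : is_derive t 1 g ('D_v f (y + t *: v) + 'D_(- v) f (y + t *: - v)).
  by apply: is_deriveD; apply: derive_line;
    apply/diff_derivable/df; rewrite ?scalerN.
split; first exact: ex_derive.
rewrite derive_val !deriveE ?linearN//=; try exact: df.
have [c [vE cv]] := He v.
have lin x : 'd f x v = \sum_i c i *: ('d f x (e i) : W).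
  by rewrite {1}vE linear_sum; apply: eq_bigr => i _; rewrite linearZ.
rewrite !lin -sumrB (le_trans (ler_norm_sum _ _ _))// /K mulr_suml.
apply: ler_sum => i _; rewrite -scalerBr normrZ.
have -> : 2 * C * (L i).1 * `|v| ^+ 2 = (C * `|v|) * ((L i).1 * (2 * `|v|)) by ring.
rewrite ler_pM// -!deriveE; try exact: df.
have [_ _ HLi] := HL i.
have -> : y + t *: v = (y - t *: v) + (2 * t) *: v.
  rewrite -addrA; congr (_ + _).
  by rewrite -scaleNr -scalerDl; congr (_ *: _); ring.
have n2 : `|(2 * t) *: v| <= 2 * `|v|.
  by rewrite normrZ normrM (ger0_norm t0) ger0_norm// ler_wpM2r// ler_piMr.
rewrite (le_trans (HLi (y - t *: v) ((2 * t) *: v) _ _))//.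
- by rewrite -scaleNr (lt_trans (in_ball _ Nt01)).
- by rewrite (le_lt_trans n2)// (lt_trans _ (dL i))//; lra.
- by rewrite ler_wpM2l.
Qed.

End MeanValue.

(** * Submersions are open: the linear model *)

Section LocalSurjectivity.
Context {R : realType}.

Lemma nbhs_distP (V : normedModType R) (x : V) (A : set V) :
  nbhs x A <-> exists2 d, 0 < d & forall y, `|y - x| < d -> A y.
Proof.
split=> [/(nbhs_normP x)[d /= d0 H]|[d d0 H]].
  by exists d => // y yd; apply: H; rewrite /= distrC.
by apply/(nbhs_normP x); exists d => // y /= yd; apply: H; rewrite distrC.
Qed.

Lemma lipschitz_cvg (V W : normedModType R) (h : V -> W) (x : V) (C : R) :
  (\forall y \near x, `|h y - h x| <= C * `|y - x|) -> h y @[y --> x] --> h x.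
Proof.
move=> hC; apply/cvgrPdist_lt => e e0.
have C0 : 0 < `|C| + 1 by rewrite ltr_wpDl.
have : \forall y \near x, `|x - y| < e / (`|C| + 1).
  by apply: (@cvgr_dist_lt _ _ _ _ _ id x (@cvg_id _ _)); rewrite divr_gt0.
apply: filterS2 hC => y hy; rewrite ltr_pdivlMr// => ye.
rewrite distrC (le_lt_trans hy)// (le_lt_trans _ ye)// distrC mulrC.
by rewrite ler_wpM2l// (le_trans (ler_norm C))// lerDl.
Qed.

(* On a complement [L] of the kernel, [g = f (a + L _)] is close to the identity;
   a minimiser of [|y - g w|] over a small ball is interior, and a nonzero
   residue [q = y - g w] could be decreased by moving [w] along [q]. *)
Lemma submersion_nbhs n m (U : set 'rV[R]_n) (f : 'rV[R]_n -> 'rV[R]_m) a :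
  open U -> Ck 1 U f -> U a -> (forall w, exists v, 'd f a v = w) ->
  forall N, nbhs a N -> nbhs (f a) (f @` N).
Proof.
move=> oU Cf Ua sf N nN; have [df _] := Cf.
have /choice[b Hb] : forall j, exists v, 'd f a v = delta_mx 0 j :> 'rV_m.
  by move=> j; exact: sf.
pose L (w : 'rV[R]_m) : 'rV[R]_n := \sum_j w 0 j *: b j.
have dL w : 'd f a (L w) = w.
  rewrite linear_sum [RHS]row_sum_delta; apply: eq_bigr => j _.
  by rewrite linearZ Hb.
have LD v w : L (v + w) = L v + L w.
  by rewrite -big_split; apply: eq_bigr => j _; rewrite mxE scalerDl.
pose K := \sum_j `|b j| + 1.
have K1 : 1 <= K by rewrite lerDr sumr_ge0.
have K0 : 0 < K by rewrite (lt_le_trans ltr01).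
have LK w : `|L w| <= K * `|w|.
  rewrite /K mulrDl mul1r ler_wpDr// mulr_suml.
  rewrite (le_trans (ler_norm_sum _ _ _))//; apply: ler_sum => j _.
  by rewrite normrZ mulrC ler_wpM2l// coord_le_norm.
have K20 : 0 < (2 * K)^-1 by rewrite invr_gt0 mulr_gt0.
have [d d0 Hd] := Ck1_strict (fin_dim_rV n) oU Cf Ua K20.
have /nbhs_normP[e /= e0 He] : nbhs a (N `&` U).
  by apply: filterI => //; exact: open_nbhs_nbhs.
pose r := Num.min d e / (3 * K).
have K30 : 0 < 3 * K by rewrite mulr_gt0.
have r0 : 0 < r by rewrite divr_gt0// lt_min d0.
have rE : Num.min d e = 3 * K * r by rewrite mulrC divfK// gt_eqF.
have Kr0 : 0 < K * r by rewrite mulr_gt0.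
clearbody r.
have Lr w : `|w| <= 2 * r -> `|L w| < d /\ `|L w| < e.
  move=> wr; apply/andP; rewrite -lt_min (le_lt_trans (LK w))//.
  rewrite (@le_lt_trans _ _ (K * (2 * r)))// ?ler_wpM2l ?(ltW K0)//.
  rewrite rE; lra.
pose g w := f (a + L w).
have gP y v : `|y| <= 2 * r -> `|v| <= 2 * r ->
    `|g (y + v) - g y - v| <= 2^-1 * `|v|.
  move=> /Lr[yd _] /Lr[vd _].
  have yd' : `|a + L y - a| < d by rewrite addrAC subrr add0r.
  have := Hd (a + L y) (L v) yd' vd; rewrite dL /g LD addrA => H.
  by rewrite (le_trans H)// invfM -mulrA ler_wpM2l// ler_pdivrMl.
have g0 : g 0 = f a.
  by rewrite /g /L big1 ?addr0// => j _; rewrite mxE scale0r.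
(* On the sphere [|w| = r], [gP] gives [|g w - g 0| >= r / 2]. A target within [r / 4] of [g 0] is
   therefore closer to [g 0] than to [g w], so the minimiser is interior. *)
apply/nbhs_distP; exists (r / 4); first by rewrite divr_gt0.
move=> y; rewrite -g0 distrC => gy.
pose B : set 'rV[R]_m := closed_ball_ Num.norm 0 r.
have BP w : B w <-> `|w| <= r by rewrite /B /closed_ball_ /= sub0r normrN.
have cB : compact B.
  apply: bounded_closed_compact; last exact: closed_closed_ball_.
  exists r; split; first exact: num_real.
  by move=> M rM w /BP wr; rewrite /= (le_trans wr)// ltW.
have cg : {within B, continuous (fun w => `|y - g w|)}.
  apply: continuous_in_subspaceT => w /set_mem/BP wr.
  suff cgw : g u @[u --> w] --> g w by exact: (cvg_norm (cvgB (cvg_cst y) cgw)).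
  apply: (@lipschitz_cvg _ _ g w 2).
  apply/nbhs_distP; exists r => // u ur.
  have h : `|g (w + (u - w)) - g w - (u - w)| <= 2^-1 * `|u - w|.
    by apply: gP; lra.
  move: h; rewrite addrCA subrr addr0 => h.
  rewrite -[g u - g w](subrK (u - w)) (le_trans (ler_normD _ _))//.
  have := normr_ge0 (u - w); lra.
have B0 : B !=set0 by exists 0; apply/BP; rewrite normr0 ltW.
have [w /set_mem/BP wr minw] := compact_EVT_min B0 cB cg.
have minw' v : `|v| <= r -> `|y - g w| <= `|y - g v|.
  by move=> vr; apply: minw; apply/mem_set/BP.
have w_lt : `|w| < r.
  rewrite lt_neqAle wr andbT; apply/eqP => wE.
  have h := minw' 0; rewrite normr0 (ltW r0) in h; have {}h := h isT.
  have k : `|g (0 + w) - g 0 - w| <= 2^-1 * `|w|.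
    by apply: gP; rewrite ?normr0; lra.
  rewrite add0r in k.
  have : `|w| <= `|g w - g 0| + `|g w - g 0 - w|.
    rewrite -[X in `|X| <= _](_ : (g w - g 0) - (g w - g 0 - w) = _).
      exact: ler_normB.
    by rewrite opprD addrA subrr add0r opprK.
  have : `|g w - g 0| <= `|y - g w| + `|g 0 - y|.
    rewrite -(subrKA y) (le_trans (ler_normD _ _))//.
    by rewrite distrC (distrC y (g 0)).
  rewrite distrC in gy; rewrite (distrC y (g 0)) in h.
  rewrite (distrC (g 0) y) in h *; lra.
exists (a + L w).
  by case: (He (a + L w)) => //=; rewrite opprD addrA subrr sub0r normrN;
    apply: (proj2 (Lr _ _)); lra.
apply/esym/subr0_eq/eqP; apply: contraT => yw.
pose q := y - g w; have q0 : 0 < `|q| by rewrite normr_gt0.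
pose s := Num.min 1 ((r - `|w|) / `|q|).
have s0 : 0 < s by rewrite lt_min ltr01 divr_gt0// subr_gt0.
have s1 : s <= 1 by rewrite ge_min lexx.
have sq : s * `|q| <= r - `|w| by rewrite -ler_pdivlMr// ge_min lexx orbT.
have nsq : `|s *: q| = s * `|q| by rewrite normrZ gtr0_norm.
have h : `|w + s *: q| <= r.
  by rewrite (le_trans (ler_normD _ _))// nsq; lra.
have k : `|g (w + s *: q) - g w - s *: q| <= 2^-1 * `|s *: q|.
  by apply: gP; rewrite ?nsq; have := normr_ge0 w; lra.
have := minw' _ h.
have -> : y - g (w + s *: q) = (1 - s) *: q - (g (w + s *: q) - g w - s *: q).
  by apply/rowP => i; rewrite /q !mxE; ring.
rewrite leNgt => /negP[].
rewrite (le_lt_trans (ler_normB _ _))// normrZ ger0_norm ?subr_ge0//.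
rewrite nsq in k; have : 0 < s * `|q| by rewrite mulr_gt0.
rewrite -/q; lra.
Qed.

End LocalSurjectivity.

(** * Maps with bounded second differences *)

Section C11.
Context {R : realType}.
Implicit Types V W : normedModType R.

(** A parametrised family of maps which is locally Lipschitz with second
    differences [O(|v|^2)], uniformly in the parameter. Unlike [Ck] this notion
    involves no derivative, hence its stability under composition is immediate,
    and it is all that the convexity argument needs of smoothness. *)
Definition C11 {P : topologicalType} {V W} (f : P -> V -> W) (p0 : P) (x0 : V) :=
  f p x0 @[p --> p0] --> f p0 x0 /\
  exists C d : R, [/\ 0 <= C, 0 < d & \forall p \near p0, forall y v,
    `|y - x0| < d -> `|v| < d ->
    `|f p (y + v) - f p y| <= C * `|v| /\
    `|f p (y + v) + f p (y - v) - 2 *: f p y| <= C * `|v| ^+ 2].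

Lemma C11_near_dist {P : topologicalType} {V W} (f : P -> V -> W) p0 x0 e :
  C11 f p0 x0 -> 0 < e -> exists2 d, 0 < d & \forall p \near p0,
    forall y, `|y - x0| < d -> `|f p y - f p0 x0| < e.
Proof.
move=> [cf [C [d [C0 d0 Hf]]]] e0.
have e20 : 0 < e / 2 by rewrite divr_gt0.
have C1 : 0 < C + 1 by rewrite ltr_wpDl.
exists (Num.min d (e / 2 / (C + 1))); first by rewrite lt_min d0 divr_gt0.
have nf : \forall p \near p0, `|f p0 x0 - f p x0| < e / 2.
  exact: (@cvgr_dist_lt _ _ _ _ _ _ _ cf).
apply: filterS2 nf Hf => p fp Hf y; rewrite lt_min ltr_pdivlMr// => /andP[yd ye].
rewrite -(subrKA (f p x0)) (le_lt_trans (ler_normD _ _))//.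
have x00 : `|x0 - x0| < d by rewrite subrr normr0.
have [h _] := Hf x0 (y - x0) x00 yd.
rewrite addrCA subrr addr0 in h; rewrite distrC in fp.
by have := normr_ge0 (y - x0); nra.
Qed.

Lemma C11_cvg {P : topologicalType} {V W} (f : P -> V -> W) p0 x0 :
  C11 f p0 x0 -> f u.1 u.2 @[u --> (p0, x0)] --> f p0 x0.
Proof.
move=> Hf; apply/cvgrPdist_lt => e /(C11_near_dist Hf)[d d0 Hd].
have nx : nbhs x0 [set y | `|y - x0| < d] by apply/nbhs_distP; exists d.
exists ([set p | forall y, `|y - x0| < d -> `|f p y - f p0 x0| < e],
  [set y | `|y - x0| < d]); first by split.
by move=> [p y] [/= Hp yd]; rewrite distrC; exact: Hp.
Qed.

(** With [w] and [w'] the increments of [f] along [v] and [- v], the second difference of the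
    composite is that of [g] at [f y] along [w], plus [g (f y + w') - g (f y - w)]. The latter is
    Lipschitz in [w + w'], the second difference of [f]. *)
Lemma C11_comp {P : topologicalType} {V W X : normedModType R}
    (f : P -> V -> W) (g : P -> W -> X) p0 x0 :
  C11 f p0 x0 -> C11 g p0 (f p0 x0) -> C11 (fun p x => g p (f p x)) p0 x0.
Proof.
move=> Hf Hg; split.
  have cfp : (p, f p x0) @[p --> p0] --> (p0, f p0 x0).
    by apply: cvg_pair => /=; [exact: cvg_id|case: Hf].
  exact: (cvg_comp _ _ cfp (C11_cvg Hg)).
case: (Hg) => cg [C [d [C0 d0 {}Hg]]].
have d20 : 0 < d / 2 by rewrite divr_gt0.
have [e1 e10 n1] := C11_near_dist Hf d20.
case: (Hf) => cf [K [e [K0 e0 {}Hf]]].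
pose r := Num.min e (Num.min (e1 / 2) (d / 2 / (K + 1))).
have K1 : 0 < K + 1 by rewrite ltr_wpDl.
exists (C * (K + K ^+ 2)), r; split.
- by rewrite mulr_ge0// addr_ge0// exprn_ge0.
- by rewrite !lt_min e0 !divr_gt0.
apply: filterS3 Hf Hg n1 => p Hf Hg n1 y v.
rewrite !lt_min => /andP[ye /andP[ye1 _]] /andP[ve /andP[ve1]].
rewrite ltr_pdivlMr// => vK.
have nv := normr_ge0 v.
have [f1 f2] := Hf _ _ ye ve.
have := Hf y (- v) ye; rewrite normrN opprK => /(_ ve)[f1' _].
pose w := f p (y + v) - f p y; pose w' := f p (y - v) - f p y.
have wd : `|w| < d / 2 by rewrite (le_lt_trans f1)//; nra.
have wd' : `|w'| < d / 2 by rewrite (le_lt_trans f1')//; nra.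
have fyd : `|f p y - f p0 x0| < d / 2 by apply: n1; lra.
have wE : f p (y + v) = f p y + w by rewrite /w addrCA subrr addr0.
have wE' : f p (y - v) = f p y + w' by rewrite /w' addrCA subrr addr0.
have ww : `|w + w'| <= K * `|v| ^+ 2.
  rewrite (_ : w + w' = f p (y + v) + f p (y - v) - 2 *: f p y)//.
  by rewrite /w /w' scaler_nat mulr2n opprD !addrA; congr (_ - _); rewrite addrAC.
have [g1 g2] := Hg (f p y) w ltac:(lra) ltac:(lra).
have gd : `|f p y - w - f p0 x0| < d.
  by rewrite addrAC (le_lt_trans (ler_normB _ _))//; lra.
have wwd : `|w + w'| < d by rewrite (le_lt_trans (ler_normD _ _))//; lra.
have [g3 _] := Hg _ _ gd wwd.
rewrite addrA subrK in g3.
have Kv : K * `|v| * (K * `|v|) = K ^+ 2 * `|v| ^+ 2 by ring.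
have w2 : `|w| ^+ 2 <= K ^+ 2 * `|v| ^+ 2 by rewrite -Kv expr2 ler_pM.
split.
  rewrite wE (le_trans g1)// -mulrA ler_wpM2l// (le_trans f1)//.
  by rewrite ler_wpM2r// lerDl exprn_ge0.
rewrite wE wE' -(subrK (g p (f p y - w)) (g p (f p y + w'))) addrCA -addrA.
rewrite (le_trans (ler_normD _ _))// -mulrA mulrDl mulrDr lerD//.
  by rewrite (le_trans g3)// ler_wpM2l.
by rewrite (le_trans g2)// ler_wpM2l.
Qed.

Lemma C11_near_eq {P : topologicalType} {V W} (f g : P -> V -> W) p0 x0 :
  (\forall u \near (p0, x0), f u.1 u.2 = g u.1 u.2) -> C11 f p0 x0 ->
  C11 g p0 x0.
Proof.
move=> [[A B] [/= nA /nbhs_distP[e e0 HB]] AB] [cf [C [d [C0 d0 Hf]]]].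
have fg p y : A p -> `|y - x0| < e -> f p y = g p y.
  by move=> Ap /HB By; exact: (AB (p, y)).
have fg0 p : A p -> f p x0 = g p x0 by move=> Ap; rewrite fg// subrr normr0.
split.
  rewrite -fg0; last exact: nbhs_singleton nA.
  by apply: cvg_trans cf; apply: near_eq_cvg; apply: filterS nA => p /fg0.
exists C, (Num.min d (e / 2)); split=> //; first by rewrite lt_min d0 divr_gt0.
apply: filterS2 nA Hf => p Ap Hf y v.
rewrite !lt_min => /andP[yd ye] /andP[vd ve].
have b1 : `|y + v - x0| < e.
  by rewrite addrAC (le_lt_trans (ler_normD _ _))//; lra.
have b2 : `|y - v - x0| < e.
  by rewrite addrAC (le_lt_trans (ler_normB _ _))//; lra.
by rewrite -!fg//; [exact: Hf|lra].
Qed.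

Lemma C11_fst {P : topologicalType} {V} {W W' : normedModType R}
    (f : P -> V -> (W * W')%type) p0 x0 :
  C11 f p0 x0 -> C11 (fun p x => (f p x).1) p0 x0.
Proof.
move=> [cf [C [d [C0 d0 Hf]]]]; split; first exact: cvg_comp cf cvg_fst.
have n1 (w : W * W') : `|w.1| <= `|w| by rewrite prod_normE le_max lexx.
exists C, d; split=> //; apply: filterS Hf => p Hf y v yd vd.
have [h1 h2] := Hf y v yd vd.
by split; [exact: le_trans (n1 _) h1|exact: le_trans (n1 _) h2].
Qed.

(** This is how an action, a single map on a product, becomes a family: one argument is frozen at a
    value depending continuously on [p]. *)
Lemma C11_slice_r {P Q : topologicalType} {V W X : normedModType R} (q0 : Q)
    (f : V * W -> X) (t : P -> V) p0 y0 : t p @[p --> p0] --> t p0 ->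
  C11 (fun _ : Q => f) q0 (t p0, y0) -> C11 (fun p y => f (t p, y)) p0 y0.
Proof.
move=> ct Hf; split.
  have ctp : (q0, (t p, y0)) @[p --> p0] --> (q0, (t p0, y0)).
    exact: (cvg_pair (cvg_cst q0) (cvg_pair ct (cvg_cst y0))).
  exact: (cvg_comp _ _ ctp (C11_cvg Hf)).
have [_ [C [d [C0 d0 {}Hf]]]] := Hf; have {}Hf := nbhs_singleton Hf.
have nd : \forall p \near p0, `|t p0 - t p| < d.
  exact: (@cvgr_dist_lt _ _ _ _ _ _ _ ct).
exists C, d; split=> //; apply: filterS nd => p tp y v yd vd.
have n0 : `|(0, v) : V * W| = `|v| by rewrite prod_normE /= normr0 max_r.
have b1 : `|(t p, y) - (t p0, y0)| < d.
  by rewrite prod_normE /= gt_max yd andbT distrC.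
have := Hf (t p, y) (0, v) b1; rewrite n0 => /(_ vd).
have -> : (t p, y) + (0, v) = (t p, y + v) by rewrite -[LHS]/(_, _) /= addr0.
by have -> : (t p, y) - (0, v) = (t p, y - v) by rewrite -[LHS]/(_, _) /= subr0.
Qed.

Lemma C11_slice_l {P Q : topologicalType} {V W X : normedModType R} (q0 : Q)
    (f : V * W -> X) (t : P -> W) p0 x0 : t p @[p --> p0] --> t p0 ->
  C11 (fun _ : Q => f) q0 (x0, t p0) -> C11 (fun p x => f (x, t p)) p0 x0.
Proof.
move=> ct Hf; split.
  have ctp : (q0, (x0, t p)) @[p --> p0] --> (q0, (x0, t p0)).
    exact: (cvg_pair (cvg_cst q0) (cvg_pair (cvg_cst x0) ct)).
  exact: (cvg_comp _ _ ctp (C11_cvg Hf)).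
have [_ [C [d [C0 d0 {}Hf]]]] := Hf; have {}Hf := nbhs_singleton Hf.
have nd : \forall p \near p0, `|t p0 - t p| < d.
  exact: (@cvgr_dist_lt _ _ _ _ _ _ _ ct).
exists C, d; split=> //; apply: filterS nd => p tp y v yd vd.
have n0 : `|(v, 0) : V * W| = `|v| by rewrite prod_normE /= normr0 max_l.
have b1 : `|(y, t p) - (x0, t p0)| < d.
  by rewrite prod_normE /= gt_max yd /= distrC.
have := Hf (y, t p) (v, 0) b1; rewrite n0 => /(_ vd).
have -> : (y, t p) + (v, 0) = (y + v, t p) by rewrite -[LHS]/(_, _) /= addr0.
by have -> : (y, t p) - (v, 0) = (y - v, t p) by rewrite -[LHS]/(_, _) /= subr0.
Qed.

Lemma Ck2_C11 {P : topologicalType} {V W} (U : set V) (f : V -> W) (p0 : P) a :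
  fin_dim V -> open U -> Ck 2 U f -> U a -> C11 (fun _ : P => f) p0 a.
Proof.
move=> fV oU Cf Ua; split; first exact: cvg_cst.
have Cf1 : Ck 1 U f.
  by case: Cf => df Cf; split=> // v x Ux; apply: differentiable_continuous;
    case: (Cf v) => + _; apply.
have [C C0 [d d0 H]] := Ck1_lipschitz fV oU Cf1 Ua.
have [C' C0' [d' d0' H']] := Ck2_second_difference fV oU Cf Ua.
exists (C + C'), (Num.min d d'); split.
- exact: addr_ge0.
- by rewrite lt_min d0.
apply: nearW => _ y v; rewrite !lt_min => /andP[yd yd'] /andP[vd vd']; split.
  by rewrite (le_trans (H _ _ yd vd))// ler_wpM2r// lerDl.
by rewrite (le_trans (H' _ _ yd' vd'))// ler_wpM2r ?exprn_ge0// lerDr.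
Qed.

End C11.

(** * Bounded second differences on manifolds *)

Section Charts.
Context {R : realType} {E F : normedModType R}.

Lemma near_chart (M : topologicalType) (c : chart E M) x (N : set M) :
  cdom c x -> nbhs x N ->
  \forall y \near cmap c x, N (cinv c y) /\ exists2 z, cdom c z & cmap c z = y.
Proof.
move=> cx nN; have nci : nbhs (cmap c x) (cinv c @^-1` N).
  by apply: (cinv_continuous cx); rewrite cmapK.
have nim : nbhs (cmap c x) (cmap c @` cdom c).
  by apply: open_nbhs_nbhs; split; [exact: cimg_open|exists x].
by apply: filterS2 nci nim => y Ny /= -[z cz zy]; split=> //; exists z.
Qed.

Lemma open_chart_image (M : topologicalType) (c : chart E M) (U : set M) :
  open U -> U `<=` cdom c -> open (cmap c @` U).
Proof.
move=> oU Uc; rewrite openE => _ [x Ux <-].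
have := near_chart (Uc _ Ux) (open_nbhs_nbhs (conj oU Ux)).
by apply: filterS => y [Uy [z cz zy]]; exists z => //; rewrite -zy cmapK in Uy.
Qed.

(** [smooth_at] supplies one pair of charts. Prescribed charts are reached by composing with
    transition maps on both sides, which gives the right expression near the point. *)
Lemma smooth_at_C11 {P : topologicalType} {M : manifoldType E}
    {N : manifoldType F} (f : M -> N) (p0 : P) x (c : chart E M)
    (d : chart F N) : fin_dim E -> fin_dim F -> smooth_at f x ->
  atlas c -> atlas d -> cdom c x -> cdom d (f x) ->
  C11 (fun _ : P => cmap d \o f \o cinv c) p0 (cmap c x).
Proof.
move=> fE fF [c0 [d0 [U [ac0 ad0 oU Ux [Uc0 Ud0 sf]]]]] ac ad cx dx.
have c0x := Uc0 _ Ux; have d0x := Ud0 _ Ux.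
have t1 : C11 (fun _ : P => cmap c0 \o cinv c) p0 (cmap c x).
  apply: (@Ck2_C11 _ _ _ _ (cmap c @` (cdom c `&` cdom c0))) => //.
  - exact: chart_overlap_open.
  - exact: atlas_smooth.
  - by exists x.
have t2 : C11 (fun _ : P => cmap d0 \o f \o cinv c0) p0 (cmap c0 x).
  apply: (@Ck2_C11 _ _ _ _ (cmap c0 @` U)) => //.
  exact: open_chart_image.
have t3 : C11 (fun _ : P => cmap d \o cinv d0) p0 (cmap d0 (f x)).
  apply: (@Ck2_C11 _ _ _ _ (cmap d0 @` (cdom d0 `&` cdom d))) => //.
  - exact: chart_overlap_open.
  - exact: atlas_smooth.
  - by exists (f x).
have t12 := C11_comp (P := P) (f := fun _ => cmap c0 \o cinv c)
  (g := fun _ => cmap d0 \o f \o cinv c0) t1.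
rewrite /= cmapK// in t12; have {}t12 := t12 t2.
have t123 := C11_comp (P := P) (g := fun _ => cmap d \o cinv d0) t12.
rewrite /= !cmapK// in t123; have {}t123 := t123 t3.
apply: C11_near_eq t123; exists (setT, [set y | cmap d (cinv d0 (cmap d0 (f
  (cinv c0 (cmap c0 (cinv c y)))))) = cmap d (f (cinv c y))]).
  split; first exact: filterT.
  have nU : nbhs x (U `&` cdom c) by
    apply: open_nbhs_nbhs; split=> //; apply: openI => //; exact: cdom_open.
  have := near_chart cx nU.
  apply: filterS => y /= [[Uy _] _].
  by rewrite (cmapK (Uc0 _ Uy)) (cmapK (Ud0 _ Uy)).
by move=> [p y] [_ /=].
Qed.

End Charts.

Lemma submersion_open {R : realType} {n m : nat} {M : manifoldType 'rV[R]_n}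
    {N : manifoldType 'rV[R]_m} (f : M -> N) : submersion f ->
  forall x A, nbhs x A -> nbhs (f x) (f @` A).
Proof.
move=> [sf df] x A nA.
have [c [d [U [ac ad oU Ux [Uc Ud Ff]]]]] := sf x.
have cx := Uc _ Ux; have dx := Ud _ Ux.
have dfx := df c d x ac ad cx dx.
pose B := [set y | (A `&` U) (cinv c y)].
have nB : nbhs (cmap c x) B.
  have nAU : nbhs x (A `&` U) by apply: filterI => //; exact: open_nbhs_nbhs.
  by apply: filterS (near_chart cx nAU) => y [].
have Ux' : (cmap c @` U) (cmap c x) by exists x.
have := submersion_nbhs (open_chart_image oU Uc) (Ff 1%N) Ux' dfx nB.
rewrite /= cmapK// => /(cmap_continuous dx) nd0.
have nd : nbhs (f x) (cmap d @^-1` ((cmap d \o f \o cinv c) @` B)) := nd0.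
have nd' : nbhs (f x) (cdom d) by apply: open_nbhs_nbhs; split=> //; exact: cdom_open.
apply: filterS2 nd nd' => y /= -[v [Av Uv] vy] dy.
exists (cinv c v) => //; have := congr1 (cinv d) vy.
by rewrite !cmapK//; exact: Ud.
Qed.

Section ManifoldC11.
Context {R : realType}.

(** Joint continuity keeps the values in a chosen chart of [N] for all nearby parameters and points
    at once. Quantifying over all charts removes transition maps from compositions. *)
Definition mC11 {P : topologicalType} {E F : normedModType R}
    {M : manifoldType E} {N : manifoldType F} (f : P -> M -> N) p0 x0 :=
  f u.1 u.2 @[u --> (p0, x0)] --> f p0 x0 /\
  forall (c : chart E M) (d : chart F N), atlas c -> atlas d ->
    cdom c x0 -> cdom d (f p0 x0) ->
    C11 (fun p v => cmap d (f p (cinv c v))) p0 (cmap c x0).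

Lemma mC11_comp {P : topologicalType} {E F F' : normedModType R}
    {M : manifoldType E} {N : manifoldType F} {L : manifoldType F'}
    (f : P -> M -> N) (g : P -> N -> L) p0 x0 :
  mC11 f p0 x0 -> mC11 g p0 (f p0 x0) -> mC11 (fun p x => g p (f p x)) p0 x0.
Proof.
move=> [cf Hf] [cg Hg]; split.
  have cfst : u.1 @[u --> (p0, x0)] --> p0 by exact: cvg_fst.
  exact: (cvg_comp _ _ (cvg_pair cfst cf) cg).
move=> c d ac ad cx dgf; have [b ab bf] := atlas_cover (f p0 x0).
have {}Hf := Hf _ _ ac ab cx bf; have {}Hg := Hg _ _ ab ad bf dgf.
have H := @C11_comp _ _ _ _ _ _ (fun p v => cmap d (g p (cinv b v))) _ _ Hf.
rewrite /= (cmapK cx) in H; apply: C11_near_eq (H Hg).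
have nb : nbhs (f p0 x0) (cdom b).
  by apply: open_nbhs_nbhs; split=> //; exact: cdom_open.
have [[A B] [/= nA nB] AB] := cf _ nb.
exists (A, [set v | B (cinv c v)]) => /=.
  by split=> //; apply: (cinv_continuous cx); rewrite cmapK.
by move=> [p v] [/= Ap Bv]; rewrite cmapK//; exact: (AB (p, cinv c v)).
Qed.

Lemma smooth_mC11 {P : topologicalType} {E F : normedModType R}
    {M : manifoldType E} {N : manifoldType F} (f : M -> N) (p0 : P) x0 :
  fin_dim E -> fin_dim F -> smooth_at f x0 -> mC11 (fun _ => f) p0 x0.
Proof.
move=> fE fF sf; split.
  have csnd : u.2 @[u --> (p0, x0)] --> x0 by exact: cvg_snd.
  exact: (cvg_comp _ _ csnd (smooth_at_continuous sf)).
by move=> c d ac ad cx dx; exact: (smooth_at_C11 p0 fE fF sf ac ad cx dx).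
Qed.

Lemma smooth_mC11_r {P : topologicalType} {E E' F : normedModType R}
    {M : manifoldType E} {M' : manifoldType E'} {N : manifoldType F}
    (f : M * M' -> N) (t : P -> M) (p0 : P) x0 :
  fin_dim E -> fin_dim E' -> fin_dim F -> smooth_at f (t p0, x0) ->
  t p @[p --> p0] --> t p0 -> mC11 (fun p x => f (t p, x)) p0 x0.
Proof.
move=> fE fE' fF sf ct; split.
  have csnd : u.2 @[u --> (p0, x0)] --> x0 by exact: cvg_snd.
  have cfst : t u.1 @[u --> (p0, x0)] --> t p0 by exact: cvg_comp cvg_fst ct.
  exact: (cvg_comp _ _ (cvg_pair cfst csnd) (smooth_at_continuous sf)).
move=> c d ac ad cx dx; have [b ab bt] := atlas_cover (t p0).
have abc : atlas (prod_chart b c) by exists b, c.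
have H := smooth_at_C11 p0 (fin_dim_prod fE fE') fF sf abc ad (conj bt cx) dx.
have cbt : cmap b (t p) @[p --> p0] --> cmap b (t p0).
  exact: (cvg_comp _ _ ct (cmap_continuous bt)).
apply: C11_near_eq (C11_slice_r cbt H).
have nb : nbhs (t p0) (cdom b).
  by apply: open_nbhs_nbhs; split=> //; exact: cdom_open.
exists (t @^-1` cdom b, setT) => /=.
  by split; [exact: ct|exact: filterT].
by move=> [p v] [/= Ap Bv]; rewrite cmapK.
Qed.

Lemma smooth_mC11_l {P : topologicalType} {E E' F : normedModType R}
    {M : manifoldType E} {M' : manifoldType E'} {N : manifoldType F}
    (f : M * M' -> N) (t : P -> M') (p0 : P) x0 :
  fin_dim E -> fin_dim E' -> fin_dim F -> smooth_at f (x0, t p0) ->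
  t p @[p --> p0] --> t p0 -> mC11 (fun p x => f (x, t p)) p0 x0.
Proof.
move=> fE fE' fF sf ct; split.
  have csnd : u.2 @[u --> (p0, x0)] --> x0 by exact: cvg_snd.
  have cfst : t u.1 @[u --> (p0, x0)] --> t p0 by exact: cvg_comp cvg_fst ct.
  exact: (cvg_comp _ _ (cvg_pair csnd cfst) (smooth_at_continuous sf)).
move=> c d ac ad cx dx; have [b ab bt] := atlas_cover (t p0).
have acb : atlas (prod_chart c b) by exists c, b.
have H := smooth_at_C11 p0 (fin_dim_prod fE fE') fF sf acb ad (conj cx bt) dx.
have cbt : cmap b (t p) @[p --> p0] --> cmap b (t p0).
  exact: (cvg_comp _ _ ct (cmap_continuous bt)).
apply: C11_near_eq (C11_slice_l cbt H).
have nb : nbhs (t p0) (cdom b).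
  by apply: open_nbhs_nbhs; split=> //; exact: cdom_open.
exists (t @^-1` cdom b, setT) => /=.
  by split; [exact: ct|exact: filterT].
by move=> [p v] [/= Ap Bv]; rewrite cmapK.
Qed.

Lemma mC11_fst {P : topologicalType} {E F F' : normedModType R}
    {M : manifoldType E} {N : manifoldType F} {N' : manifoldType F'}
    (f : P -> M -> (N * N')%type) p0 x0 :
  mC11 f p0 x0 -> mC11 (fun p x => (f p x).1) p0 x0.
Proof.
move=> [cf Hf]; split; first exact: cvg_comp cf cvg_fst.
move=> c d ac ad cx dx; have [b ab bf] := atlas_cover (f p0 x0).2.
have adb : atlas (prod_chart d b) by exists d, b.
exact: (C11_fst (Hf _ _ ac adb cx (conj dx bf))).
Qed.

End ManifoldC11.

(** * Euclidean squares and strict midpoint convexity *)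

Section Squares.
Context {R : realType} {n : nat}.
Implicit Types v w : 'rV[R]_n.

(** The norm of row vectors is the sup norm, which is not strictly convex; the Euclidean square
    obeys the parallelogram law. *)
Definition dotp v w : R := \sum_i v 0 i * w 0 i.

Lemma dotp_ge0 v : 0 <= dotp v v.
Proof. by apply: sumr_ge0 => i _; rewrite -expr2 sqr_ge0. Qed.

Lemma dotp_ge_norm v : `|v| ^+ 2 <= dotp v v.
Proof.
have [->|v0] := eqVneq v 0; first by rewrite normr0 expr0n dotp_ge0.
have : mx_norm v != 0 by apply: contraNneq v0 => /mx_norm_eq0/eqP.
move=> /mx_norm_neq0[[i j] /= vE].
rewrite (_ : `|v| = `|v i j|)// ord1 real_normK ?num_real// /dotp (bigD1 j)//=.
by rewrite -expr2 lerDl; apply: sumr_ge0 => k _; rewrite -expr2 sqr_ge0.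
Qed.

Lemma dotp_le_norm v w : `|dotp v w| <= n%:R * (`|v| * `|w|).
Proof.
rewrite (le_trans (ler_norm_sum _ _ _))//.
apply: (@le_trans _ _ (\sum_(i < n) `|v| * `|w|)).
  by apply: ler_sum => i _; rewrite normrM ler_pM// coord_le_norm.
by rewrite sumr_const card_ord mulr_natl.
Qed.

(** The parallelogram law with a defect [e], which vanishes when [m] is the midpoint of [a] and
    [b]. *)
Lemma dotp_midpoint (a b m : 'rV[R]_n) :
  let e := a + b - 2 *: m in
  2 * dotp m m = dotp a a + dotp b b - dotp (a - b) (a - b) / 2
                 - dotp (a + b) e + dotp e e / 2.
Proof.
move=> e; rewrite /dotp !mulr_suml mulr_sumr -!sumrN -!big_split /=.
by apply: eq_bigr => i _; rewrite !mxE; field.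
Qed.

Lemma dotp_continuous : continuous (fun v => dotp v v).
Proof.
apply: continuous_big => [|i _ v]; first exact: add_continuous.
have cv : (w : 'rV[R]_n) 0 i @[w --> v] --> v 0 i by exact: coord_continuous.
exact: (cvgM cv cv).
Qed.

End Squares.

(* Second differences of [f] are [O(|u - a|^2)] whereas [f u - f a] is bounded
   below by [|u - a|] up to a factor, so [|f|^2] is strictly midpoint convex
   wherever [f] is small. *)
Lemma strict_midpoint_convexity {R : realType} {n : nat}
    {P : topologicalType} {V : normedModType R}
    (f : P -> V -> 'rV[R]_n) (b : P -> 'rV[R]_n -> V) p0 a :
  C11 f p0 a -> C11 b p0 (f p0 a) ->
  (\forall u \near (p0, a), b u.1 (f u.1 u.2) = u.2) ->
  \forall u \near (p0, a), u.2 <> a ->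
    let F (v : V) := dotp (f u.1 v - f p0 a) (f u.1 v - f p0 a) in
    2 * F (2^-1 *: (u.2 + a)) < F u.2 + F a.
Proof.
move=> Hf [_ [K [r [K0 r0 Hb]]]] [[A B] [/= nA /nbhs_distP[s s0 HB]] AB].
case: (Hf) => _ [C [d [C0 d0 H]]].
(* With [D = |u - a|] and [W = |al - be|], [dotp_midpoint] gains at least [W ^+ 2 / 2] and loses at
   most [n C ep D ^+ 2], which is at most [ep * T * W ^+ 2] since [D <= K * W]. The choice of [ep]
   makes [ep * T < 1/2], and [r / 2] keeps [al - be] in the range of the Lipschitz bound on [b]. *)
pose T := n%:R * C * K ^+ 2; pose ep := Num.min (r / 2) (2 * (T + 1))^-1.
have T0 : 0 <= T by rewrite /T !mulr_ge0// exprn_ge0.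
have ep0 : 0 < ep by rewrite lt_min divr_gt0// invr_gt0 mulr_gt0// ltr_wpDl.
have [t t0 Ht] := C11_near_dist Hf ep0.
pose N p := [/\ A p, (forall y v, `|y - f p0 a| < r -> `|v| < r ->
    `|b p (y + v) - b p y| <= K * `|v|),
   (forall y v, `|y - a| < d -> `|v| < d ->
    `|f p (y + v) + f p (y - v) - 2 *: f p y| <= C * `|v| ^+ 2) &
   (forall y, `|y - a| < t -> `|f p y - f p0 a| < ep)].
have nN : \forall p \near p0, N p.
  apply: filterS2 (filterI nA Hb) (filterI H Ht) => p [Ap Hbp] [Hp Htp].
  by split=> // y v yd vd; [case: (Hbp y v)|case: (Hp y v)].
pose m := Num.min (Num.min s t) d.
have m0 : 0 < m by rewrite !lt_min s0 t0.
exists (N, [set u | `|u - a| < m]).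
  by split=> //=; apply/nbhs_distP; exists m.
move=> [p u] [/= [Ap Hbp Hp Htp] um] ua /=.
have [us ut ud] : [/\ `|u - a| < s, `|u - a| < t & `|u - a| < d].
  by move: um; rewrite /m !lt_min => /andP[/andP[-> ->] ->].
have a0 : `|a - a| = 0 by rewrite subrr normr0.
pose D := `|u - a|.
have D0 : 0 < D by rewrite normr_gt0 subr_eq0; apply/eqP.
pose y := 2^-1 *: (u + a); pose v := 2^-1 *: (u - a).
have yv : y + v = u.
  rewrite /y /v -scalerDr addrACA subrr addr0 -mulr2n -[u *+ 2]scaler_nat scalerA.
  by rewrite mulVf ?scale1r// pnatr_eq0.
have ymv : y - v = a.
  rewrite /y /v -scalerBr opprB [a - u]addrC addrACA subrr add0r -mulr2n.
  rewrite -[a *+ 2]scaler_nat scalerA.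
  by rewrite mulVf ?scale1r// pnatr_eq0.
have ya : y - a = v by rewrite -ymv opprB addrCA subrr addr0.
have vD : `|v| = D / 2 by rewrite /v normrZ gtr0_norm ?invr_gt0// mulrC.
have vd : `|v| < d by rewrite vD; rewrite -/D in ud; lra.
have := Hp y v; rewrite ya yv ymv => /(_ vd vd) He.
pose al := f p u - f p0 a; pose be := f p a - f p0 a; pose mu := f p y - f p0 a.
have eE : al + be - 2 *: mu = f p u + f p a - 2 *: f p y.
  by apply/rowP => i; rewrite !mxE; ring.
rewrite -eE in He.
have al_ep : `|al| < ep by exact: Htp.
have be_ep : `|be| < ep by apply: Htp; rewrite a0.
have mu_ep : `|mu| < ep by apply: Htp; rewrite ya vD; rewrite -/D in ut; lra.
have epr : ep <= r / 2 by rewrite ge_min lexx.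
have ab : al - be = f p u - f p a by rewrite /al /be opprB addrA subrK.
have abr : `|al - be| < r.
  by rewrite (le_lt_trans (ler_normB _ _))//; lra.
have DK : D <= K * `|al - be|.
  have := Hbp (f p a) (al - be); rewrite ab addrCA subrr addr0 -ab.
  rewrite (AB (p, u) (conj Ap (HB _ us))) /=.
  have Ba : B a by apply: HB; rewrite a0.
  rewrite (AB (p, a) (conj Ap Ba)) /=; apply => //.
  by rewrite (lt_le_trans be_ep)//; lra.
rewrite -/y -/mu -/al -/be; have /= -> := dotp_midpoint al be mu.
set e := al + be - 2 *: mu in He *.
have e4 : `|e| <= 4 * ep.
  rewrite (le_trans (ler_normB _ _))// normrZ ger0_norm//.
  by have := ler_normD al be; lra.
have abn : `|al + be| <= 2 * ep by have := ler_normD al be; lra.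
have h1 := dotp_ge_norm (al - be).
have h2 := dotp_le_norm (al + be) e; have h3 := dotp_le_norm e e.
rewrite vD in He.
pose W := `|al - be|; rewrite -/W in DK h1.
have W0 : 0 < W.
  rewrite lt_def normr_ge0 andbT; apply: contraTneq D0 => W0.
  by rewrite -leNgt (le_trans DK)// W0 mulr0.
have epT : ep * T < 2^-1.
  have : ep * (2 * (T + 1)) <= 1.
    by rewrite -ler_pdivlMr ?mulr_gt0 ?ltr_wpDl// div1r ge_min lexx orbT.
  by lra.
have n0 : 0 <= n%:R :> R by [].
have e0 := normr_ge0 e.
have S0 := normr_ge0 (al + be).
have b2 : n%:R * (`|al + be| * `|e|) <= n%:R * (2 * ep * (C * (D / 2) ^+ 2)).
  by rewrite ler_wpM2l// ler_pM.
have b3 : n%:R * (`|e| * `|e|) <= n%:R * (4 * ep * (C * (D / 2) ^+ 2)).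
  by rewrite ler_wpM2l// ler_pM.
have D2 : n%:R * C * ep * D ^+ 2 <= ep * T * W ^+ 2.
  rewrite (_ : ep * T * W ^+ 2 = n%:R * C * ep * (K * W) ^+ 2); last first.
    by rewrite /T; ring.
  rewrite ler_wpM2l ?mulr_ge0 ?(ltW ep0)// lerXn2r ?nnegrE ?mulr_ge0//.
    exact: ltW.
  exact: ltW.
have D3 : ep * T * W ^+ 2 < 2^-1 * W ^+ 2 by rewrite ltr_pM2r ?exprn_gt0.
move: h2 h3; rewrite !ler_norml => /andP[h2 _] /andP[_ h3].
have b23 : n%:R * (2 * ep * (C * (D / 2) ^+ 2)) +
   n%:R * (4 * ep * (C * (D / 2) ^+ 2)) / 2 = n%:R * C * ep * D ^+ 2 by field.
lra.
Qed.

(** A maximiser at [t] still competes nearby, which bounds [E] from below; compactness makes the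
    upper bound uniform in [k]. *)
Lemma continuous_compact_max (R : realType) (S T : topologicalType) (K : set S)
    (f : S -> T -> R) : compact K -> K !=set0 ->
  continuous (fun u => f u.1 u.2) ->
  exists2 E : T -> R, continuous E & forall t,
    (exists2 k, K k & E t = f k t) /\ forall k, K k -> f k t <= E t.
Proof.
move=> cK K0 cf.
have cft t : continuous (fun k => f k t).
  move=> k; have ck : (k', t) @[k' --> k] --> (k, t).
    exact: (cvg_pair cvg_id (cvg_cst t)).
  exact: (cvg_comp _ _ ck (cf (k, t))).
have /choice[m Hm] : forall t, exists k, K k /\ forall k', K k' -> f k' t <= f k t.
  move=> t; have [k /set_mem Kk Hk] :=
    compact_EVT_max K0 cK (continuous_subspaceT (cft t)).
  by exists k; split=> // k' Kk'; apply: Hk; exact: mem_set.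
exists (fun t => f (m t) t); last first.
  by move=> t; have [Kk Hk] := Hm t; split=> //; exists (m t).
move=> t; apply/cvgrPdist_lt => e e0.
have [Kmt Hmt] := Hm t.
have low : \forall t' \near t, f (m t) t - e < f (m t) t'.
  have ct : (m t, t') @[t' --> t] --> (m t, t).
    exact: (cvg_pair (cvg_cst (m t)) cvg_id).
  have := cvg_comp _ _ ct (cf (m t, t)) => /= cmt.
  have := @cvgr_gt _ _ _ _ _ _ cmt (f (m t) t - e).
  by apply; rewrite ltrBlDr ltrDl.
have up : \forall t' \near t, K `<=` [set k | f k t' < f (m t) t + e].
  apply: ((compact_near_coveringP K).1 cK) => k Kk.
  have lt_e : f k t < f (m t) t + e.
    by rewrite (le_lt_trans (Hmt _ Kk))// ltrDl.
  exact: (@cvgr_lt _ _ _ _ _ _ (cf (k, t)) _ lt_e).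
apply: filterS2 low up => t' low up.
have [Kmt' Hmt'] := Hm t'.
have := up _ Kmt'; have := Hmt' _ Kmt => /=.
by rewrite ltr_norml => ? ?; apply/andP; split; lra.
Qed.

(** A squared coordinate distance cut off at [r]. The ball [q <= r] is compact inside the chart
    image, so its copy [B] is closed in the Hausdorff [M], and the constant [r] extends continuously
    beyond the chart. *)
Lemma chart_bump {R : realType} {n : nat} {M : manifoldType 'rV[R]_n}
    (c : chart 'rV[R]_n M) (x0 : M) : cdom c x0 ->
  exists (r : R) (e : M -> R), [/\ 0 < r, continuous e,
    forall z, e z < r ->
      cdom c z /\ e z = dotp (cmap c z - cmap c x0) (cmap c z - cmap c x0),
    e x0 = 0 & forall N, nbhs x0 N -> exists2 s, 0 < s & forall z, e z < s -> N z].
Proof.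
move=> cx; set a := cmap c x0; pose q w := dotp (w - a) (w - a).
have nim : nbhs a (cmap c @` cdom c).
  by apply: open_nbhs_nbhs; split; [exact: cimg_open|exists x0].
have /nbhs_distP[d d0 Hd] := nim.
have d20 : 0 < d / 2 by rewrite divr_gt0.
pose r := (d / 2) ^+ 2; have r0 : 0 < r by rewrite exprn_gt0.
pose A := [set w | q w <= r].
have q_lt w s : 0 < s -> q w <= s ^+ 2 -> `|w - a| <= s.
  move=> s0 qs; have := le_trans (dotp_ge_norm (w - a)) qs.
  by rewrite ler_pXn2r// nnegrE// ltW.
have Aim w : A w -> (cmap c @` cdom c) w.
  by move=> /q_lt -/(_ d20) wd; apply: Hd; lra.
have cq : continuous q.
  apply: (@continuous_comp1 _ _ _ (fun v => dotp v v)).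
    exact: dotp_continuous.
  by move=> w; exact: (cvgB cvg_id (cvg_cst a)).
have cA : compact A.
  apply: bounded_closed_compact.
    exists (`|a| + d); split; first exact: num_real.
    move=> M' HM w /q_lt -/(_ d20) wd /=.
    rewrite -(subrK a w) (le_trans (ler_normD _ _))//; lra.
  rewrite (_ : A = q @^-1` [set t | t <= r])//.
  apply: preimage_closed; last exact: closed_le.
  by move=> w _; exact: cq.
pose B := cinv c @` A.
have clB : closed B.
  apply: (compact_closed (@manifold_hausdorff _ _ M)).
  apply: continuous_compact cA; apply: continuous_in_subspaceT.
  by move=> w /set_mem/Aim[z cz <-]; exact: cinv_continuous.
have BP z : B z <-> cdom c z /\ q (cmap c z) <= r.
  split=> [[w Aw <-]|[cz qz]]; last by exists (cmap c z); rewrite ?cmapK.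
  by have [y cy yw] := Aim _ Aw; rewrite -yw cmapK//; split=> //; rewrite yw.
pose e z := if `[< B z >] then q (cmap c z) else r.
have e_in z : cdom c z -> e z = Num.min (q (cmap c z)) r.
  move=> cz; rewrite /e; case: asboolP => [/BP[_ qr]|nB]; first by rewrite min_l.
  by rewrite min_r// leNgt; apply/negP => /ltW qr; apply: nB; apply/BP.
exists r, e; split=> //.
- move=> z; have [cz|ncz] := pselect (cdom c z); last first.
    have nBz : nbhs z (~` B).
      by apply: open_nbhs_nbhs; split; [exact: closed_openC|move/BP => []].
    apply: (@cvg_trans _ (r @[y --> z])).
      apply: near_eq_cvg; apply: filterS nBz => y nBy.
      by rewrite /e; case: asboolP.
    by rewrite /e; case: asboolP => [/BP[]//|_]; exact: cvg_cst.
  rewrite /continuous_at e_in//.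
  apply: (@cvg_trans _ (Num.min (q (cmap c y)) r @[y --> z])).
    have nc : nbhs z (cdom c) by apply: open_nbhs_nbhs; split=> //; exact: cdom_open.
    by apply: near_eq_cvg; apply: filterS nc => y cy; rewrite e_in.
  apply: (@continuous_min _ _ (fun y => q (cmap c y)) (fun=> r) z).
    exact: (cvg_comp _ _ (cmap_continuous cz) (cq _)).
  exact: cvg_cst.
- by move=> z; rewrite /e; case: asboolP => [/BP[]//|_]; rewrite ltxx.
- by rewrite e_in// /q subrr /dotp big1 ?min_l ?(ltW r0)// => i _; rewrite mxE mul0r.
- move=> N nN; have nci : nbhs a (cinv c @^-1` N).
    by apply: (cinv_continuous cx); rewrite cmapK.
  have /nbhs_distP[s s0 Hs] := nci.
  have s20 : 0 < s / 2 by rewrite divr_gt0.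
  exists (Num.min r ((s / 2) ^+ 2)); first by rewrite lt_min r0 exprn_gt0.
  move=> z; rewrite lt_min /e; case: asboolP => [/BP[cz _]|]; last first.
    by rewrite ltxx.
  move=> /andP[_ /ltW /q_lt -/(_ s20) zs].
  by have := Hs (cmap c z); rewrite /= cmapK//; apply; lra.
Qed.

(** * The principal bundle of a bibundle *)

Section PrincipalBundle.
Context {R : realType} {nG nH nX nY nZ : nat}.
Context {G : compactLieGroupType 'rV[R]_nG} {H : compactLieGroupType 'rV[R]_nH}.
Context {X : gmanifold 'rV[R]_nX G} {Y : gmanifold 'rV[R]_nY H}.
Context (Z : bibundle 'rV[R]_nZ X Y).
Local Notation lam := (bb_lambda (Z := Z)).
Local Notation "z .* h" := (bb_ract (z : Z) h) (at level 40, left associativity).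
Local Notation zact := (@act _ (bibundle_gspace Z)).

Lemma bb_ract_inj (z : Z) : injective (bb_ract z).
Proof.
move=> h h' zh; have [_ _ [g _ fK]] := bb_lambda_principal Z.
have := can_inj fK; move=> /(_ (h^-1%g, z) (h'^-1%g, z)) /=.
by rewrite !invgK zh => /(_ erefl) /pair_equal_spec[/invg_inj].
Qed.

Lemma bb_ract_trans (z z' : Z) : lam z = lam z' -> exists h, z .* h = z'.
Proof.
move=> zz'; have [[_ _ surj] _ _] := bb_lambda_principal Z.
have [[h w] _ [<- <-]] := surj (z, z') zz'.
by exists h^-1%g.
Qed.

(** The division map of the principal bundle, with default value [1] off the fibre product. *)
Definition bb_div (z z' : Z) : H := xget 1%g [set h | z .* h = z'].

Lemma bb_ractK (z z' : Z) : lam z = lam z' -> z .* bb_div z z' = z'.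
Proof.
by move=> /bb_ract_trans[h zh]; apply: (@xgetPex _ 1%g [set h | z .* h = z']); exists h.
Qed.

Lemma bb_div_ract (z : Z) h : bb_div z (z .* h) = h.
Proof. by apply: (@bb_ract_inj z); rewrite bb_ractK// bb_lambda_invariant. Qed.

(** Division is smooth along the fibre product, hence the local ambient extension [g]. The inverse
    stems from the principal map, which sends [(h, z)] to [(z, z h^-1)]. *)
Lemma bb_div_smooth (u : Z * Z) : lam u.1 = lam u.2 ->
  exists2 g : Z * Z -> (H * Z)%type, smooth_at g u &
    \forall v \near u, lam v.1 = lam v.2 -> bb_div v.1 v.2 = (g v).1^-1%g.
Proof.
move=> lu; have [_ _ [g sg fK]] := bb_lambda_principal Z.
have [g' [sg' gg']] := sg _ lu; exists g' => //.
apply: filterS gg' => -[z z'] /= gg' zz'; rewrite -(gg' zz').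
have [h <-] := bb_ract_trans zz'; rewrite bb_div_ract.
by have := fK (h^-1%g, z); rewrite /= invgK => ->; rewrite /= invgK.
Qed.

Lemma bb_div_near (u : Z * Z) (O : set H) : lam u.1 = lam u.2 ->
  nbhs (bb_div u.1 u.2) O ->
  \forall v \near u, lam v.1 = lam v.2 -> O (bb_div v.1 v.2).
Proof.
move=> lu nO; have [g sg gE] := bb_div_smooth lu.
have gu := nbhs_singleton gE lu; rewrite gu in nO.
have cg : (g v).1^-1%g @[v --> u] --> (g u).1^-1%g.
  have cg1 : (g v).1 @[v --> u] --> (g u).1.
    exact: (cvg_comp _ _ (smooth_at_continuous sg) cvg_fst).
  exact: (cvg_comp _ _ cg1 (@invg_continuous H _)).
by apply: filterS2 gE (cg _ nO) => v vE /= Ov lv; rewrite vE.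
Qed.

Lemma bb_div_continuous {T : topologicalType} (a b : T -> Z) :
  continuous a -> continuous b -> (forall t, lam (a t) = lam (b t)) ->
  continuous (fun t => bb_div (a t) (b t)).
Proof.
move=> ca cb ab t O nO.
have cab : (a t', b t') @[t' --> t] --> (a t, b t) by exact: (cvg_pair (ca t) (cb t)).
suff : \forall t' \near t, O (bb_div (a t') (b t')) by [].
have nO' : \forall t' \near t, lam (a t') = lam (b t') -> O (bb_div (a t') (b t')).
  exact: cab _ (@bb_div_near (a t, b t) O (ab t) nO).
by apply: filterS nO' => t'; apply.
Qed.

Lemma bb_lambda_nbhs (z : Z) A : nbhs z A -> nbhs (lam z) (lam @` A).
Proof. exact: submersion_open (bb_lambda_submersion Z) z A. Qed.

Lemma bb_ract_continuous : continuous (fun u : Z * H => u.1 .* u.2).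
Proof. exact: smooth_continuous (bb_ract_smooth (Z := Z)). Qed.

Lemma bb_ract_orbit_continuous (z : Z) : continuous (bb_ract z).
Proof.
apply: (continuous_comp2 bb_ract_continuous) => h; first exact: cvg_cst.
exact: cvg_id.
Qed.

(** If the fibre of [z] misses [C], compactness of [H] makes the orbits of all points near [z] miss
    it; [lam] is open. *)
Lemma bb_lambda_closed (C : set Z) : closed C -> closed (lam @` C).
Proof.
move=> clC; suff oC : open (~` (lam @` C)).
  by have := open_closedC oC; rewrite setCK.
rewrite openE => x nCx; have [z zx] := bb_lambda_surjective Z x.
have : \forall z' \near z, [set: H] `<=` [set h | ~ C (z' .* h)].
  apply: ((compact_near_coveringP _).1 (@compactg H)) => h _.
  have nC : nbhs (z .* h) (~` C).
    apply: open_nbhs_nbhs; split; first exact: closed_openC.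
    by move=> Czh; apply: nCx; exists (z .* h); rewrite ?bb_lambda_invariant.
  have := bb_ract_continuous (x := (z, h)) nC.
  case=> -[A B] /= [nA nB] AB; exists (B, A) => //= -[h' z'] [/= Bh Az].
  exact: (AB (z', h')).
move=> /bb_lambda_nbhs; rewrite zx; apply: filterS => _ [z' Hz' <-] [w Cw wz'].
by have [h zh] := bb_ract_trans (esym wz'); apply: (Hz' h) => //; rewrite /= zh.
Qed.

Lemma bb_lambda_zact k z : lam (zact k z) = gm_act k.1 (lam z).
Proof. by rewrite /= bb_lambda_invariant bb_lambda_equivariant. Qed.

Lemma zact_ract k z h : zact k (z .* h) = zact k z .* (k.2 * h * k.2^-1)%g.
Proof. by rewrite /= bb_actC -!bb_ractM !mulgA mulVg mul1g. Qed.

(** [strict_midpoint_convexity] for the orbit map [h |-> k (z h)], with parameter [(k, z)] and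
    segments straight in the chart [d] and ending at [1]. The left inverse it asks for comes from
    the division map, so immersivity of orbit maps is used in the form of a smooth division. *)
Lemma fiber_convexity (k0 : G * H) (z0 : Z) (c : chart 'rV[R]_nZ Z)
    (d : chart 'rV[R]_nH H) : atlas c -> atlas d -> cdom c z0 -> cdom d 1%g ->
  zact k0 z0 = z0 ->
  let Q z := dotp (cmap c z - cmap c z0) (cmap c z - cmap c z0) in
  \forall w \near ((k0, z0), 1%g : H), w.2 <> 1%g ->
    2 * Q (zact w.1.1 (w.1.2 .* cinv d (2^-1 *: (cmap d w.2 + cmap d 1%g)))) <
    Q (zact w.1.1 (w.1.2 .* w.2)) + Q (zact w.1.1 w.1.2).
Proof.
move=> ac ad cz d1 k0z0 Q.
pose P : topologicalType := ((G * H) * Z)%type; pose p0 : P := (k0, z0).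
have fG := @fin_dim_rV R nG; have fH := @fin_dim_rV R nH.
have fZ := @fin_dim_rV R nZ.
pose a (p : P) (h : H) := zact p.1 (p.2 .* h).
have ck1 : p.1.1 @[p --> p0] --> k0.1 by exact: (cvg_comp _ _ cvg_fst cvg_fst).
have ck2 : p.1.2 @[p --> p0] --> k0.2 by exact: (cvg_comp _ _ cvg_fst cvg_snd).
have cp2 : p.2 @[p --> p0] --> z0 by exact: cvg_snd.
have cV1 : p.1.1^-1%g @[p --> p0] --> k0.1^-1%g.
  exact: (cvg_comp _ _ ck1 (@invg_continuous G _)).
have cV2 : p.1.2^-1%g @[p --> p0] --> k0.2^-1%g.
  exact: (cvg_comp _ _ ck2 (@invg_continuous H _)).
have az0 : a p0 1%g = z0 by rewrite /a bb_ract1.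
have Ha : mC11 a p0 1%g.
  have H1 : mC11 (fun (p : P) (h : H) => p.2 .* h) p0 1%g.
    apply: (smooth_mC11_r (f := fun u : Z * H => u.1 .* u.2)) => //.
    exact: bb_ract_smooth.
  have H2 : mC11 (fun (p : P) (z : Z) => bb_lact p.1.1 z) p0 (z0 .* 1%g).
    apply: (smooth_mC11_r (f := fun u : G * Z => bb_lact u.1 u.2)) => //.
    exact: bb_lact_smooth.
  have H3 : mC11 (fun (p : P) (z : Z) => z .* p.1.2^-1%g) p0 (bb_lact k0.1 (z0 .* 1%g)).
    apply: (smooth_mC11_l (f := fun u : Z * H => u.1 .* u.2)) => //.
    exact: bb_ract_smooth.
  exact: (mC11_comp (mC11_comp H1 H2) H3).
have [g sg gE] := @bb_div_smooth (z0, z0) erefl.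
have g1 : (g (z0, z0)).1 = 1%g.
  have := nbhs_singleton gE erefl; rewrite /= -{2}(bb_ract1 z0) bb_div_ract.
  by move/esym/(congr1 (fun h : H => h^-1%g)); rewrite invgK invg1.
(* Undo [k], then divide by [p.2]. The extension [g] replaces [bb_div] because an arbitrary argument
   near [z0] need not return to the fibre of [p.2]. *)
pose b (p : P) (z : Z) := (g (p.2, bb_lact p.1.1^-1%g (z .* p.1.2))).1^-1%g.
have k0z : bb_lact k0.1^-1%g (z0 .* k0.2) = z0.
  have := k0z0; rewrite /= => /(congr1 (fun z => bb_lact k0.1^-1%g (z .* k0.2))).
  by rewrite -bb_ractM mulVg bb_ract1 -bb_lactM mulVg bb_lact1.
have Hb : mC11 b p0 z0.
  have H1 : mC11 (fun (p : P) (z : Z) => z .* p.1.2) p0 z0.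
    apply: (smooth_mC11_l (f := fun u : Z * H => u.1 .* u.2)) => //.
    exact: bb_ract_smooth.
  have H2 : mC11 (fun (p : P) (z : Z) => bb_lact p.1.1^-1%g z) p0 (z0 .* k0.2).
    apply: (smooth_mC11_r (f := fun u : G * Z => bb_lact u.1 u.2)) => //.
    exact: bb_lact_smooth.
  have H12 := mC11_comp H1 H2.
  have H3 : mC11 (fun (p : P) (z : Z) => g (p.2, z)) p0 (bb_lact k0.1^-1%g (z0 .* k0.2)).
    apply: (smooth_mC11_r (f := g)) => //; first exact: fin_dim_prod.
    by rewrite k0z.
  have H4 := mC11_fst (mC11_comp H12 H3).
  have H5 : mC11 (fun (p : P) (h : H) => h^-1%g) p0
      (g (z0, bb_lact k0.1^-1%g (z0 .* k0.2))).1.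
    by apply: smooth_mC11 => //; exact: invg_smooth.
  exact: (mC11_comp H4 H5).
have bz0 : b p0 z0 = 1%g by rewrite /b /= k0z g1 invg1.
pose f (p : P) u := cmap c (a p (cinv d u)).
pose b' (p : P) w := cmap d (b p (cinv c w)).
have Hf : C11 f p0 (cmap d 1%g) by apply: (proj2 Ha) => //; rewrite az0.
have Hb' : C11 b' p0 (f p0 (cmap d 1%g)).
  by rewrite /f cmapK// az0; apply: (proj2 Hb) => //; rewrite bz0.
have cpu : (u.1, cinv d u.2) @[u --> (p0, cmap d 1%g)] --> (p0, 1%g : H).
  have c1 : u.1 @[u --> (p0, cmap d 1%g)] --> p0 by exact: cvg_fst.
  have c2 : cinv d u.2 @[u --> (p0, cmap d 1%g)] --> (1%g : H).
    apply: (cvg_comp _ _ cvg_snd); have := cinv_continuous d1.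
    by rewrite /prop_for /continuous_at cmapK.
  exact: (cvg_pair c1 c2).
have inv_ab : \forall u \near (p0, cmap d 1%g), b' u.1 (f u.1 u.2) = u.2.
  have n1 : \forall u \near (p0, cmap d 1%g), cdom c (a u.1 (cinv d u.2)).
    have nc : nbhs (a p0 1%g) (cdom c).
      by rewrite az0; apply: open_nbhs_nbhs; split=> //; exact: cdom_open.
    exact: (cvg_comp _ _ cpu (proj1 Ha)) nc.
  have n2 : \forall u \near (p0, cmap d 1%g),
      bb_div u.1.2 (u.1.2 .* cinv d u.2) = (g (u.1.2, u.1.2 .* cinv d u.2)).1^-1%g.
    have c2 : (w.1.2, w.1.2 .* w.2) @[w --> (p0, 1%g : H)] --> (z0, z0).
      have c21 : w.1.2 @[w --> (p0, 1%g : H)] --> z0.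
        exact: (cvg_comp _ _ cvg_fst cp2).
      have c22 : w.1.2 .* w.2 @[w --> (p0, 1%g : H)] --> z0.
        have := @bb_ract_continuous (z0, 1%g); rewrite /continuous_at /= bb_ract1.
        exact: (cvg_comp _ _ (cvg_pair c21 cvg_snd)).
      exact: (cvg_pair c21 c22).
    have n2 : \forall u \near (p0, cmap d 1%g), lam u.1.2 = lam (u.1.2 .* cinv d u.2) ->
        bb_div u.1.2 (u.1.2 .* cinv d u.2) = (g (u.1.2, u.1.2 .* cinv d u.2)).1^-1%g.
      exact: (cvg_comp _ _ cpu c2) gE.
    by apply: filterS n2 => u; apply; rewrite bb_lambda_invariant.
  have n3 : \forall u \near (p0, cmap d 1%g), (cmap d @` cdom d) u.2.
    have nd : nbhs (cmap d 1%g) (cmap d @` cdom d).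
      by apply: open_nbhs_nbhs; split; [exact: cimg_open|exists 1%g].
    have c1 : u.2 @[u --> (p0, cmap d 1%g)] --> cmap d 1%g by exact: cvg_snd.
    exact: c1 nd.
  apply: filterS3 n1 n2 n3 => -[p w] /= n1 n2 [h dh hw].
  have dw : cinv d w = h by rewrite -hw cmapK.
  rewrite /b' /f dw; rewrite dw in n1; rewrite dw in n2.
  rewrite (cmapK n1) -hw; congr (cmap d _).
  rewrite /b /a /= -bb_ractM mulVg bb_ract1 -bb_lactM mulVg bb_lact1 -n2.
  by rewrite bb_div_ract.
have conv := strict_midpoint_convexity Hf Hb' inv_ab.
have cph : (w.1, cmap d w.2) @[w --> (p0, 1%g : H)] --> (p0, cmap d 1%g).
  have c1 : w.1 @[w --> (p0, 1%g : H)] --> p0 by exact: cvg_fst.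
  have c2 : cmap d w.2 @[w --> (p0, 1%g : H)] --> cmap d 1%g.
    exact: (cvg_comp snd (cmap d) cvg_snd (cmap_continuous d1)).
  exact: (cvg_pair c1 c2).
have nd : \forall w \near (p0, 1%g : H), cdom d w.2.
  have nd : nbhs (1%g : H) (cdom d).
    by apply: open_nbhs_nbhs; split=> //; exact: cdom_open.
  have c1 : w.2 @[w --> (p0, 1%g : H)] --> (1%g : H) by exact: cvg_snd.
  exact: c1 nd.
have conv' : \forall w \near (p0, 1%g : H), cmap d w.2 <> cmap d 1%g ->
    let F v := dotp (f w.1 v - f p0 (cmap d 1%g)) (f w.1 v - f p0 (cmap d 1%g)) in
    2 * F (2^-1 *: (cmap d w.2 + cmap d 1%g)) < F (cmap d w.2) + F (cmap d 1%g).
  exact: cph conv.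
apply: filterS2 nd conv' => -[p h] /= dh H1' h1.
have H1 : cmap d h <> cmap d 1%g.
  by move=> /(congr1 (cinv d)); rewrite !cmapK.
have := H1' H1; rewrite /f cmapK// az0 !cmapK// /Q /a /= bb_ract1.
by [].
Qed.

End PrincipalBundle.

(** * Local sections through fixed points *)

Section LocalSection.
Context {R : realType} {nG nH nX nY nZ : nat}.
Context {G : compactLieGroupType 'rV[R]_nG} {H : compactLieGroupType 'rV[R]_nH}.
Context {X : gmanifold 'rV[R]_nX G} {Y : gmanifold 'rV[R]_nY H}.
Context (Z : bibundle 'rV[R]_nZ X Y).
Local Notation lam := (bb_lambda (Z := Z)).
Local Notation "z .* h" := (bb_ract (z : Z) h) (at level 40, left associativity).
Local Notation zact := (@act _ (bibundle_gspace Z)).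

Lemma closed_subgroup_compact (L : compactGroupType) (K : closed_subgroup L) :
  compact (K : set L).
Proof.
by apply: (subclosed_compact _ (@compactg L)) => //; exact: csg_closed.
Qed.

(* The section picks in each fibre the minimiser of [E z = max_(k in K) e (kz)],
   with [e] the squared distance to [z0] in a chart. Strict convexity makes the
   minimiser unique, hence continuous in the base point and [K]-fixed. *)
Lemma local_section (K : closed_subgroup (G * H)%type) (z0 : Z) :
  (forall k, K k -> zact k z0 = z0) ->
  exists (U : set X) (s : X -> Z), [/\ open U, U (lam z0),
    forall x, lam (s x) = x,
    forall x, U x -> {for x, continuous s} &
    forall x, U x -> (forall k, K k -> gm_act k.1 x = x) ->
      forall k, K k -> zact k (s x) = s x].
Proof.
move=> Kz0.
have [c ac cz] := atlas_cover z0; have [d ad d1] := atlas_cover (1%g : H).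
have [r [e [r0 ce eE e0 eN]]] := chart_bump cz.
have [] := @continuous_compact_max R (G * H)%type Z K (fun k z => e (zact k z)).
- exact: closed_subgroup_compact.
- by exists 1%g; exact: csg1.
- exact: (continuous_comp1 ce (@act_continuous _ (bibundle_gspace Z))).
move=> E cE HE.
have E0 : E z0 = 0 by have [[k Kk ->] _] := HE z0; rewrite Kz0.
have EK k z : K k -> E (zact k z) = E z.
  have le k' z' : K k' -> E (zact k' z') <= E z'.
    move=> Kk'; have [[l Kl ->] _] := HE (zact k' z').
    by rewrite -actM; apply: (proj2 (HE z')); exact: csgM.
  move=> Kk; apply/eqP; rewrite eq_le le//=.
  rewrite -{1}[z](@act1 _ (bibundle_gspace Z)) -(mulVg k) actM.
  by apply: le; exact: csgV.
have eleE z : e z <= E z.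
  by have := proj2 (HE z) 1%g (@csg1 _ K); rewrite act1.
pose mid h := cinv d (2^-1 *: (cmap d h + cmap d 1%g)).
have mid1 : mid 1%g = 1%g.
  rewrite /mid -mulr2n -[cmap d 1%g *+ 2]scaler_nat scalerA mulVf ?pnatr_eq0//.
  by rewrite scale1r cmapK.
have cmid : mid h @[h --> (1%g : H)] --> (1%g : H).
  have c1 : 2^-1 *: (cmap d h + cmap d 1%g) @[h --> (1%g : H)] --> cmap d 1%g.
    rewrite -[X in _ --> X](_ : 2^-1 *: (cmap d 1%g + cmap d 1%g) = _); last first.
      rewrite -mulr2n -[cmap d 1%g *+ 2]scaler_nat scalerA mulVf ?pnatr_eq0//.
      by rewrite scale1r.
    by apply: cvgZr; apply: cvgD; [exact: (cmap_continuous d1)|exact: cvg_cst].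
  have := cinv_continuous d1; rewrite /prop_for /continuous_at cmapK// => c2.
  exact: (cvg_comp _ _ c1 c2).
have nEr (q : Z * H -> Z) : q w @[w --> (z0, 1%g : H)] --> z0 ->
    \forall w \near (z0, 1%g : H), E (q w) < r.
  move=> cq; have cEq : E (q w) @[w --> (z0, 1%g : H)] --> E z0.
    exact: (cvg_comp _ _ cq (cE z0)).
  by apply: (@cvgr_lt _ _ _ _ _ _ cEq); rewrite E0.
have c1 : w.1 @[w --> (z0, 1%g : H)] --> z0 by exact: cvg_fst.
have c2 : w.2 @[w --> (z0, 1%g : H)] --> (1%g : H) by exact: cvg_snd.
have cr : u.1 .* u.2 @[u --> (z0, 1%g : H)] --> z0.
  by have := bb_ract_continuous (x := (z0, 1%g)); rewrite /continuous_at /= bb_ract1.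
have c3 : w.1 .* mid w.2 @[w --> (z0, 1%g : H)] --> z0.
  exact: (cvg_comp _ _ (cvg_pair c1 (cvg_comp _ _ c2 cmid)) cr).
(* Compactness of [K] makes fibre convexity uniform in [k]. A [k] attaining [E] at the midpoint
   transfers it to [E], because [e] agrees with [Q] below the cutoff [r]. *)
have convE : \forall w \near (z0, 1%g : H), w.2 <> 1%g ->
    E (w.1 .* mid w.2) < E w.1 \/ E (w.1 .* mid w.2) < E (w.1 .* w.2).
  pose Q z := dotp (cmap c z - cmap c z0) (cmap c z - cmap c z0).
  have convQ : \forall w \near (z0, 1%g : H), (K : set _) `<=` [set k | w.2 <> 1%g ->
      2 * Q (zact k (w.1 .* mid w.2)) <
      Q (zact k (w.1 .* w.2)) + Q (zact k w.1)].
    pose bad (w : Z * H) (k : G * H) := w.2 <> 1%g ->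
      2 * Q (zact k (w.1 .* mid w.2)) <
      Q (zact k (w.1 .* w.2)) + Q (zact k w.1).
    have := (compact_near_coveringP _).1 (@closed_subgroup_compact _ K)
      (Z * H)%type (nbhs (z0, 1%g : H)) bad _; apply => k Kk.
    have [[A1 O] [/= [[B N] [/= nB nN] BN] nO] AO] :=
      fiber_convexity ac ad cz d1 (Kz0 k Kk).
    exists (B, N `*` O) => /=; first by split=> //; exists (N, O).
    move=> [k' [z h]] [/= Bk' [/= Nz Oh]] /= h1.
    exact: (AO ((k', z), h) (conj (BN (k', z) (conj Bk' Nz)) Oh)).
  apply: filterS2 convQ (filterI (nEr _ c1) (filterI (nEr _ cr) (nEr _ c3))).
  move=> [z h] /= convQ [Ez [Ezh Ezm]] h1.
  have [[k Kk Ek] _] := HE (z .* mid h).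
  have := convQ k Kk h1.
  have QE z' : E z' < r -> Q (zact k z') = e (zact k z').
    move=> Ez'; have lt_r := le_lt_trans (proj2 (HE z') k Kk) Ez'.
    by have [_ ->] := eE _ lt_r.
  rewrite !QE// -Ek.
  have := proj2 (HE z) k Kk; have := proj2 (HE (z .* h)) k Kk.
  have [lt1|ge1] := boolP (E (z .* mid h) < E z); first by left.
  rewrite -leNgt in ge1.
  by move=> *; right; lra.
(* As [e <= E], points with [E < ep] are so close to [z0] that the quotient of two of them in one
   fibre is in the range of [convE]; the midpoint then beats one of the two. *)
have [ep ep0 Hep] : exists2 ep, 0 < ep & forall z z', E z < ep -> E z' < ep ->
    lam z = lam z' -> z <> z' ->
    exists2 z'', lam z'' = lam z & E z'' < E z \/ E z'' < E z'.
  have [[N O] [/= nN nO] NO] := convE.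
  have nO' : nbhs (bb_div z0 z0) O by rewrite -{2}(bb_ract1 z0) bb_div_ract.
  have [[N1 N2] [/= nN1 nN2] N12] := bb_div_near (u := (z0, z0)) erefl nO'.
  have [s s0 Hs] := eN _ (filterI nN (filterI nN1 nN2)).
  exists s => // z z' Ez Ez' zz' zNz'.
  have [Nz [N1z _]] := Hs z (le_lt_trans (eleE z) Ez).
  have [_ [_ N2z']] := Hs z' (le_lt_trans (eleE z') Ez').
  have Od := N12 (z, z') (conj N1z N2z') zz'.
  have dz' := bb_ractK zz'.
  have d1' : bb_div z z' <> 1%g.
    by move=> d1'; apply: zNz'; rewrite -dz' d1' bb_ract1.
  have := NO (z, bb_div z z') (conj Nz Od) d1'; rewrite /= dz' => h.
  by exists (z .* mid (bb_div z z')); rewrite ?bb_lambda_invariant.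
have /choice[s Hs] : forall x : X, exists z, lam z = x /\
    forall z', lam z' = x -> E z <= E z'.
  move=> x; have [z zx] := bb_lambda_surjective Z x.
  have cEz : continuous (fun h => E (z .* h)).
    exact: (continuous_comp1 cE (bb_ract_orbit_continuous (z := z))).
  have H0 : [set: H] !=set0 by exists 1%g.
  have [h _ Hh] := compact_EVT_min H0 (@compactg H) (continuous_subspaceT cEz).
  exists (z .* h); rewrite bb_lambda_invariant; split=> // z' z'x.
  have [h' <-] := bb_ract_trans (etrans zx (esym z'x)).
  by apply: Hh; exact: mem_set.
have sx x : lam (s x) = x by case: (Hs x).
have smin x z : lam z = x -> E (s x) <= E z by case: (Hs x) => _; apply.
pose U := lam @` [set z | E z < ep].
have EsU x : U x -> E (s x) < ep.
  by move=> [z Ez zx]; exact: le_lt_trans (smin _ _ zx) Ez.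
have uniq x z : U x -> lam z = x -> E z <= E (s x) -> z = s x.
  move=> /EsU Ux zx Ez; apply: contrapT => zs.
  have [|z'' zz'' Ez''] := Hep z (s x) (le_lt_trans Ez Ux) Ux _ zs.
    by rewrite sx.
  have := smin x z'' (etrans zz'' zx); rewrite leNgt => /negP[].
  by case: Ez'' => // Ez''; exact: lt_le_trans Ez'' Ez.
have nElt z (b : R) : E z < b -> nbhs z [set z' | E z' < b].
  by move=> Ez; exact: (@cvgr_lt _ _ _ _ _ _ (cE z)).
exists U, s; split=> //.
- rewrite openE => _ [z Ez <-]; apply: bb_lambda_nbhs; exact: nElt.
- by exists z0; rewrite /= ?E0.
- move=> x Ux W nW.
  pose C := ~` (W^°).
  (* Uniqueness and compactness give a gap between the minimum and the values of [E] on the fibre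
     outside the interior of [W]. It persists nearby: fibres near [x] have a point with [E < b]
     since [lam] is open, but none in [C] with [E <= b] since [lam] is closed. *)
  have [b Esb Hb] : exists2 b, E (s x) < b & forall z, C z -> lam z = x -> b < E z.
    pose D : set H := [set h | C (s x .* h)].
    have crs := bb_ract_orbit_continuous (z := s x).
    have cD : compact D.
      apply: (subclosed_compact _ (@compactg H)) => //.
      apply: (preimage_closed (f := fun h => s x .* h) (D := C)) => [h _|].
        exact: crs.
      by apply: open_closedC; exact: open_interior.
    have [D0|/set0P/negP] := pselect (D !=set0); last first.
      rewrite negbK => /eqP D0; exists (E (s x) + 1); first by rewrite ltrDl.
      move=> z Cz zx; have [h hz] := bb_ract_trans (etrans (sx x) (esym zx)).
      have Dh : D h by rewrite /D /= hz.
      by move: Dh; rewrite D0.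
    have [h /set_mem Dh Hh] := compact_EVT_min D0 cD
      (continuous_subspaceT (continuous_comp1 cE crs)).
    have lt_h : E (s x) < E (s x .* h).
      rewrite ltNge; apply/negP => Eh.
      have hs : s x .* h = s x by apply: uniq => //; rewrite bb_lambda_invariant.
      by move: Dh; rewrite /D /= hs => -[]; exact: nW.
    exists ((E (s x) + E (s x .* h)) / 2); first by lra.
    move=> z Cz zx; have [h' hz] := bb_ract_trans (etrans (sx x) (esym zx)).
    have : E (s x .* h) <= E (s x .* h') by apply: Hh; apply/mem_set; rewrite /D /= hz.
    by rewrite hz; lra.
  pose F := C `&` [set z | E z <= b].
  have clF : closed F.
    apply: closedI; first by apply: open_closedC; exact: open_interior.
    rewrite (_ : [set z | E z <= b] = E @^-1` [set t | t <= b])//.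
    by apply: preimage_closed; [move=> ? _; exact: cE|exact: closed_le].
  have nF : nbhs x (~` (lam @` F)).
    apply: open_nbhs_nbhs; split.
      exact/closed_openC/bb_lambda_closed.
    by move=> [z [Cz Ez] zx]; have := Hb z Cz zx; rewrite ltNge => /negP[].
  have nb : nbhs x (lam @` [set z | E z < b]).
    by rewrite -[x]sx; apply: bb_lambda_nbhs; exact: nElt.
  suff : \forall x' \near x, W (s x') by [].
  apply: filterS2 nF nb => x' nFx' [z Ez zx'].
  apply: contrapT => nW'; apply: nFx'; exists (s x') => //; split.
    by move=> /interior_subset.
  by rewrite /= (le_trans (smin _ _ zx'))// ltW.
- move=> x Ux Kx k Kk; apply: uniq => //.
    by rewrite bb_lambda_zact sx Kx.
  by rewrite EK.
Qed.

End LocalSection.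

(** * Lifting paths and homotopies *)

Section Lifting.
Context {R : realType} {nG nH nX nY nZ : nat}.
Context {G : compactLieGroupType 'rV[R]_nG} {H : compactLieGroupType 'rV[R]_nH}.
Context {X : gmanifold 'rV[R]_nX G} {Y : gmanifold 'rV[R]_nY H}.
Context (Z : bibundle 'rV[R]_nZ X Y) (K : closed_subgroup (G * H)%type).
Local Notation lam := (bb_lambda (Z := Z)).
Local Notation "z .* h" := (bb_ract (z : Z) h) (at level 40, left associativity).
Local Notation zact := (@act _ (bibundle_gspace Z)).
Local Notation zfixed := (@fixed _ (bibundle_gspace Z) K).

Lemma fixed_closed (L : compactGroupType) (M : gspace L) (K' : closed_subgroup L) :
  hausdorff_space M -> closed (fixed (X := M) K').
Proof.
move=> hM z clz k Kk; apply: hM => A B nA nB.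
have nkA : nbhs z (act k @^-1` A) := @act_cst_continuous _ M k z _ nA.
have [w [fw [Aw Bw]]] := clz _ (filterI nkA nB).
by exists w; split=> //; rewrite -(fw k Kk).
Qed.

(** By freeness, the quotient of two fixed points in one fibre commutes with [k.2] for every [k] in
    [K]. *)
Lemma fixed_div (z z' w : Z) : zfixed z -> zfixed z' -> zfixed w ->
  lam z = lam z' -> zfixed (w .* bb_div z z').
Proof.
move=> fz fz' fw zz' k Kk; have := fz' k Kk.
rewrite -{1 2}(bb_ractK zz') zact_ract fz// => /bb_ract_inj kc.
by rewrite zact_ract fw// kc.
Qed.

Definition clampi (a b s : R) : R := Num.max a (Num.min s b).

Lemma clampi_continuous a b : continuous (clampi a b).
Proof.
apply: continuous_rmax => s; first exact: cvg_cst.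
by apply: continuous_rmin => t; [exact: cvg_id|exact: cvg_cst].
Qed.

Lemma clampi_in a b s : a <= b -> a <= clampi a b s <= b.
Proof. by move=> ab; rewrite /clampi le_max lexx ge_max ab ge_min lexx orbT. Qed.

Lemma clampi_left a b e s : b <= e -> s <= b -> clampi a b s = clampi a e s.
Proof. by move=> be sb; rewrite /clampi !min_l// (le_trans sb). Qed.

Lemma clampi_right a b e s : a <= b -> b <= e -> b <= s ->
  clampi b e s = clampi a e s.
Proof.
move=> ab be bs; have bm : b <= Num.min s e by rewrite le_min bs.
by rewrite /clampi !max_r// (le_trans ab).
Qed.

(** A lift over a rectangle is a map on the whole plane above the clamped [F], so that pasting deals
    with globally continuous maps. *)
Definition liftable (F : R * R -> X) (a b c d : R) := exists f : R * R -> Z,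
  [/\ continuous f, forall u, zfixed (f u) &
      forall u, lam (f u) = F (clampi a b u.1, clampi c d u.2)].

(** The two lifts differ on the common edge by an [H]-valued function of the second coordinate, and
    the second lift is translated by it. *)
Lemma liftable_glue1 F a b e c d : a <= b -> b <= e ->
  liftable F a b c d -> liftable F b e c d -> liftable F a e c d.
Proof.
move=> ab be [f1 [c1 W1 L1]] [f2 [c2 W2 L2]].
have Eb t : lam (f2 (b, t)) = lam (f1 (b, t)).
  rewrite L1 L2 /= /clampi. by rewrite (min_l be) minxx maxxx (max_r ab).
have cb (f : R * R -> Z) : continuous f -> continuous (fun u : R * R => f (b, u.2)).
  move=> cf; apply: (continuous_comp2 cf); last exact: continuous_snd.
  by move=> u; exact: cvg_cst.
exists (fun u => if u.1 <= b then f1 u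
                 else f2 u .* bb_div (f2 (b, u.2)) (f1 (b, u.2))); split.
- apply: continuous_paste => //; first exact: continuous_fst.
    apply: (continuous_comp2 (bb_ract_continuous (Z := Z))) => //.
    apply: bb_div_continuous => [||u]; [exact: cb|exact: cb|exact: Eb].
  by move=> [s t] /= ->; rewrite bb_ractK.
- by move=> u; case: ifP => _ //; exact: fixed_div.
- move=> u; case: ifPn => [ub|]; first by rewrite L1 (clampi_left _ be ub).
  by rewrite -ltNge => /ltW bu; rewrite bb_lambda_invariant L2 (clampi_right ab be bu).
Qed.

Let swap (u : R * R) := (u.2, u.1).

Let swap_continuous : continuous swap.
Proof. by apply: continuous_pair; [exact: continuous_snd|exact: continuous_fst]. Qed.

Lemma liftable_swap F a b c d :
  liftable F a b c d -> liftable (F \o swap) c d a b.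
Proof.
move=> [f [cf Wf Lf]]; exists (f \o swap); split=> [|u|u]; last exact: Lf.
- exact: continuous_comp1 cf swap_continuous.
- exact: Wf.
Qed.

Lemma liftable_glue2 F a b c d e : c <= d -> d <= e ->
  liftable F a b c d -> liftable F a b d e -> liftable F a b c e.
Proof.
move=> cd de /liftable_swap l1 /liftable_swap l2.
have /liftable_swap := liftable_glue1 cd de l1 l2.
by rewrite (_ : (F \o swap) \o swap = F)//; apply/funext => -[].
Qed.

Section Square.
Context (F : R * R -> X) (cF : continuous F) (KF : forall u k, K k -> gm_act k.1 (F u) = F u).
Context (z0 : Z) (fz0 : zfixed z0) (lz0 : lam z0 = F (0, 0)).

Let im x := exists2 z, zfixed z & lam z = x.

(** Along points fixed by the projection of [K], having a lift in [Z^K] is open by [local_section]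
    and closed because [lam] and [Z^K] are closed. The radial path joins [u] to the corner, where
    [z0] is a lift. *)
Lemma fixed_image_path u : im (F u).
Proof.
pose g (t : R) := F (t * u.1, t * u.2).
have cg : continuous g.
  apply: (continuous_comp2 cF) => t; apply: cvgM;
    [exact: cvg_id|exact: cvg_cst|exact: cvg_id|exact: cvg_cst].
suff : im (g 0) <-> im (g 1).
  rewrite /g !mul0r !mul1r -surjective_pairing => -[+ _]; apply.
  by exists z0.
have clim : closed im.
  apply: (bb_lambda_closed (Z := Z)).
  exact: (@fixed_closed _ (bibundle_gspace Z) K (@manifold_hausdorff _ _ Z)).
apply: (@cousin R (fun a b => im (g a) <-> im (g b))); first by move=> *; tauto.
move=> t _; have [imt|nimt] := pselect (im (g t)).
- have [z fz zt] := imt.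
  have [U [s [oU Uz ls cs Ks]]] := local_section fz.
  have nU : nbhs (g t) U by rewrite -zt; apply: open_nbhs_nbhs.
  have /nbhs_distP[e e0 He] := cg t _ nU; exists e => // a b *.
  suff imU r : `|r - t| < e -> im (g r) by split=> _; apply: imU; rewrite ltr_norml; lra.
  by move=> /He Ur; exists (s (g r)) => // k Kk; apply: Ks => // l Kl; exact: KF.
- have nim : nbhs (g t) (~` im) by apply: open_nbhs_nbhs; split=> //; exact: closed_openC.
  have /nbhs_distP[e e0 He] := cg t _ nim; exists e => // a b *.
  suff imU r : `|r - t| < e -> ~ im (g r).
    by split=> /imU; case; rewrite ltr_norml; lra.
  exact: He.
Qed.

Lemma liftable_local s0 t0 : exists2 e, 0 < e & forall a b c d,
  s0 - e < a -> a <= b -> b < s0 + e -> t0 - e < c -> c <= d -> d < t0 + e ->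
  liftable F a b c d.
Proof.
have [z fz zst] := fixed_image_path (s0, t0).
have [U [s [oU Uz ls cs Ks]]] := local_section fz.
have nU : nbhs (F (s0, t0)) U by rewrite -zst; apply: open_nbhs_nbhs.
have [[A B] [/= /nbhs_distP[e1 e10 HA] /nbhs_distP[e2 e20 HB] AB]] := cF nU.
exists (Num.min e1 e2); first by rewrite lt_min e10.
move=> a b c d sa ab bs tc cd dt.
pose k (u : R * R) := (clampi a b u.1, clampi c d u.2).
have ck : continuous k.
  apply: continuous_pair.
    exact: (continuous_comp1 (@clampi_continuous a b) continuous_fst).
  exact: (continuous_comp1 (@clampi_continuous c d) continuous_snd).
have m1 : Num.min e1 e2 <= e1 by rewrite ge_min lexx.
have m2 : Num.min e1 e2 <= e2 by rewrite ge_min lexx orbT.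
have Uk u : U (F (k u)).
  have /andP[? ?] := clampi_in u.1 ab; have /andP[? ?] := clampi_in u.2 cd.
  by apply: (AB (k u)); split; [apply: HA|apply: HB]; rewrite /= ltr_norml; lra.
exists (fun u => s (F (k u))); split=> //.
- move=> u; have cFk : F (k v) @[v --> u] --> F (k u).
    exact: (cvg_comp _ _ (ck u) (@cF (k u))).
  exact: (cvg_comp (fun v => F (k v)) s cFk (cs _ (Uk u))).
- by move=> u l Kl; apply: Ks => // l' Kl'; exact: KF.
Qed.

(** Continuous induction replaces a grid: horizontally around a height [t0], the thickness of the
    strip being part of the induction, then vertically over the strips. *)
Lemma lift_square : liftable F 0 1 0 1.
Proof.
have strip t0 : exists2 e, 0 < e & forall c d,
    t0 - e < c -> c <= d -> d < t0 + e -> liftable F 0 1 c d.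
  apply: (@cousin R (fun a b => exists2 e, 0 < e & forall c d,
    t0 - e < c -> c <= d -> d < t0 + e -> liftable F a b c d)).
    move=> a b c ab bc [e1 e10 H1] [e2 e20 H2].
    exists (Num.min e1 e2); first by rewrite lt_min e10.
    move=> x y; have m1 : Num.min e1 e2 <= e1 by rewrite ge_min lexx.
    have m2 : Num.min e1 e2 <= e2 by rewrite ge_min lexx orbT.
    by move=> tx xy yt; apply: (liftable_glue1 ab bc); [apply: H1|apply: H2]; lra.
  move=> s0 _; have [e e0 He] := liftable_local s0 t0; exists e => // a b *.
  by exists e => // c d *; apply: He => //; lra.
apply: (@cousin R (fun c d => liftable F 0 1 c d)).
  by move=> c d e cd de; exact: liftable_glue2.
move=> t0 _; have [e e0 He] := strip t0; exists e => // c d *.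
by apply: He => //; lra.
Qed.

End Square.

Lemma lift_path (p : R -> X) (z0 : Z) : continuous p ->
  (forall s k, K k -> gm_act k.1 (p s) = p s) -> zfixed z0 -> lam z0 = p 0 ->
  exists q : R -> Z, [/\ continuous q, forall s, zfixed (q s),
    forall s, lam (q s) = p (clamp s) & q 0 = z0].
Proof.
move=> cp Kp fz0 lz0.
have cp1 : continuous (fun u : R * R => p u.1).
  exact: (continuous_comp1 cp continuous_fst).
have [f [cf Wf Lf]] := lift_square cp1 (fun u => Kp u.1) fz0 lz0.
have f00 : lam (f (0, 0)) = lam z0 by rewrite Lf lz0 -[clampi 0 1 _]/(clamp 0) clamp0.
exists (fun s => f (s, 0) .* bb_div (f (0, 0)) z0); split=> [|s|s|].
- apply: (continuous_comp2 (bb_ract_continuous (Z := Z))).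
    by apply: (continuous_comp2 cf) => s; [exact: cvg_id|exact: cvg_cst].
  by move=> s; exact: cvg_cst.
- exact: fixed_div.
- by rewrite bb_lambda_invariant Lf.
- by rewrite bb_ractK.
Qed.

(** Any lift of the square is off by an [H]-valued map along the three prescribed sides. A
    retraction of the square onto these sides extends this map to a correction of the whole lift;
    the side [s = 1] stays free. *)
Lemma lift_homotopy (F : R * R -> X) (p0 p1 : R -> Z) (z0 : Z) : continuous F ->
  (forall u k, K k -> gm_act k.1 (F u) = F u) ->
  continuous p0 -> continuous p1 ->
  (forall s, zfixed (p0 s)) -> (forall s, zfixed (p1 s)) ->
  (forall s, lam (p0 s) = F (clamp s, 0)) ->
  (forall s, lam (p1 s) = F (clamp s, 1)) ->
  p0 0 = z0 -> p1 0 = z0 -> (forall t, F (0, t) = lam z0) ->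
  exists f : R * R -> Z, [/\ continuous f, forall u, zfixed (f u) &
    [/\ forall u, lam (f u) = F (clamp u.1, clamp u.2),
        forall s, 0 <= s -> f (s, 0) = p0 s,
        forall s, 0 <= s -> f (s, 1) = p1 s &
        forall t, 0 <= t <= 1 -> f (0, t) = z0]].
Proof.
move=> cF KF cp0 cp1 W0 W1 L0 L1 p00 p10 F0.
have fz0 : zfixed z0 by rewrite -p00.
have [f [cf Wf Lf]] := lift_square cF KF fz0 (esym (F0 0)).
have {}Lf u : lam (f u) = F (clamp u.1, clamp u.2) by exact: Lf.
have cfs (t : R) : continuous (fun s => f (s, t)).
  by apply: (continuous_comp2 cf) => s; [exact: cvg_id|exact: cvg_cst].
have cft (s : R) : continuous (fun t => f (s, t)).
  by apply: (continuous_comp2 cf) => t; [exact: cvg_cst|exact: cvg_id].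
have E0 s : lam (f (s, 0)) = lam (p0 s) by rewrite Lf L0 clamp0.
have E1 s : lam (f (s, 1)) = lam (p1 s) by rewrite Lf L1 clamp1.
have Ez t : lam (f (0, t)) = lam z0 by rewrite Lf clamp0 F0.
pose c0 s := bb_div (f (s, 0)) (p0 s); pose c1 s := bb_div (f (s, 1)) (p1 s).
pose cz t := bb_div (f (0, t)) z0.
(* [c] is the correction along the three sides of the square, unfolded onto
   [-1, 2]; [r] maps the square onto them. *)
pose c (x : R) := if x <= 0 then c0 (- x) else if x <= 1 then cz x else c1 (x - 1).
pose r (u : R * R) : R := u.2 + u.1 * (2 * u.2 - 1).
have cc : continuous c.
  have cid : continuous (fun x : R => x) by move=> x; exact: cvg_id.
  have cc0 : continuous c0 by exact: bb_div_continuous.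
  have cc1 : continuous c1 by exact: bb_div_continuous.
  have ccz : continuous cz.
    by apply: bb_div_continuous => [//|t|//]; exact: cvg_cst.
  apply: continuous_paste => //.
  - by apply: (continuous_comp1 cc0) => x; apply: cvgN; exact: cvg_id.
  - apply: continuous_paste => //.
      by apply: (continuous_comp1 cc1) => x; apply: cvgB => //; exact: cvg_cst.
    by move=> x ->; rewrite subrr /cz /c1 p10.
  - by move=> x ->; rewrite oppr0 ler01 /cz /c0 p00.
have cr : continuous r.
  move=> u; apply: cvgD; first exact: cvg_snd.
  apply: cvgM; first exact: cvg_fst.
  by apply: cvgB; [apply: cvgM; [exact: cvg_cst|exact: cvg_snd]|exact: cvg_cst].
exists (fun u => f u .* c (r u)); split; last split.
- apply: (continuous_comp2 (bb_ract_continuous (Z := Z))) => //.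
  exact: continuous_comp1 cc cr.
- by move=> u; rewrite /c; case: ifP => _; [|case: ifP => _]; exact: fixed_div.
- by move=> u; rewrite bb_lambda_invariant.
- move=> s s0; rewrite /r /= (_ : 0 + _ = - s); last by ring.
  by rewrite /c oppr_le0 s0 opprK bb_ractK.
- move=> s s0; rewrite /r /= (_ : 1 + _ = 1 + s); last by ring.
  rewrite /c (_ : (1 + s <= 0) = false); last by apply/negbTE; rewrite -ltNge; lra.
  case: ifPn => [s1|_]; last by rewrite (_ : 1 + s - 1 = s) ?bb_ractK//; ring.
  have -> : s = 0 by lra.
  by rewrite addr0 p10 bb_ractK.
- move=> t /andP[t0 t1]; rewrite /r /= mul0r addr0 /c; case: ifPn => [t0'|_].
    have -> : t = 0 by lra.
    by rewrite oppr0 bb_ractK// p00.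
  by rewrite t1 bb_ractK.
Qed.

End Lifting.

(** * Coefficient systems and equivalences of categories *)

Section Equivalence.
Local Notation hom := Defs.hom.
Local Notation coef_map := Defs.coef_map.
Local Notation fmap := Defs.fmap.
Context {C D : category} (F : functor C D).

Lemma additive_inverse (U V : zmodType) (f : {additive U -> V}) :
  bijective f -> exists g : {additive V -> U}, cancel f g /\ cancel g f.
Proof.
move=> [g fK gK].
have gB : zmod_morphism g.
  by move=> u v; apply: (can_inj fK); rewrite raddfB !gK.
pose gA : {additive V -> U} := HB.pack g (GRing.isZmodMorphism.Build V U g gB).
by exists gA.
Qed.

Lemma naturally_isomorphic_sym (A B : coefficient_system C) :
  naturally_isomorphic A B -> naturally_isomorphic B A.
Proof.
move=> [t [bt nt]]; have g x := cid (additive_inverse (bt x)).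
exists (fun x => sval (g x)); split=> [x|x y f m].
  by have [tK gK] := svalP (g x); exists (t x).
have [tK gK] := svalP (g x); have [tK' gK'] := svalP (g y).
by apply: (can_inj tK); rewrite gK nt gK'.
Qed.

Lemma naturally_isomorphic_trans (A B E : coefficient_system C) :
  naturally_isomorphic A B -> naturally_isomorphic B E ->
  naturally_isomorphic A E.
Proof.
move=> [t [bt nt]] [u [bu nu]].
exists (fun x => (u x \o t x : {additive A x -> E x})); split=> [x|x y f m] /=.
  exact: (bij_comp (bu x) (bt x)).
by rewrite nt nu.
Qed.

Context
  (full : forall x y (h : hom (F x) (F y)), exists k, fmap F k = h)
  (faithful : forall x y (k k' : hom x y), fmap F k = fmap F k' -> k = k')
  (surj : forall d : D, exists c : C, F c = d).

(** The equation [F c = d] is eliminated here once; later arguments compose with [i] and [j] instead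
    of transporting hom types. *)
Let iso_surj d : {c : C & {i : hom (F c) d & {j : hom d (F c) |
  cmp i j = idm (F c) /\ cmp j i = idm d}}}.
Proof.
have [c <-] := cid (surj d); exists c, (idm (F c)), (idm (F c)).
by split; exact: cmp1m.
Qed.

Let c d : C := projT1 (iso_surj d).
Let i d : hom (F (c d)) d := projT1 (projT2 (iso_surj d)).
Let j d : hom d (F (c d)) := sval (projT2 (projT2 (iso_surj d))).

Let ij d : cmp (i d) (j d) = idm (F (c d)).
Proof. exact: (proj1 (svalP (projT2 (projT2 (iso_surj d))))). Qed.

Let ji d : cmp (j d) (i d) = idm d.
Proof. exact: (proj2 (svalP (projT2 (projT2 (iso_surj d))))). Qed.

Let lift x y (h : hom (F x) (F y)) : hom x y := sval (cid (full h)).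

Let liftK x y (h : hom (F x) (F y)) : fmap F (lift h) = h.
Proof. exact: svalP (cid (full h)). Qed.

Let conj d e (f : hom d e) : hom (c d) (c e) :=
  lift (cmp (cmp (i d) f) (j e)).

(** The system is [A] along the quasi-inverse [d |-> c d], [f |-> conj f], whose functoriality is
    tested after applying the faithful [F]. *)
Lemma pushforward_exists (A : coefficient_system C) :
  exists B : coefficient_system D, is_pushforward F A B.
Proof.
have bid d (m : A (c d)) : coef_map A (conj (idm d)) m = m.
  rewrite (_ : conj (idm d) = idm (c d)) ?coef_id//; apply: faithful.
  by rewrite liftK fmap_id cmpm1 ij.
have bcmp d e f (g : hom d e) (h : hom e f) (m : A (c f)) :
    coef_map A (conj (cmp g h)) m = coef_map A (conj g) (coef_map A (conj h) m).
  rewrite -coef_cmp; congr (coef_map A _ m); apply: faithful.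
  rewrite fmap_cmp !liftK !cmpA; congr (cmp (cmp _ _) _).
  by rewrite -[cmp (cmp (cmp _ _) (j e)) (i e)]cmpA ji cmpm1.
pose B := @CoefficientSystem D (fun d => A (c d))
  (fun d e f => coef_map A (conj f)) bid bcmp.
exists B.
(* The lift of [j (F x)] is an arrow from [x] to [c (F x)]; contravariance reverses it. *)
exists (fun x => coef_map A (lift (j (F x)))); split=> [x|x y f m].
  exists (coef_map A (lift (i (F x)))) => m; rewrite -coef_cmp.
    rewrite (_ : cmp _ _ = idm _) ?coef_id//; apply: faithful.
    by rewrite fmap_cmp !liftK fmap_id ij.
  rewrite (_ : cmp _ _ = idm _) ?coef_id//; apply: faithful.
  by rewrite fmap_cmp !liftK fmap_id ji.
rewrite /= -!coef_cmp; congr (coef_map A _ m); apply: faithful.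
by rewrite !fmap_cmp !liftK !cmpA ji cmp1m.
Qed.

(** Conjugation by [i] and [j] carries [t] to all objects of [D]. Naturality of [t] concerns arrows
    of [C], and fullness replaces any [f] by such an arrow, [conj f]. *)
Lemma pullback_reflects_iso (B B' : coefficient_system D) :
  naturally_isomorphic (pullback F B) (pullback F B') ->
  naturally_isomorphic B B'.
Proof.
move=> [t [bt nt]].
exists (fun d => (coef_map B' (j d) \o (t (c d) \o coef_map B (i d))
  : {additive B d -> B' d})); split=> [d|d e f m].
  have b1 : bijective (coef_map B (i d)).
    exists (coef_map B (j d)) => m; rewrite -coef_cmp ?ij ?ji; exact: coef_id.
  have b2 : bijective (coef_map B' (j d)).
    exists (coef_map B' (i d)) => m; rewrite -coef_cmp ?ij ?ji; exact: coef_id.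
  exact: (bij_comp b2 (bij_comp (bt (c d)) b1)).
have E : cmp (i d) f = cmp (fmap F (conj f)) (i e).
  by rewrite liftK -cmpA ji cmpm1.
have E' : cmp f (j e) = cmp (j d) (fmap F (conj f)).
  by rewrite liftK !cmpA ji cmp1m.
rewrite /= -coef_cmp E coef_cmp -[in RHS]coef_cmp E' coef_cmp.
by congr (coef_map B' _ _); exact: nt.
Qed.

Lemma pushforward_unique (A : coefficient_system C)
    (B B' : coefficient_system D) :
  is_pushforward F A B -> is_pushforward F A B' -> naturally_isomorphic B B'.
Proof.
move=> BA /naturally_isomorphic_sym AB'; apply: pullback_reflects_iso.
exact: naturally_isomorphic_trans BA AB'.
Qed.

End Equivalence.

Lemma closed_subgroup_eq (L : compactGroupType) (K K' : closed_subgroup L) :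
  (forall k, K k <-> K' k) -> K = K'.
Proof.
case: K K' => [K a b c d] [K' a' b' c' d'] /= KK'.
have E : K = K' by apply/funext => k; exact/propext.
case: K' / E a' b' c' d' {KK'} => *; congr ClosedSubgroup; exact: Prop_irrelevance.
Qed.

Lemma pi_ob_eq (L : compactGroupType) (M : gspace L) (x y : pi_ob M) :
  ob_grp x = ob_grp y -> ob_pt x = ob_pt y -> x = y.
Proof.
case: x y => [K p f] [K' p' f'] /= KK' pp'.
case: K' / KK' f' => f'; case: p' / pp' f' => f'.
by congr PiOb; exact: Prop_irrelevance.
Qed.

(** * The functor induced by the left leg *)

Section LeftFunctor.
Context {R : realType} {nG nH nX nY nZ : nat}.
Context {G : compactLieGroupType 'rV[R]_nG} {H : compactLieGroupType 'rV[R]_nH}.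
Context {X : gmanifold 'rV[R]_nX G} {Y : gmanifold 'rV[R]_nY H}.
Context (Z : bibundle 'rV[R]_nZ X Y).
Local Notation lam := (bb_lambda (Z := Z)).
Local Notation "z .* h" := (bb_ract (z : Z) h) (at level 40, left associativity).
Local Notation zact := (@act _ (bibundle_gspace Z)).
Local Notation F := (Pi_map R (left_functor Z)).
Local Notation image K := (image_subgroup (left_functor Z) K).

(** Freeness of the [H]-action. Membership in a projected subgroup is lifted back to the subgroup in
    this way. *)
Lemma zact_eq (u v : G * H) (z : Z) : zact u z = z -> zact v z = z ->
  u.1 = v.1 -> u = v.
Proof.
case: u v => [u1 u2] [v1 v2] /= uz vz uv; congr (_, _) => //.
by apply/invg_inj/(bb_ract_inj (z := bb_lact u1 z)); rewrite uz uv vz.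
Qed.

(** For [z] above [x], take the part of the stabiliser of [z] lying over [K]. It projects onto [K]:
    [k z] stays in the fibre of [z], and some [h] brings it back. *)
Lemma left_functor_surj (d : Pi R X) : exists c, F c = d.
Proof.
case: d => K x fx; have [z zx] := bb_lambda_surjective Z x.
pose S (u : G * H) : Prop := K u.1 /\ zact u z = z.
have S1 : S 1%g by split; [exact: csg1|exact: act1].
have SM a b : S a -> S b -> S (a * b)%g.
  by move=> [Ka az] [Kb bz]; split; [exact: csgM|rewrite actM bz].
have SV a : S a -> S a^-1%g.
  by move=> [Ka az]; split; [exact: csgV|rewrite -{1}az -actM mulVg act1].
have clS : closed (S : set (G * H)%type).
  move=> u clu; split.
    apply: (@csg_closed _ K) => A nA.
    have nA' : nbhs u (fst @^-1` A) := @continuous_fst G H u _ nA.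
    by have [v [[Kv _] Av]] := clu _ nA'; exists v.1.
  apply: (@manifold_hausdorff _ _ Z) => A B nA nB.
  have cz : continuous (fun v => zact v z).
    apply: (continuous_comp2 (@act_continuous _ (bibundle_gspace Z))) => v.
      exact: cvg_id.
    exact: cvg_cst.
  have [v [[_ vz] Av]] := clu _ (cz u _ nA).
  by exists z; split; [rewrite -vz|exact: nbhs_singleton nB].
pose K' := ClosedSubgroup clS S1 SM SV.
have fz u : K' u -> zact u z = z by case.
exists (PiOb fz); apply: pi_ob_eq => //=; apply: closed_subgroup_eq => k.
split=> [[u [Ku _] <-]//|Kk].
have : lam z = lam (bb_lact k z).
  by rewrite bb_lambda_equivariant zx (fx k Kk : gm_act k x = x).
move=> /bb_ract_trans[h zh]; exists (k, h)%type => //; split=> //=.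
by rewrite -zh -bb_ractM mulgV bb_ract1.
Qed.

Lemma left_functor_full (x y : Pi R (bibundle_gspace Z))
  (h : Defs.hom (F x) (F y)) : exists k, Defs.fmap F k = h.
Proof.
pose a := repr (h : arrow R (F x : pi_ob X) (F y)).
have [q [cq fq lq q0]] := lift_path (Z := Z) (K := ob_grp x) (p := ext_path a)
  (z0 := ob_pt x) (@ext_path_continuous _ _ _ _ _ a)
  (fun s k Kk => @ext_path_fixed _ _ _ _ _ a s _ (ex_intro2 _ _ k Kk erefl))
  (fun k Kk => ob_fixed Kk) ltac:(by rewrite /ext_path clamp0 arr_path0).
have lq1 : lam (bb_lact (arr_g a) (ob_pt y)) = lam (q 1).
  by rewrite lq /ext_path !clamp1 arr_path1 bb_lambda_equivariant.
have [m qm] := bb_ract_trans lq1.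
pose g : G * H := (arr_g a, m^-1%g).
have gy : q 1 = zact g (ob_pt y) by rewrite /= invgK.
(* The conjugate of [k] fixes the point of [y], since the lifted path ends at a fixed point. It
   shares its [G]-component with some [l] in the group of [y], hence equals [l]. *)
have sg : subconj (ob_grp x) (ob_grp y) g.
  move=> k Kk; set u := (g^-1 * k * g)%g.
  have uy : zact u (ob_pt y) = ob_pt y.
    by rewrite /u !actM -gy fq// gy -actM mulVg act1.
  have [|l Kl lu] := @arr_subconj _ _ _ _ _ a k.1; first by exists k.
  suff -> : u = l by [].
  by apply: zact_eq uy (ob_fixed Kl) _; rewrite -[l.1]/(ef_hom (left_functor Z) l) lu.
pose b := @PreArrow R _ (bibundle_gspace Z) x y g q sg (continuous_subspaceT cq)
  (fun s _ => fq s) q0 gy.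
exists (arrow_class b); rewrite [LHS]pi_fmap_class -[h]arrow_repr -/a.
apply/arrow_eqP; apply: (@homotopic_reparam _ _ _ _ _ _ _ id) => //.
  by move=> s; exact: cvg_id.
by move=> s Is /=; rewrite lq /ext_path !clampE// clampE.
Qed.

(** [Phi] lifts with three sides prescribed, and the free side [f (1, t)] dictates the lift of
    [Psi]: [q t] is the only coset over [P t] carrying [y0] to [f (1, t)]. *)
Lemma left_functor_faithful (x y : Pi R (bibundle_gspace Z))
  (k k' : Defs.hom x y) : Defs.fmap F k = Defs.fmap F k' -> k = k'.
Proof.
rewrite -[k]arrow_repr -[k']arrow_repr.
set a := repr (k : arrow R (x : pi_ob _) y); set b := repr (k' : arrow R (x : pi_ob _) y).
rewrite /= [LHS]pi_fmap_class [RHS]pi_fmap_class => /arrow_eqP/homotopic_global.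
move=> [Psi [Phi [cS eS S0 S1 cF fF F0 F1 F_0 F_1]]].
pose K := ob_grp x; pose L := ob_grp y; pose y0 : Z := ob_pt y.
have KF u k1 : K k1 -> gm_act k1.1 (Phi u) = Phi u.
  by case: u => s t Kk1; apply: fF; exists k1.
have [f [cf fixf [lf f0 f1 fz]]] := lift_homotopy (Z := Z) (F := Phi)
  (p0 := ext_path a) (p1 := ext_path b) (z0 := ob_pt x) cF KF
  (@ext_path_continuous _ _ _ _ _ a) (@ext_path_continuous _ _ _ _ _ b)
  (@ext_path_fixed _ _ _ _ _ a) (@ext_path_fixed _ _ _ _ _ b)
  (fun s => ltac:(by rewrite F0 (clampE (clamp_unitI s))))
  (fun s => ltac:(by rewrite F1 (clampE (clamp_unitI s))))
  ltac:(by rewrite /ext_path clamp0 arr_path0)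
  ltac:(by rewrite /ext_path clamp0 arr_path0) F_0.
pose e : Defs.orbit (image K) := coset (image K) 1%g.
pose P t : Defs.orbit (image L) := Psi (e, clamp t).
have lf1 t g : coset (image L) g = P t -> lam (bb_lact g y0) = lam (f (1, t)).
  move=> gP; rewrite lf /= clamp1 F_1 -/e -/(P t) -gP.
  by rewrite (@ob_map_coset _ X (pi_fobj (left_functor Z) y)) bb_lambda_equivariant.
have /choice[h Hh] t : exists h, zact (repr (P t), h) y0 = f (1, t).
  have [m <-] := bb_ract_trans (lf1 t _ (coset_repr (P t))).
  by exists m^-1%g; rewrite /= invgK.
pose q t : orbit_gspace L := coset L (repr (P t), h t).
have quniq t g m : coset (image L) g = P t -> zact (g, m) y0 = f (1, t) ->
    coset L (g, m) = q t.
  rewrite -[P t]coset_repr => /coset_eqP[l Ll lE] gm.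
  apply/coset_eqP; set u := (_ * _)%g.
  suff -> : u = l by [].
  apply: (@zact_eq _ _ y0) (ob_fixed Ll) _ => //.
  by rewrite /u actM Hh -gm -actM mulVg act1.
(* The choice [repr (P t)] may jump with [t]. By [quniq] any representative of [P t] will do, and
   openness of the coset map provides one close to [repr (P t0)]. *)
have cq : continuous q.
  move=> t0 W nW.
  have [[U V] [/= nU nV] UVW] := @coset_continuous _ L (repr (P t0), h t0) _ nW.
  have div0 : bb_div (bb_lact (repr (P t0)) y0) (f (1, t0)) = (h t0)^-1%g.
    by rewrite -Hh /= bb_div_ract.
  have nO : nbhs (bb_div (bb_lact (repr (P t0)) y0) (f (1, t0)))
      ((fun m : H => m^-1%g) @^-1` V).
    by rewrite div0; apply: (@invg_continuous H); rewrite invgK.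
  have nd := bb_div_near
    (u := (bb_lact (repr (P t0)) y0, f (1, t0))) (lf1 t0 _ (coset_repr (P t0))) nO.
  have ct : continuous (fun w : G * R => (bb_lact w.1 y0, f (1, w.2))).
    apply: continuous_pair.
      apply: (continuous_comp2 (smooth_continuous (bb_lact_smooth (Z := Z)))).
        exact: continuous_fst.
      by move=> w; exact: cvg_cst.
    apply: (continuous_comp2 cf) continuous_snd => w; exact: cvg_cst.
  have [[A T] [/= nA nT] AT] := ct (repr (P t0), t0) _ nd.
  have cP : continuous P.
    apply: (continuous_comp2 cS) => [t|]; [exact: cvg_cst|exact: clamp_continuous].
  have nP : \forall t \near t0, (coset (image L) @` (U `&` A)) (P t).
    exact: cP t0 _ (nbhs_coset (filterI nU nA)).
  have {}nT : \forall t \near t0, T t by exact: nT.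
  suff : \forall t \near t0, W (q t) by [].
  apply: filterS2 nP nT => t [g [Ug Ag] gP] Tt.
  have lfg := lf1 t g gP; have Vg := AT (g, t) (conj Ag Tt) lfg.
  rewrite -(quniq t g (bb_div (bb_lact g y0) (f (1%R, t)))^-1%g gP).
    exact: (UVW (_, _)).
  by rewrite /= invgK bb_ractK.
have fq t : fixed (X := orbit_gspace L) K (q t).
  move=> u Ku; rewrite /= /q translate_coset; apply: quniq.
    rewrite /= -translate_coset coset_repr /P -eS translate_coset mulg1.
    congr (Psi (_, _)); apply/esym/coset_eqP; rewrite invg1 mul1g.
    by exists u.
  by rewrite -[LHS]/(zact (u * (repr (P t), h t))%g y0) actM Hh fixf.
have obq t : ob_map (q t) = f (1, t) by rewrite ob_map_coset Hh.
have q0 : q 0 = coset L (arr_g a).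
  rewrite [arr_g a]surjective_pairing; apply/esym/quniq.
    rewrite /P clamp0 S0 /arr_map (orbit_map_coset _ (arr_subconj (pre_map _ a))).
    by rewrite mul1g.
  by rewrite -surjective_pairing f0// /ext_path clamp1 arr_path1.
have q1 : q 1 = coset L (arr_g b).
  rewrite [arr_g b]surjective_pairing; apply/esym/quniq.
    rewrite /P clamp1 S1 /arr_map (orbit_map_coset _ (arr_subconj (pre_map _ b))).
    by rewrite mul1g.
  by rewrite -surjective_pairing f1// /ext_path clamp1 arr_path1.
apply/arrow_eqP.
(* An equivariant map out of the orbit of [K] amounts to a [K]-fixed point of the target, so the
   path [q] of fixed points is the required homotopy of orbit maps. *)
exists (fun w => act (repr w.1) (q w.2)), f; split=> /=.
- apply: continuous_subspaceT;
  apply: (@repr_act_continuous _ (orbit_gspace L) _ _ fst (q \o snd)) => [||w].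
  + exact: continuous_fst.
  + exact: (continuous_comp1 cq continuous_snd).
  + exact: fq.
- move=> g d t _; apply: (etrans (act_repr (g * repr d)%g (fq t))).
  exact: (@actM _ (orbit_gspace L)).
- by move=> d; rewrite q0 translate_coset.
- by move=> d; rewrite q1 translate_coset.
- exact: continuous_subspaceT.
- by move=> s t _ _; exact: fixf.
- by move=> s Is; have /unitIP/andP[s0 _] := Is; rewrite f0// /ext_path clampE.
- by move=> s Is; have /unitIP/andP[s0 _] := Is; rewrite f1// /ext_path clampE.
- by move=> t /unitIP It; rewrite fz.
- move=> t It; have Et := etrans (act_repr 1%g (fq t)) (@act1 _ (orbit_gspace L) _).
  by rewrite -obq; exact: (congr1 (@ob_map _ _ y) (esym Et)).
Qed.

End LeftFunctor.

Theorem proposition4p9 (R : realType) (nG nH nX nY nZ : nat)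
    (G : compactLieGroupType 'rV[R]_nG) (H : compactLieGroupType 'rV[R]_nH)
    (X : gmanifold 'rV[R]_nX G) (Y : gmanifold 'rV[R]_nY H)
    (Z : bibundle 'rV[R]_nZ X Y)
    (A : coefficient_system (Pi R (bibundle_gspace Z))) :
  (exists B : coefficient_system (Pi R X),
     is_pushforward (Pi_map R (left_functor Z)) A B) /\
  (forall B B' : coefficient_system (Pi R X),
     is_pushforward (Pi_map R (left_functor Z)) A B ->
     is_pushforward (Pi_map R (left_functor Z)) A B' ->
     naturally_isomorphic B B').
Proof.
have full := @left_functor_full R nG nH nX nY nZ G H X Y Z.
have faithful := @left_functor_faithful R nG nH nX nY nZ G H X Y Z.
have surj := left_functor_surj Z.
split; first exact: pushforward_exists full faithful surj A.
exact: pushforward_unique full surj A.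
Qed.
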